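(* Let $G$ be an $n$-unexceptional $2$-connected graph of order $n \ge 10$. Then $\eta(G) \ge 2n$.
   Context: All graphs are finite, simple and connected; the order of a graph is its number of vertices. Let $d_G(u,v)$ be the usual shortest-path distance. The Wiener index is $W(G)=\sum_{\{u,v\}\subseteq V(G)} d_G(u,v)$, the sum being over unordered pairs of distinct vertices. For an edge $ab\in E(G)$ let $n_{ab}(a)=|\{c\in V(G): d_G(c,a)<d_G(c,b)\}|$ and $n_{ab}(b)=|\{c\in V(G): d_G(c,b)<d_G(c,a)\}|$. The Szeged index is $Sz(G)=\sum_{ab\in E(G)} n_{ab}(a)\,n_{ab}(b)$. The Szeged--Wiener gap is $\eta(G)=Sz(G)-W(G)$. For integers $n,t$ with $1\le t\le n-1$, $K_n^t$ denotes the graph of order $n$ obtained from the complete graph $K_{n-1}$ by adding one new vertex adjacent to exactly $t$ vertices of $K_{n-1}$. A graph $G$ is $n$-exceptional if it is isomorphic to one of $K_n$, $K_n^2$, $K_n^{n-2}$, and $n$-unexceptional otherwise. *)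

(* Defs.v *)
From HB Require Import structures.
From mathcomp Require Import all_boot all_order all_algebra.

Set Implicit Arguments.
Unset Strict Implicit.
Unset Printing Implicit Defensive.

Record sgraph := SGraph {
  svertex :> finType;
  adj : rel svertex;
  adj_sym : symmetric adj;
  adj_irrefl : irreflexive adj
}.

Section GraphNotions.
Variable G : sgraph.

Definition induced_connected (A : {set G}) : Prop :=
  {in A &, forall x y : G,
     connect [rel u v | [&& adj u v, u \in A & v \in A]] x y}.

Definition k_connected (k : nat) : Prop :=
  k < #|G| /\ forall S : {set G}, #|S| < k -> induced_connected (~: S).

Definition has_walk (k : nat) (x y : G) : bool :=
  [exists p : k.-tuple G, path (@adj G) x p && (last x p == y)].

(* Least length of a walk from x to y.  Such a length is < #|G| when x and y
   lie in the same component; otherwise the value is #|G|. *)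
Definition dist (x y : G) : nat :=
  find (fun k => has_walk k x y) (iota 0 #|G|).

(* Selects one ordered representative of each unordered pair of distinct
   vertices, for sums whose general term is symmetric. *)
Definition upair (x y : G) : bool := enum_rank x < enum_rank y.

Definition wiener : nat := \sum_(x : G) \sum_(y : G | upair x y) dist x y.

Definition ncloser (a b : G) : nat := #|[set c : G | dist c a < dist c b]|.

Definition szeged : nat :=
  \sum_(a : G) \sum_(b : G | upair a b && adj a b) ncloser a b * ncloser b a.

Definition sw_gap : int := (szeged%:Z - wiener%:Z)%R.

End GraphNotions.

Definition isomorphic (G H : sgraph) : Prop :=
  exists2 f : G -> H, bijective f & forall x y, adj (f x) (f y) = adj x y.

Section CompleteGraph.
Variable n : nat.

Definition complete_adj : rel 'I_n := [rel i j | i != j].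

Lemma complete_adj_sym : symmetric complete_adj.
Proof. by move=> i j; rewrite /complete_adj /= eq_sym. Qed.

Lemma complete_adj_irrefl : irreflexive complete_adj.
Proof. by move=> i; rewrite /complete_adj /= eqxx. Qed.

Definition complete_graph : sgraph :=
  SGraph complete_adj_sym complete_adj_irrefl.

End CompleteGraph.

(* K_n^t, for 1 <= t <= n - 1: the vertices [Some i] form K_{n-1}, and the new
   vertex [None] is adjacent to the first t of them. *)
Section CompletePlusVertex.
Variables n t : nat.

Definition complete_plus_adj : rel (option 'I_n.-1) := fun u v =>
  match u, v with
  | Some i, Some j => i != j
  | Some i, None | None, Some i => i < t
  | None, None => false
  end.

Lemma complete_plus_adj_sym : symmetric complete_plus_adj.
Proof. by move=> [i|] [j|] //=; rewrite eq_sym. Qed.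

Lemma complete_plus_adj_irrefl : irreflexive complete_plus_adj.
Proof. by move=> [i|] //=; rewrite eqxx. Qed.

Definition complete_plus : sgraph :=
  SGraph complete_plus_adj_sym complete_plus_adj_irrefl.

End CompletePlusVertex.

Definition exceptional (n : nat) (G : sgraph) : Prop :=
  [\/ isomorphic G (complete_graph n),
      isomorphic G (complete_plus n 2)
    | isomorphic G (complete_plus n (n - 2))].

(* Main.v *)
Require Import Defs.
From mathcomp Require Import all_boot all_order all_algebra zify.
From Stdlib Require Import Classical.

Set Implicit Arguments.
Unset Strict Implicit.
Unset Printing Implicit Defensive.

(** Write the Szeged index as the number of triples (x, y, ab) where the oriented
edge ab leads away from x and towards y.  A pair (x, y) at distance d has at
least d such edges, one for each level of a geodesic, so the gap is half the sum
over ordered pairs of the excess [exc], and it is enough to bound this sum below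
by 4n.  The excess restricted to edges inside a vertex set S (distances being
taken in G) grows with S, so S is enlarged within the 2-connected induced
subgraphs until it is everything.  If S is not complete, the sum grows by at
least 4 per new vertex, and by at least 6 when G has neither an isometric 4-cycle
nor an isometric cycle of length at least 6: one adds either a single vertex with
two neighbours in S or, when there is none, an ear taken from an isometric cycle
that leaves S.  One starts from an isometric cycle of length
4 or at least 6 (total 4|S|), from an isometric pentagon (10 = 6 * 5 - 20), or,
when there is none of these, from a maximum clique with two further vertices
(at least 6|S| - 20); finally 6n - 20 >= 4n for n >= 10.  The only graphs where
the last start is impossible are complete or a clique plus one vertex. *)

(* [lia] preprocesses every hypothesis, which is prohibitive in the large contexts
   below; keep only those about natural numbers. *)
Ltac nlia := repeat match goal with H : ?T |- _ => lazymatch T with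
  | is_true (leq _ _) => fail
  | is_true (andb (leq _ _) (leq _ _)) => fail
  | is_true (orb (leq _ _) (leq _ _)) => fail
  | @eq bool (leq _ _) _ => fail
  | is_true (negb (leq _ _)) => fail
  | @eq nat _ _ => fail
  | nat => fail
  | _ => clear H
  end end; lia.

(** Since distances never change, an edge counted for a pair stays counted when [S] grows, and a
    step only has to exhibit new edges or new pairs. The excess subtracts the number of geodesic
    levels realized in [S], not the distance, because an induced subgraph need not contain a
    geodesic between its vertices; this is what makes it monotone in [S]. Noncompleteness has to be
    carried along because a vertex joined to all of a clique gains nothing. The rate 4 suffices only
    from a start without deficit. Each vertex of an isometric 4-cycle, or of an isometric cycle of
    length at least 6, contributes 4, but a vertex of a pentagon only 2: on an odd cycle a pair at
    distance 2 has a single good edge on the longer arc. The rate 6 repays that deficit, and its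
    proof uses the absence of the very cycles that give a start without deficit. 2-connectedness
    provides two different attachments for any part of [S], so that a path can be exploited from
    both ends. *)

Lemma least_nat (P : nat -> Prop) :
  (exists n, P n) -> exists2 n, P n & forall m, P m -> n <= m.
Proof.
case=> n; elim/ltn_ind: n => n IH Pn.
case: (classic (exists2 m, m < n & P m)) => [[m lt_mn /IH]|no]; first exact.
exists n => // m Pm; case: leqP => // lt_mn; case: no; by exists m.
Qed.

(** * Walks, connectivity and distance *)

Section Walks.
Variable G : sgraph.
Implicit Types (A B S : {set G}) (x y v : G).

Lemma adjC x y : adj x y = adj y x. Proof. exact: adj_sym. Qed.

Lemma adjN x y : adj x y -> x != y.
Proof. by apply: contraTneq => ->; rewrite adj_irrefl. Qed.

Definition walk A n x y := exists p : nat -> G,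
  [/\ p 0 = x, p n = y, forall i, i <= n -> p i \in A
    & forall i, i < n -> adj (p i) (p i.+1)].

Lemma walk0 A x : x \in A -> walk A 0 x x.
Proof. by move=> Ax; exists (fun=> x); split. Qed.

Lemma walk1 A x y : x \in A -> y \in A -> adj x y -> walk A 1 x y.
Proof.
move=> Ax Ay xy; exists (fun i => if i is 0 then x else y).
by split=> // [[|i]|[|i]].
Qed.

Lemma walk_cat A m n x y v : walk A m x y -> walk A n y v -> walk A (m + n) x v.
Proof.
move=> [p [p0 pm Ap adp]] [q [q0 qn Aq adq]].
exists (fun i => if i <= m then p i else q (i - m)); split=> [|||].
- by rewrite leq0n.
- case: leqP => [le|_]; last by rewrite addKn.
  by have n0 : n = 0 by [lia]; rewrite n0 addn0 pm -qn n0 q0.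
- move=> i le_i; case: leqP => [|lt]; first exact: Ap.
  by apply: Aq; lia.
move=> i; case: (ltngtP i m) => [lt|gt|->] lt_i.
- by apply: adp.
- by rewrite subSn ?(ltnW gt) //; apply: adq; lia.
- by rewrite subSnn pm -q0; apply: adq; lia.
Qed.

Lemma walk_rev A n x y : walk A n x y -> walk A n y x.
Proof.
move=> [p [p0 pn Ap adp]]; exists (fun i => p (n - i)); split.
- by rewrite subn0.
- by rewrite subnn.
- by move=> i _; apply: Ap; lia.
move=> i lt_i; have -> : n - i = (n - i.+1).+1 by lia.
by rewrite adjC; apply: adp; lia.
Qed.

Lemma walk_sub A (p : nat -> G) i j :
  i <= j -> (forall t, i <= t <= j -> p t \in A) ->
  (forall t, i <= t < j -> adj (p t) (p t.+1)) -> walk A (j - i) (p i) (p j).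
Proof.
move=> le_ij Ap adp; exists (fun t => p (i + t)); split.
- by rewrite addn0.
- by rewrite subnKC.
- by move=> t le_t; apply: Ap; lia.
by move=> t lt_t; rewrite addnS; apply: adp; lia.
Qed.

Lemma path_walk A x p : {subset x :: p <= A} -> path (@adj G) x p ->
  walk A (size p) x (last x p).
Proof.
move=> sA pp; exists (nth x (x :: p)); split=> //.
- by rewrite (last_nth x).
- by move=> i le_i; apply: sA; apply: mem_nth.
by move=> i lt_i; have /pathP := pp; apply.
Qed.

Lemma has_walkP n x y : reflect (walk setT n x y) (has_walk n x y).
Proof.
apply: (iffP existsP) => [[p /andP[pp /eqP <-]]|[p [<- <- _ adp]]].
  have sT : {subset x :: p <= [set: G]} by move=> v _; apply: in_setT.
  by have := path_walk sT pp; rewrite size_tuple.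
have sz : size (mkseq (fun i => p i.+1) n) == n by rewrite size_mkseq.
exists (Tuple sz) => /=; apply/andP; split.
  apply/(pathP (p 0)) => i; rewrite size_mkseq => lt_i.
  by case: i lt_i => [|i] lt_i /=; rewrite !nth_mkseq ?adp //; lia.
rewrite (last_nth (p 0)) size_mkseq.
by case: n {adp sz} => [|n] //=; rewrite nth_mkseq.
Qed.

Lemma dist_le n x y : walk setT n x y -> dist x y <= n.
Proof.
move=> /has_walkP w; case: (ltnP n #|G|) => [lt_n|]; last first.
  by apply: leq_trans; rewrite -[leqRHS](size_iota 0); apply: find_size.
rewrite leqNgt; apply/negP => /(before_find 0).
by rewrite nth_iota // w.
Qed.

(* Connectedness of the subgraph induced on [A], as a cut property. *)
Definition conn A := forall (X : {set G}) x y, x \in A -> x \in X ->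
  y \in A -> y \notin X ->
  exists u v, [/\ u \in A, u \in X, v \in A, v \notin X & adj u v].

Lemma conn_walk A x y : conn A -> x \in A -> y \in A -> exists n, walk A n x y.
Proof.
move=> cA Ax Ay; pose e := [rel u v : G | [&& adj u v, u \in A & v \in A]].
pose X := [set v | connect e x v].
case: (boolP (y \in X)) => [|yX]; last first.
  have [|u [v [Au uX Av vX uv]]] := cA X x y Ax _ Ay yX; first by rewrite inE.
  case/negP: vX; move: uX; rewrite !inE => /connect_trans; apply.
  by apply: connect1; rewrite /= uv Au.
rewrite inE => /connectP[p ep ->]; exists (size p); apply: path_walk.
  elim: p x {X} Ax ep => [|z p IH] x Ax /=.
    by move=> _ v; rewrite inE => /eqP->.
  move=> /andP[/and3P[_ _ Az] /(IH z Az) sA] v.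
  by rewrite inE => /orP[/eqP->|/sA].
by apply: sub_path ep => u v /and3P[].
Qed.

Lemma induced_conn A : induced_connected A -> conn A.
Proof.
move=> iA X x y Ax Xx Ay nXy; have /connectP[p ep Ey] := iA x y Ax Ay.
elim: p x Ax Xx ep Ey => [|z p IH] x Ax Xx /=.
  by move=> _ Ey; rewrite Ey Xx in nXy.
move=> /andP[/and3P[xz _ Az] ep] Ey; case: (boolP (z \in X)) => zX.
  exact: IH zX ep Ey.
by exists x, z; split.
Qed.

Lemma connU A B w : conn A -> conn B -> w \in A -> w \in B -> conn (A :|: B).
Proof.
move=> cA cB Aw Bw X x y ABx Xx ABy nXy.
have wl (C D : {set G}) : conn C -> C \subset D -> (exists2 x, x \in C & x \in X) ->
    (exists2 y, y \in C & y \notin X) ->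
    exists u v, [/\ u \in D, u \in X, v \in D, v \notin X & adj u v].
  move=> cC sub [x' Cx' Xx'] [y' Cy' Xy']; have sCD := subsetP sub.
  have [u [v [Cu Xu Cv Xv uv]]] := cC X x' y' Cx' Xx' Cy' Xy'.
  by exists u, v; split; auto.
case: (boolP (w \in X)) => Xw.
  move: ABy; rewrite inE => /orP[Ay|By].
    by apply: (wl A); rewrite ?subsetUl //; [exists w | exists y].
  by apply: (wl B); rewrite ?subsetUr //; [exists w | exists y].
move: ABx; rewrite inE => /orP[Ax|Bx].
  by apply: (wl A); rewrite ?subsetUl //; [exists x | exists w].
by apply: (wl B); rewrite ?subsetUr //; [exists x | exists w].
Qed.

Lemma conn1 x : conn [set x].
Proof. by move=> X u v /set1P-> Xu /set1P-> /negP[]. Qed.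

Lemma conn_add A x a : conn A -> a \in A -> adj x a -> conn (x |: A).
Proof.
move=> cA Aa xa; have cxa : conn [set x; a].
  move=> X u v; rewrite !inE => /orP[]/eqP-> Xu /orP[]/eqP-> Xv.
  - by rewrite Xu in Xv.
  - by exists x, a; rewrite !inE !eqxx orbT.
  - by exists a, x; rewrite !inE !eqxx orbT adjC.
  - by rewrite Xu in Xv.
have := connU cA cxa Aa; rewrite !inE eqxx orbT => /(_ isT).
congr conn; apply/setP => u; rewrite !inE.
by case: eqP => //= _; rewrite ?orbT // orbC; case: eqP => // ->.
Qed.

Lemma conn_seg (p : nat -> G) n :
  (forall i, i < n -> adj (p i) (p i.+1)) -> conn [set p i | i : 'I_n.+1].
Proof.
elim: n => [|n IH] adp.
  by have -> : [set p i | i : 'I_1] = [set p 0];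
    [apply/setP => u; apply/imsetP/set1P => [[i _ ->]|->];
      [rewrite ord1 | exists ord0] | exact: conn1].
have -> : [set p i | i : 'I_n.+2] = p n.+1 |: [set p i | i : 'I_n.+1].
  apply/setP => u; rewrite !inE; apply/imsetP/orP => [[i _ ->]|].
    case: (ltnP i n.+1) => lt_i; last first.
      by left; apply/eqP; congr p; have := ltn_ord i; lia.
    by right; apply/imsetP; exists (Ordinal lt_i).
  case=> [/eqP->|/imsetP[i _ ->]]; first by exists ord_max.
  by exists (widen_ord (leqnSn _) i).
apply: (@conn_add _ _ (p n)); last by rewrite adjC adp.
  by apply: IH => i lt_i; apply: adp; lia.
by apply/imsetP; exists ord_max.
Qed.

(** No minimal size is required, so every clique qualifies. *)
Definition conn2 A := conn A /\ forall v, conn (A :\ v).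

Lemma conn2_add A x a b : conn2 A -> a \in A -> b \in A -> a != b ->
  adj x a -> adj x b -> conn2 (x |: A).
Proof.
move=> [cA cA1] Aa Ab nab xa xb; split; first exact: conn_add xa.
move=> v; case: (eqVneq v x) => [->|nvx].
  suff -> : (x |: A) :\ x = A :\ x by [].
  by apply/setP => u; rewrite !inE; case: eqP.
have -> : (x |: A) :\ v = x |: (A :\ v).
  by apply/setP => u; rewrite !inE; case: (eqVneq u x) => //= ->; rewrite eq_sym nvx.
case: (eqVneq a v) => [Eav|nav]; last by apply: (@conn_add _ _ a); rewrite ?inE ?nav.
by apply: (@conn_add _ _ b); rewrite ?inE ?Ab ?andbT // -Eav eq_sym.
Qed.

(** Whichever vertex is deleted, one of the two shared vertices survives and glues the two parts. *)
Lemma conn2U A B a b : conn2 A -> conn2 B -> a != b ->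
  a \in A -> a \in B -> b \in A -> b \in B -> conn2 (A :|: B).
Proof.
move=> [cA cA1] [cB cB1] nab Aa Ba Ab Bb; split; first exact: connU Aa Ba.
move=> v; rewrite setDUl; case: (eqVneq a v) => [Eav|nav].
  by apply: (@connU _ _ b) => //; rewrite !inE -Eav eq_sym nab.
by apply: (@connU _ _ a) => //; rewrite !inE nav.
Qed.

(* The cut property applied to the closed neighbourhood of [x]. *)
Lemma conn_P3 A x y : conn A -> x \in A -> y \in A -> x != y -> ~~ adj x y ->
  exists u v, [/\ u \in A, v \in A, adj x u && adj u v, x != v & ~~ adj x v].
Proof.
move=> cA Ax Ay nxy naxy; pose X := [set v | (v == x) || adj x v].
have [||u [v [Au]]] := cA X x y Ax _ Ay; rewrite ?inE ?eqxx // ?negb_or.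
  by rewrite eq_sym nxy.
rewrite eq_sym => /orP[/eqP<-|xu] Av /andP[nvx nxv] uv.
  by rewrite uv in nxv.
by exists u, v; rewrite xu uv eq_sym.
Qed.

End Walks.

(** * Graph distance and geodesics *)

Section Metric.
Variable G : sgraph.
Hypothesis cG : conn [set: G].
Implicit Types (A S : {set G}) (x y v : G).

(** A walk shortened to one without repeated vertices has fewer than [#|G|] edges, so in a connected
    graph the search in [dist] never returns its default value. *)
Lemma dist_lt x y : dist x y < #|G|.
Proof.
have [n [p [p0 pn _ adp]]] := conn_walk cG (in_setT x) (in_setT y).
have : exists2 s, path (@adj G) x s & last x s = y.
  exists (mkseq (fun i => p i.+1) n).
    apply/(pathP x) => i; rewrite size_mkseq => lt_i.
    by case: i lt_i => [|i] lt_i /=; rewrite !nth_mkseq -?p0 ?adp //; lia.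
  rewrite (last_nth x) size_mkseq.
  by case: n {adp} pn => [|n] /= pn; rewrite ?nth_mkseq // -p0.
case=> s ps <-; case: (shortenP ps) => s' ps' us' _.
have lt_s' : size s' < #|G|.
  by have := card_uniqP us' => /= <-; apply: max_card.
apply: leq_ltn_trans lt_s'; apply: dist_le; apply: path_walk => // v _.
exact: in_setT.
Qed.

Lemma dist_walk x y : walk setT (dist x y) x y.
Proof.
apply/has_walkP; have lt := dist_lt x y.
have /(nth_find 0) : has (fun k => has_walk k x y) (iota 0 #|G|).
  by rewrite has_find size_iota.
by rewrite nth_iota.
Qed.

Lemma distxx x : dist x x = 0.
Proof. by apply/eqP; rewrite -leqn0; apply: dist_le; apply: walk0. Qed.

Lemma dist0 x y : (dist x y == 0) = (x == y).
Proof.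
apply/eqP/eqP => [E|->]; last exact: distxx.
by have := dist_walk x y; rewrite E => -[p [<- <-]].
Qed.

Lemma distC x y : dist x y = dist y x.
Proof.
by apply/eqP; rewrite eqn_leq; apply/andP; split; apply: dist_le;
  apply: walk_rev; apply: dist_walk.
Qed.

Lemma dist_tri v x y : dist x y <= dist x v + dist v y.
Proof. by apply: dist_le; apply: walk_cat; apply: dist_walk. Qed.

Lemma adj_dist x y : adj x y = (dist x y == 1).
Proof.
apply/idP/eqP => [xy|E].
  apply/eqP; rewrite eqn_leq; apply/andP; split.
    by apply: dist_le; apply: walk1.
  by rewrite lt0n dist0 adjN.
have := dist_walk x y; rewrite E => -[p [<- <- _ adp]]; exact: adp.
Qed.

Lemma adj_dist1 x y : adj x y -> dist x y = 1.
Proof. by rewrite adj_dist => /eqP. Qed.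

Lemma dist_adj x a b : adj a b -> dist x b <= (dist x a).+1.
Proof. by move=> ab; have := dist_tri a x b; rewrite (adj_dist1 ab) addn1. Qed.

Lemma dist_ge2 x y : x != y -> ~~ adj x y -> 2 <= dist x y.
Proof.
by move=> nxy; rewrite adj_dist => naxy; move: nxy; rewrite -dist0; lia.
Qed.

Lemma dist2 c x y : x != y -> ~~ adj x y -> adj x c -> adj c y -> dist x y = 2.
Proof.
move=> nxy naxy xc cy; have := dist_ge2 nxy naxy; have := dist_adj x cy.
by rewrite (adj_dist1 xc); lia.
Qed.

Lemma dist2P x y : dist x y = 2 -> exists c, adj x c /\ adj c y.
Proof.
move=> E; have := dist_walk x y; rewrite E => -[p [<- <- _ adp]].
by exists (p 1); split; apply: adp.
Qed.

Lemma geodesic x y : exists p : nat -> G,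
  [/\ p 0 = x, p (dist x y) = y,
      forall i, i <= dist x y -> dist x (p i) = i
    & forall i, i < dist x y -> adj (p i) (p i.+1)].
Proof.
have [p [p0 pn _ adp]] := dist_walk x y; exists p; split=> // i le_i.
have le1 : dist x (p i) <= i.
  by apply: dist_le; exists p; split=> // j lt_j; apply: adp; lia.
have le2 : dist (p i) y <= dist x y - i.
  apply: dist_le; rewrite -{2}pn; apply: walk_sub => // t /andP[_ ?].
  exact: adp.
by have := dist_tri (p i) x y; lia.
Qed.

End Metric.

(** * Excess *)

Section Excess.
Variable G : sgraph.
Hypothesis cG : conn [set: G].
Implicit Types (A S : {set G}) (x y v : G) (f : G * G) (F : {set G * G}).

(* The Szeged index counts an edge [ab] once for every pair [(x, y)] with [x]
   closer to [a] and [y] closer to [b]. *)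
Definition good S x y := [set f : G * G |
  [&& f.1 \in S, f.2 \in S, adj f.1 f.2,
      dist x f.2 == (dist x f.1).+1 & dist y f.1 == (dist y f.2).+1]].

Definition geo_edges x y :=
  [set f : G * G | (dist x f.1 + dist y f.2).+1 == dist x y].

Definition levels x F :=
  [set k : 'I_#|G| | [exists f in F, dist x f.1 == k]].

(* The number of good edges inside [S] beyond one geodesic edge for each level
   at which [S] contains a geodesic edge. *)
Definition exc S x y :=
  #|good S x y| - #|levels x (good S x y :&: geo_edges x y)|.

Definition total_exc S := \sum_(x in S) \sum_(y in S) exc S x y.

Lemma mem_good S x y a b : a \in S -> b \in S -> adj a b ->
  dist x b = (dist x a).+1 -> dist y a = (dist y b).+1 ->
  (a, b) \in good S x y.
Proof. by move=> Sa Sb ab E1 E2; rewrite inE /= Sa Sb ab E1 E2 !eqxx. Qed.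

Lemma good_sub S S' x y : S \subset S' -> good S x y \subset good S' x y.
Proof.
move=> /subsetP sS; apply/subsetP => f; rewrite !inE.
by case/and5P => /sS-> /sS-> -> -> ->.
Qed.

Lemma levU x F F' : levels x (F :|: F') = levels x F :|: levels x F'.
Proof.
apply/setP => k; rewrite !inE; apply/existsP/orP.
  case=> f; rewrite inE => /andP[/orP[Ff|Ff] E].
    by left; apply/existsP; exists f; rewrite Ff.
  by right; apply/existsP; exists f; rewrite Ff.
by case=> /existsP[f /andP[Ff E]]; exists f; rewrite inE Ff ?orbT.
Qed.

Lemma card_lev x F : #|levels x F| <= #|F|.
Proof.
have -> : levels x F = (fun f => Ordinal (dist_lt cG x f.1)) @: F.
  apply/setP => k; rewrite inE; apply/existsP/imsetP.
    by case=> f /andP[Ff /eqP E]; exists f => //; apply: val_inj.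
  by case=> f Ff ->; exists f; rewrite Ff /=.
exact: leq_imset_card.
Qed.

Lemma lev_sub x F F' :
  (forall f, f \in F -> exists2 g, g \in F' & dist x g.1 = dist x f.1) ->
  levels x F \subset levels x F'.
Proof.
move=> sF; apply/subsetP => k; rewrite !inE => /existsP[f /andP[/sF[g Fg E] Ek]].
by apply/existsP; exists g; rewrite Fg E.
Qed.

(* Edges that are new and either off all geodesics or at a level already
   occupied by another geodesic edge all count. *)
Lemma exc_inc S S' x y F : S \subset S' -> F \subset good S' x y ->
  [disjoint F & good S x y] ->
  (forall f, f \in F -> f \in geo_edges x y ->
     exists2 g, g \in good S' x y :&: geo_edges x y & (g \notin F) /\ dist x g.1 = dist x f.1) ->
  exc S x y + #|F| <= exc S' x y.
Proof.
move=> sS sF dF cov; rewrite /exc.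
set H := good S' x y in sF cov *; set B := good S x y in dF *.
have sB : B \subset H :\: F.
  by rewrite subsetD good_sub // disjoint_sym.
have sub1 : levels x (H :&: geo_edges x y) \subset levels x ((H :\: F) :&: geo_edges x y).
  apply: lev_sub => f; rewrite in_setI => /andP[Hf gf].
  case: (boolP (f \in F)) => Ff; last first.
      by exists f => //; rewrite in_setI in_setD Ff Hf gf.
  have [g + [nFg E]] := cov f Ff gf; rewrite in_setI => /andP[Hg gg].
  by exists g => //; rewrite in_setI in_setD nFg Hg gg.
(* The old edges number [b] on [lb] levels, [F] has [n] edges, and the other new edges number [c].
   The latter may open new levels, but at most one each, and [F] opens none. *)
have arith (b lb n c lc h h0 lh u : nat) : lh <= u -> n + h0 = h -> b + c = h0 ->
    u <= lb + lc -> lc <= c -> lb <= b -> b - lb + n <= h - lh by lia.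
apply: (arith _ _ _ #|H :\: F :\: B| #|levels x ((H :\: F :\: B) :&: geo_edges x y)|
  _ #|H :\: F| _ _ (subset_leq_card sub1)).
- by have := cardsID F H; rewrite (setIidPr sF).
- by have := cardsID B (H :\: F); rewrite (setIidPr sB).
- have -> : (H :\: F) :&: geo_edges x y
      = (B :&: geo_edges x y) :|: ((H :\: F :\: B) :&: geo_edges x y).
    by rewrite -setIUl -{1}(setID (H :\: F) B) (setIidPr sB).
  by rewrite levU; exact: (leq_card_setU _ _).1.
- by apply: leq_trans (card_lev _ _) _; apply/subset_leq_card/subsetIl.
by apply: leq_trans (card_lev _ _) _; apply/subset_leq_card/subsetIl.
Qed.

Lemma exc_mono S S' x y : S \subset S' -> exc S x y <= exc S' x y.
Proof.
move=> sS; have := @exc_inc S S' x y set0 sS (sub0set _).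
rewrite cards0 addn0; apply; first by rewrite -setI_eq0 set0I.
by move=> f; rewrite inE.
Qed.

Lemma exc_ge S x y F : F \subset good S x y ->
  (forall f, f \in F -> f \in geo_edges x y ->
     exists2 g, g \in good S x y :&: geo_edges x y & (g \notin F) /\ dist x g.1 = dist x f.1) ->
  #|F| <= exc S x y.
Proof.
move=> sF cov; have := @exc_inc set0 S x y F (sub0set _) sF.
have -> : good set0 x y = set0 by apply/setP => f; rewrite !inE.
rewrite -setI_eq0 setI0 eqxx => /(_ isT cov).
by apply: leq_trans; apply: leq_addl.
Qed.

Lemma good_swap S x y : good S y x = (fun f => (f.2, f.1)) @: good S x y.
Proof.
apply/setP => -[a b]; rewrite inE /=; apply/idP/imsetP.
  case/and5P=> Sa Sb ab E1 E2; exists (b, a) => //.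
  by rewrite inE /= Sa Sb adjC ab E1 E2.
case=> -[a' b']; rewrite inE /= => /and5P[Sa Sb ab E1 E2] [-> ->].
by rewrite Sa Sb adjC ab E1 E2.
Qed.

Lemma geoC x y a b : ((a, b) \in geo_edges x y) = ((b, a) \in geo_edges y x).
Proof. by rewrite !inE /= addnC (distC cG y x). Qed.

Lemma exc_sym S x y : exc S x y = exc S y x.
Proof.
suff le_lev u v : #|levels v (good S v u :&: geo_edges v u)|
    <= #|levels u (good S u v :&: geo_edges u v)|.
  rewrite /exc; have -> : #|good S y x| = #|good S x y|.
    by rewrite good_swap card_imset // => -[a b] [c d] [-> ->].
  by congr (_ - _); apply/eqP; rewrite eqn_leq !le_lev.
(* Reflection of the levels: a geodesic edge that starts at distance [k] from [u] ends at distance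
   [(dist u v).-1 - k] from [v]. The default value of [insubd] is not taken on such levels. *)
pose r (k : 'I_#|G|) := insubd k ((dist u v).-1 - k).
apply: leq_trans (leq_imset_card r _); apply: subset_leq_card.
apply/subsetP => k; rewrite inE => /existsP[[a b] /andP[]].
rewrite inE good_swap => /andP[/imsetP[[b' a'] good_f [Ea Eb]]].
move: Ea Eb good_f => /= <- <- good_f; rewrite geoC => geo_f /eqP /= E.
apply/imsetP; exists (Ordinal (dist_lt cG u b)).
  by rewrite inE; apply/existsP; exists (b, a); rewrite inE good_f geo_f /=.
apply: val_inj; move: geo_f; rewrite inE /= => /eqP D.
have Ek : (dist u v).-1 - dist u b = k by rewrite -E -D; lia.
by rewrite /r val_insubd /= Ek ltn_ord.
Qed.

(** Bounds on a row of the excess are obtained from explicit lists. An entry [(v, f)] is a good edge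
    [f] for the pair [x], [v]; if [f] lies on a geodesic, its level must still be occupied by an
    edge outside the list, to which the subtracted unit is charged. *)
Lemma units S S' x (L : seq (G * (G * G))) : uniq L ->
  (forall v f, (v, f) \in L -> [/\ v \in S, f \in good S' x v
    & f \in geo_edges x v -> exists2 g, g \in good S' x v :&: geo_edges x v
                       & (v, g) \notin L /\ dist x g.1 = dist x f.1]) ->
  size L <= \sum_(v in S) exc S' x v.
Proof.
move=> uL HL; rewrite -(card_uniqP uL) -sum1_card.
have -> : \sum_(p in L) 1 = \sum_(v in S) \sum_(f | (v, f) \in L) 1.
  rewrite pair_big_dep /=; apply: eq_bigl => -[v f] /=.
  by apply/idP/andP => [Lp|[]//]; have [-> _ _] := HL v f Lp.
apply: leq_sum => v Sv; rewrite sum1_card.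
have -> : #|[pred f | (v, f) \in L]| = #|[set f | (v, f) \in L]|.
  by apply: eq_card => f; rewrite !inE.
apply: exc_ge => [|f]; first by apply/subsetP => f; rewrite inE => /HL[].
rewrite inE => /HL[_ _ cov] /cov[g gg [nLg E]].
by exists g => //; rewrite inE.
Qed.

(** A good edge on no geodesic occupies no level and so always counts. *)
Definition extra S x v f := (f \in good S x v) && (f \notin geo_edges x v).

Lemma extra_units S S' x (L : seq (G * (G * G))) : uniq L ->
  (forall v f, (v, f) \in L -> v \in S /\ extra S' x v f) ->
  size L <= \sum_(v in S) exc S' x v.
Proof.
move=> uL HL; apply: units => // v f /HL[Sv /andP[gf ngf]]; split=> //.
by rewrite (negbTE ngf).
Qed.

Lemma mem_extra S x y a b : a \in S -> b \in S -> adj a b ->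
  dist x b = (dist x a).+1 -> dist y a = (dist y b).+1 ->
  dist x y <= dist x a + dist y b -> extra S x y (a, b).
Proof.
move=> Sa Sb ab E1 E2 lt; rewrite /extra mem_good // inE /= neq_ltn.
by rewrite orbC ltnS lt.
Qed.

Lemma exc_extra S x y f : extra S x y f -> 0 < exc S x y.
Proof.
case/andP=> gf ngf; rewrite -(cards1 f); apply: exc_ge => [|g].
  by rewrite sub1set.
by rewrite inE => /eqP->; rewrite (negbTE ngf).
Qed.

(** All paths [x c y] share the same two levels. The path through [c0] pays for these, and both
    edges at every other common neighbour are surplus. *)
Lemma exc_cn S x y (C : {set G}) c0 : x \in S -> y \in S -> x != y ->
  ~~ adj x y -> c0 \in C -> C \subset S ->
  (forall c, c \in C -> adj x c && adj c y) ->
  2 * #|C|.-1 <= exc S x y.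
Proof.
move=> Sx Sy nxy naxy Cc0 /subsetP sC HC.
have D c : c \in C -> [/\ dist x c = 1, dist y c = 1 & dist x y = 2].
  move=> /HC/andP[xc cy]; split; first exact: adj_dist1.
    by rewrite adj_dist1 // adjC.
  exact: dist2 xc cy.
pose C' := C :\ c0.
pose F := [set (x, c) | c in C'] :|: [set (c, y) | c in C'].
have C'C c : c \in C' -> c \in C by rewrite inE => /andP[].
have goodl c : c \in C -> (x, c) \in good S x y.
  move=> Cc; have [E1 E2 E3] := D c Cc; have /andP[xc cy] := HC c Cc.
  apply: mem_good => //; rewrite ?distxx ?(distC cG y x) ?E1 ?E2 ?E3 //.
  exact: sC.
have goodr c : c \in C -> (c, y) \in good S x y.
  move=> Cc; have [E1 E2 E3] := D c Cc; have /andP[xc cy] := HC c Cc.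
  by apply: mem_good => //; rewrite ?distxx ?E1 ?E2 ?E3 //; apply: sC.
have [E1 E2 E3] := D c0 Cc0.
have -> : 2 * #|C|.-1 = #|F|.
  have injl : injective (pair x : G -> G * G).
    by move=> a b /(congr1 snd).
  have injr : injective (fun c : G => (c, y)) by move=> a b /(congr1 fst).
  rewrite cardsU (card_imset _ injl) (card_imset _ injr).
  have -> : [set (x, c) | c in C'] :&: [set (c, y) | c in C'] = set0.
    apply/setP => f; rewrite !inE; apply/andP => -[/imsetP[c Cc ->] /imsetP[c' Cc' [E _]]].
    by have := HC _ (C'C _ Cc'); rewrite -E adj_irrefl.
  by rewrite cards0 subn0 addnn -mul2n (cardsD1 c0 C) Cc0.
apply: exc_ge.
  apply/subsetP => f; rewrite inE => /orP[]/imsetP[c /C'C Cc ->]; auto.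
move=> f; rewrite inE => /orP[]/imsetP[c Cc ->] _.
  exists (x, c0); last split=> //.
    by rewrite inE goodl // inE /= distxx // E2 E3.
  rewrite !inE negb_or; apply/andP; split; apply/negP => /imsetP[c' Cc' []].
    by move=> E; rewrite -E !inE eqxx in Cc'.
  by move=> E _; have := HC _ (C'C _ Cc'); rewrite -E adj_irrefl.
exists (c0, y); last split=> //.
- by rewrite inE goodr // inE /= distxx // E1 E3.
- rewrite !inE negb_or; apply/andP; split; apply/negP => /imsetP[c' Cc' []].
    move=> E _; have := HC _ Cc0; rewrite E adj_irrefl //.
  by move=> E; rewrite -E !inE eqxx in Cc'.
by have [-> _ _] := D c (C'C _ Cc).
Qed.

Lemma exc_cn2 S x y a b : x \in S -> y \in S -> a \in S -> b \in S ->
  x != y -> ~~ adj x y -> a != b -> adj x a -> adj a y -> adj x b -> adj b y ->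
  2 <= exc S x y.
Proof.
move=> Sx Sy Sa Sb nxy naxy nab xa ay xb byy.
have := @exc_cn S x y [set a; b] a Sx Sy nxy naxy; rewrite cards2 nab.
apply; rewrite ?inE ?eqxx //; first by apply/subsetP => c; rewrite !inE => /orP[]/eqP->.
by move=> c; rewrite !inE => /orP[]/eqP->; apply/andP.
Qed.

(** The old path [x a y] already occupies both levels, so both edges at the new common neighbour [b]
    count. *)
Lemma exc_P3 S S' x y a b : S \subset S' -> x \in S -> y \in S -> a \in S ->
  b \in S' -> b \notin S -> x != y -> ~~ adj x y ->
  adj x a -> adj a y -> adj x b -> adj b y -> exc S x y + 2 <= exc S' x y.
Proof.
move=> sS Sx Sy Sa S'b nSb nxy naxy xa ay xb byy.
have sSS := subsetP sS.
have nab : a != b by apply: contraNneq nSb => <-.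
have D : dist x y = 2 by apply: dist2 xa ay.
have D' : dist y x = 2 by rewrite distC.
have nxb : x != b by apply: contraNneq nSb => <-.
have nyb : y != b by apply: contraNneq nSb => <-.
have Dx c : adj x c -> dist x c = 1 by apply: adj_dist1.
have Dy c : adj c y -> dist y c = 1 by rewrite adjC; apply: adj_dist1.
have goodl c : adj x c -> adj c y -> c \in S' -> (x, c) \in good S' x y.
  by move=> xc cy Sc; apply: mem_good; rewrite ?distxx ?D' ?Dx ?Dy //; apply: sSS.
have goodr c : adj x c -> adj c y -> c \in S' -> (c, y) \in good S' x y.
  by move=> xc cy Sc; apply: mem_good; rewrite ?distxx ?D ?Dx ?Dy //; apply: sSS.
have -> : 2 = #|[set (x, b); (b, y)]| by rewrite cards2 xpair_eqE negb_and nxb.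
apply: exc_inc => //.
- by apply/subsetP => f; rewrite in_set2 => /orP[]/eqP->; [apply: goodl | apply: goodr].
- rewrite -setI_eq0; apply/eqP/setP => f; rewrite !inE.
  by apply/negP => /andP[/orP[]/eqP->]; rewrite /= (negbTE nSb) ?andbF.
move=> f; rewrite !inE => /orP[]/eqP-> _.
  exists (x, a).
    by rewrite in_setI goodl ?sSS // inE /= distxx D Dy.
  by rewrite !inE !xpair_eqE /= eqxx (negbTE nab) (negbTE nxb).
exists (a, y).
  by rewrite in_setI goodr ?sSS // inE /= distxx D Dx.
by rewrite !inE !xpair_eqE /= (negbTE nab) [y == b](negbTE nyb) ?andbF /= !Dx.
Qed.

Lemma exc_inc_extra S S' x y f : S \subset S' -> extra S' x y f ->
  (f.1 \notin S) || (f.2 \notin S) -> exc S x y + 1 <= exc S' x y.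
Proof.
move=> sS /andP[gf ngf] new; rewrite -(cards1 f); apply: exc_inc => //.
- by rewrite sub1set.
- rewrite -setI_eq0; apply/eqP/setP => g; rewrite !inE.
  by apply/negP => /andP[/eqP->]; case/orP: new => /negbTE->; rewrite ?andbF.
by move=> g; rewrite inE => /eqP->; rewrite (negbTE ngf).
Qed.

Lemma total_exc_split S S' : S \subset S' ->
  total_exc S' = \sum_(x in S) \sum_(y in S) exc S' x y
    + 2 * \sum_(x in S' :\: S) \sum_(y in S) exc S' x y
    + \sum_(x in S' :\: S) \sum_(y in S' :\: S) exc S' x y.
Proof.
move=> sS; have row (X : {set G}) : \sum_(x in X) \sum_(y in S') exc S' x y
    = \sum_(x in X) \sum_(y in S) exc S' x y
      + \sum_(x in X) \sum_(y in S' :\: S) exc S' x y.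
  rewrite -big_split; apply: eq_bigr => x _ /=.
  by rewrite (big_setID S) (setIidPr sS).
rewrite /total_exc (big_setID S) (setIidPr sS) /= !row mul2n -addnn.
rewrite [\sum_(x in S) \sum_(y in S' :\: S) _]exchange_big /= !addnA.
do 3!congr (_ + _); apply: eq_bigr => x _; apply: eq_bigr => y _.
exact: exc_sym.
Qed.

Lemma total_exc_pairs S S' k (L : seq (G * G)) : S \subset S' -> uniq L ->
  (forall x y, (x, y) \in L ->
     [/\ x \in S, y \in S & exc S x y + k <= exc S' x y]) ->
  total_exc S + k * size L <= \sum_(x in S) \sum_(y in S) exc S' x y.
Proof.
move=> sS uL HL; rewrite /total_exc !pair_big /=.
have -> : k * size L = \sum_(p | (p.1 \in S) && (p.2 \in S)) (p \in L) * k.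
  rewrite -(card_uniqP uL) -sum1_card big_distrr /= muln1.
  rewrite [LHS]big_mkcond [RHS]big_mkcond /=; apply: eq_bigr => -[x y] _ /=.
  case: (boolP ((x, y) \in L)) => [/HL[-> -> _]|_] /=; first by rewrite mul1n.
  by case: ifP.
rewrite -big_split /=; apply: leq_sum => -[x y] /= _.
case: (boolP ((x, y) \in L)) => [/HL[_ _]|_]; first by rewrite mul1n.
by rewrite mul0n addn0 exc_mono.
Qed.

Lemma total_exc_le S S' : S \subset S' ->
  total_exc S <= \sum_(x in S) \sum_(y in S) exc S' x y.
Proof.
by move=> sS; apply: leq_sum => x _; apply: leq_sum => y _; apply: exc_mono.
Qed.

End Excess.

(** * From the excess to the Szeged-Wiener gap *)

Section Gap.
Variable G : sgraph.
Hypothesis cG : conn [set: G].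
Implicit Types (x y v : G).

(** In the whole graph a geodesic provides a good edge on each level below [dist x y], so at least
    that many are subtracted. *)
Lemma exc_dist x y : exc setT x y + dist x y <= #|good setT x y|.
Proof.
rewrite /exc; set L := levels _ _.
have le1 : #|L| <= #|good setT x y|.
  by apply: leq_trans (card_lev cG _ _) _; apply/subset_leq_card/subsetIl.
suff : dist x y <= #|L| by move: le1; lia.
have [p [p0 pn dp adp]] := geodesic cG x y.
pose h (k : 'I_(dist x y)) := widen_ord (ltnW (dist_lt cG x y)) k.
have injh : injective h by move=> i j /(congr1 val) /= E; apply: val_inj.
rewrite -[leqLHS]card_ord -(card_imset _ injh); apply: subset_leq_card.
apply/subsetP => _ /imsetP[k _ ->]; rewrite inE; apply/existsP.
have lt_k := ltn_ord k; have a1 := adp k lt_k.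
have D1 : dist x (p k) = k by apply: dp; apply: ltnW.
have D2 : dist x (p k.+1) = k.+1 by apply: dp.
have D3 : dist (p k.+1) y <= dist x y - k.+1.
  apply: dist_le; have := @walk_sub G setT p k.+1 (dist x y) lt_k.
  rewrite pn; apply=> [t _|t /andP[_]]; [exact: in_setT | exact: adp].
have D4 : dist y (p k) <= (dist y (p k.+1)).+1 by apply: dist_adj; rewrite // adjC.
have := dist_tri cG (p k) x y; rewrite D1 (distC cG (p k)) => tri.
rewrite (distC cG) in D3.
have E1 : dist y (p k) = (dist y (p k.+1)).+1 by move: lt_k; lia.
exists (p k, p k.+1); rewrite in_setI mem_good ?in_setT ?D1 ?D2 //= eqxx andbT.
by rewrite inE /= D1; apply/eqP; move: lt_k; lia.
Qed.

Lemma sum_upair (F : G -> G -> nat) : (forall x y, F x y = F y x) ->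
  (forall x, F x x = 0) ->
  \sum_x \sum_y F x y = 2 * \sum_x \sum_(y | upair x y) F x y.
Proof.
move=> FC F0; rewrite mul2n -addnn.
rewrite [X in _ = _ + X](exchange_big_dep xpredT) //= -big_split /=.
apply: eq_bigr => x _; rewrite [LHS](bigID (fun y => upair x y)) /=.
congr (_ + _); rewrite [LHS]big_mkcond [RHS]big_mkcond /=.
apply: eq_bigr => y _; rewrite /upair -leqNgt.
case: (ltngtP (enum_rank x) (enum_rank y)) => // /val_inj/enum_rank_inj->.
by rewrite F0.
Qed.

(** Double counting. Distances to the ends of an edge differ by at most one, so the pairs for which
    [(a, b)] is good form the product of the two sets counted by [ncloser]. The factor 2 stands for
    the two orientations. *)
Lemma sum_good : \sum_(x : G) \sum_(y : G) #|good setT x y| = 2 * szeged G.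
Proof.
pose F (a b : G) := if adj a b then ncloser a b * ncloser b a else 0.
have -> : szeged G = \sum_a \sum_(b | upair a b) F a b.
  apply: eq_bigr => a _; rewrite big_mkcondr; apply: eq_bigr => b _.
  by rewrite /F; case: adj.
rewrite -sum_upair; last 2 first.
- by move=> a b; rewrite /F adjC mulnC.
- by move=> a; rewrite /F adj_irrefl.
have FE q : F q.1 q.2 = \sum_(p : G * G) (q \in good setT p.1 p.2).
  have -> : F q.1 q.2 = #|[set p : G * G | q \in good setT p.1 p.2]|.
    case: q => a b; rewrite /F /=; case: ifP => [ab|nab]; last first.
      by rewrite [RHS](_ : _ = 0) //; apply: eq_card0 => p; rewrite !inE /= nab.
    rewrite -cardsX; apply: eq_card => -[x y]; rewrite !inE /= ab /=.
    have ba : adj b a by rewrite adjC.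
    have := dist_adj cG x ab; have := dist_adj cG y ba.
    by move=> le1 le2; congr (_ && _); apply/idP/idP; lia.
  rewrite -sum1_card big_mkcond /=; apply: eq_bigr => p _.
  by rewrite inE; case: (_ \in _).
rewrite !pair_big /= (eq_bigr _ (fun q _ => FE q)) exchange_big /=.
apply: eq_bigr => p _; rewrite -sum1_card big_mkcond /=.
by apply: eq_bigr => q _; case: (_ \in _).
Qed.

Lemma total_exc_gap : total_exc [set: G] + 2 * wiener G <= 2 * szeged G.
Proof.
rewrite -sum_good -sum_upair; [|by move=> x y; rewrite distC|exact: distxx].
have -> : total_exc [set: G] = \sum_(x : G) \sum_(y : G) exc setT x y.
  apply: eq_big => [x|x _]; first by rewrite in_setT.
  by apply: eq_bigl => y; rewrite in_setT.
rewrite -big_split; apply: leq_sum => x _ /=; rewrite -big_split.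
by apply: leq_sum => y _; apply: exc_dist.
Qed.

Lemma gap_ge n : 4 * n <= total_exc [set: G] -> ((2 * n)%:Z <= sw_gap G)%R.
Proof. by move=> le; have := total_exc_gap; rewrite /sw_gap; lia. Qed.

End Gap.

(** * Adding a vertex with two neighbours *)

Section Paths.
Variable G : sgraph.
Hypothesis cG : conn [set: G].
Implicit Types (A R S X : {set G}) (x y v w : G) (p : nat -> G).

(* Walking along [p] away from [y], stop at the first vertex [p j.+2] which is
   closer to [y] than its position predicts. *)
Lemma first_drop y p n : adj y (p 0) -> y != p 1 -> ~~ adj y (p 1) ->
  (forall i, i < n -> adj (p i) (p i.+1)) ->
  (forall i, i.+2 <= n -> p i != p i.+2 /\ ~~ adj (p i) (p i.+2)) ->
  dist y (p n) <= n ->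
  exists j, [/\ j.+2 <= n, forall t, t <= j.+1 -> dist y (p t) = t.+1,
    dist y (p j.+2) <= j.+2
    & forall S, p j \in S -> p j.+1 \in S ->
        extra S y (p j.+2) (p j, p j.+1)].
Proof.
move=> yp0 nyp1 nap1 adp indp le_n.
have [i le_i min_i] := @least_nat (fun i => dist y (p i) <= i) (ex_intro _ n le_n).
have lt_in : i <= n by apply: min_i.
have up t : t <= i -> dist y (p t) <= t.+1.
  elim: t => [|t IH] le_t; first by rewrite adj_dist1.
  have lt_tn : t < n by apply: leq_trans lt_in.
  by apply: leq_trans (dist_adj cG y (adp _ lt_tn)) _; rewrite ltnS IH // ltnW.
have D t : t < i -> dist y (p t) = t.+1.
  move=> lt_t; apply/eqP; rewrite eqn_leq up ?(ltnW lt_t) //= ltnNge.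
  by apply/negP => /min_i; rewrite leqNgt lt_t.
case: i le_i {min_i} lt_in {up} D => [|[|j]] le_i lt_in D.
- by rewrite adj_dist1 in le_i.
- by have := dist_ge2 cG nyp1 nap1; rewrite leqNgt ltnS le_i.
have adj1 : adj (p j) (p j.+1) by apply: adp; nlia.
have adj2 : adj (p j.+1) (p j.+2) by apply: adp; nlia.
have [nj naj] := indp j lt_in.
have D2 : dist (p j.+2) (p j) = 2.
  by rewrite distC // (dist2 cG nj naj adj1 adj2).
have D1 : dist (p j.+2) (p j.+1) = 1 by apply: adj_dist1; rewrite // adjC.
have Dj : dist y (p j) = j.+1 by apply: D.
have Dj1 : dist y (p j.+1) = j.+2 by apply: D.
exists j; split=> // S Sj Sj1; apply: mem_extra; rewrite ?D1 ?D2 ?Dj ?Dj1 //.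
by rewrite addn1.
Qed.

(** [j] is the number of interior vertices. Minimality below is among [j > 0], since an edge inside
    [A] would otherwise win without meeting [R]. *)
Definition apath A R j p := [/\ p 0 \in A, p j.+1 \in A, p 0 != p j.+1,
  forall i, 0 < i <= j -> p i \in R & forall i, i <= j -> adj (p i) (p i.+1)].

Definition min_apath A R j p :=
  [/\ 0 < j, apath A R j p & forall i q, 0 < i -> apath A R i q -> j <= i].

(** [D] is the component of [r] in [R]. Connectedness of [S] gives an exit [v] from [D] into [A],
    connectedness of [S] without [v] gives a second exit [v'], and a walk inside the component joins
    them. *)
Lemma apath_ex S A R a b r : conn2 S -> A \subset S -> a \in A -> b \in A ->
  a != b -> r \in R -> (forall v, v \in R -> v \in S /\ v \notin A) ->
  (forall u v, u \in R -> v \in S -> v \notin A -> adj u v -> v \in R) ->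
  exists j p, min_apath A R j p.
Proof.
move=> [cS cS1] /subsetP sA Aa Ab nab Rr sR clR.
pose e := [rel u v : G | [&& adj u v, u \in R & v \in R]].
pose D := [set v | connect e r v].
have Dr : r \in D by rewrite inE.
have sDR v : v \in D -> v \in R.
  rewrite inE => /connectP[s]; elim/last_ind: s => [_ ->|s u _] //.
  by rewrite last_rcons rcons_path => /andP[_ /and3P[_ _ Ru]] ->.
have out u v : u \in D -> v \in S -> v \notin D -> adj u v -> v \in A.
  move=> Du Sv nDv uv; apply: contraNT nDv => nAv.
  have Ru := sDR _ Du; have Rv := clR _ _ Ru Sv nAv uv.
  move: Du; rewrite !inE => /connect_trans; apply.
  by apply: connect1; rewrite /= uv Ru.
have nDA v : v \in A -> v \notin D.
  by move=> Av; apply/negP => /sDR/sR[_]; rewrite Av.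
have Sr : r \in S by have [] := sR r Rr.
have [u [v [Su Du Sv nDv uv]]] := cS D r a Sr Dr (sA _ Aa) (nDA _ Aa).
have Av := out _ _ Du Sv nDv uv.
have [c Ac nvc] : exists2 c, c \in A & c != v.
  by case: (eqVneq a v) => [<-|nav]; [exists b; rewrite // eq_sym | exists a].
have [||u' [v' [Su' Du' Sv' nDv' uv']]] := cS1 v D r c _ Dr _ (nDA _ Ac).
- by rewrite !inE Sr andbT; apply: contraTneq Av => <-; have [] := sR r Rr.
- by rewrite !inE nvc sA.
move: Sv'; rewrite !inE => /andP[nvv' Sv'].
have Av' := out _ _ Du' Sv' nDv' uv'.
have [n [p [p0 pn Rp adp]]] : exists n, walk R n u u'.
  have symD : connect_sym e.
    by apply: sym_connect_sym => s t /=; rewrite adjC (andbC (s \in R)).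
  have : connect e u u'.
    by move: Du Du'; rewrite !inE (symD r) => /connect_trans; apply.
  case/connectP=> s es ->; exists (size s); apply: path_walk.
    elim: s (u) (sDR _ Du) es => [|z s IH] x Rx /=.
      by move=> _ w; rewrite inE => /eqP->.
    move=> /andP[/and3P[_ _ Rz] /(IH z Rz) sub] w.
    by rewrite inE => /orP[/eqP->|/sub].
  by apply: sub_path es => x w /and3P[].
pose q i := if i is i'.+1 then if i' <= n then p i' else v' else v.
have ap : 0 < n.+1 /\ apath A R n.+1 q.
  split=> //; split=> //=.
  - by rewrite ltnn.
  - by rewrite ltnn eq_sym.
  - by case=> [|i] //= le_i; rewrite -ltnS le_i; apply: Rp; rewrite -ltnS.
  case=> [|i] le_i /=; first by rewrite p0 adjC.
  rewrite -ltnS le_i; case: ltnP => lt_i; first exact: adp.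
  have -> : i = n by apply/eqP; rewrite eqn_leq lt_i -ltnS le_i.
  by rewrite pn.
have [j [q' [j0 Pq']] min_j] :=
  @least_nat (fun j => exists q, 0 < j /\ apath A R j q) (ex_intro _ _ (ex_intro _ q ap)).
exists j, q'; split=> // i q'' i0 ap''; apply: min_j; by exists q''.
Qed.

Lemma apath_rev A R j p : min_apath A R j p ->
  min_apath A R j (fun i => p (j.+1 - i)).
Proof.
move=> [j0 [A0 A1 nA Rp adp] min_j]; split=> //; split; rewrite ?subn0 ?subnn //.
- by rewrite eq_sym.
- by move=> i le_i; apply: Rp; nlia.
move=> i le_i; have -> : j.+1 - i = (j - i).+1 by nlia.
by rewrite subSS adjC; apply: adp; nlia.
Qed.

Section Minimal.
Variables (A R : {set G}) (j : nat) (p : nat -> G).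
Hypothesis mp : min_apath A R j p.
Hypothesis RA : forall v, v \in R -> v \notin A.

(** The pair of the two ends is left out: a chord between them bypasses all interior vertices and
    contradicts nothing. *)
Lemma min_apath_ind i k : i.+1 < k -> k <= j.+1 -> (0 < i) || (k <= j) ->
  p i != p k /\ ~~ adj (p i) (p k).
Proof.
have [j0 [A0 A1 nA Rp adp] min_j] := mp.
move=> lt_ik le_k ends.
(* The path that omits the [s] vertices following [p i]. *)
pose q s t := if t <= i then p t else p (t + s).
have cut s : 0 < s -> s < j -> i + s <= j -> adj (p i) (p (i + s).+1) -> False.
  move=> s0 lt_sj le_s a1; suff : j <= j - s by nlia.
  apply: (min_j _ (q s)); first by nlia.
  split; rewrite /q ?leq0n //.
  - case: ifP => ?; first by nlia.
    by have -> : (j - s).+1 + s = j.+1 by nlia.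
  - case: ifP => ?; first by nlia.
    by have -> : (j - s).+1 + s = j.+1 by nlia.
  - by move=> t le_t; case: ifP => ?; apply: Rp; nlia.
  move=> t le_t; case: ifP => ?; case: ifP => ?.
  - by apply: adp; nlia.
  - by have -> : t = i by [nlia]; rewrite addSn.
  - by nlia.
  - by rewrite addSn; apply: adp; nlia.
split; apply/negP.
  move/eqP => E; case: (posnP i) => [i0|i_gt0].
    have := RA (Rp k _); rewrite -E i0 A0; by move=> /(_ ltac:(nlia)).
  case: (ltngtP k j.+1) => lt_k; [|by nlia|].
    apply: (cut (k - i)); [by nlia..|]; have -> : i + (k - i) = k by nlia.
    by rewrite E; apply: adp; nlia.
  by have := RA (Rp i _); rewrite E lt_k A1; move=> /(_ ltac:(nlia)).
move=> a1; apply: (cut (k - i.+1)); [by nlia..|].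
by have -> : (i + (k - i.+1)).+1 = k by nlia.
Qed.

Lemma min_apath_inj i k : i <= j.+1 -> k <= j.+1 -> p i = p k -> i = k.
Proof.
have [j0 [A0 A1 nA Rp adp] _] := mp.
wlog lt_ik : i k / i < k => [wl|] le_i le_k E.
  by case: (ltngtP i k) => // lt; [apply: wl | apply/esym/wl].
case: (ltngtP i.+1 k) => [lt|lt|Ek]; [|by nlia|].
  case: (boolP ((0 < i) || (k <= j))) => [ends|].
    by have [/eqP] := min_apath_ind lt le_k ends.
  rewrite negb_or -!leqNgt leqn0 => /andP[/eqP i0 lt_k].
  have Ekj : k = j.+1 by nlia.
  by move: nA; rewrite -Ekj -E i0 eqxx.
have := adp i; rewrite Ek E adj_irrefl => /(_ ltac:(nlia)) //.
Qed.

(** Both [p 0 ... p k v] and [v p k ... p j.+1] are shorter candidates, unless [p k] is already the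
    extreme interior vertex on the side of [v] or [v] is the opposite end. *)
Lemma min_apath_end v k : v \in A -> 0 < k <= j -> adj (p k) v ->
  (k = j \/ v = p 0) /\ (k = 1 \/ v = p j.+1).
Proof.
have [j0 [A0 A1 nA Rp adp] min_j] := mp.
move=> Av /andP[k0 le_k] a1; split.
  case: (eqVneq v (p 0)) => [->|nv]; [by right | left].
  suff : j <= k by nlia.
  apply: (min_j _ (fun t => if t <= k then p t else v)) => //; split; rewrite ?leq0n ?ltnn //=.
  - by rewrite eq_sym.
  - by move=> t le_t; case: ifP => ?; [apply: Rp; nlia | nlia].
  move=> t le_t; rewrite le_t; case: ifP => ?; first by apply: adp; nlia.
  by have -> : t = k by nlia.
case: (eqVneq v (p j.+1)) => [->|nv]; [by right | left].
suff : j <= (j - k).+1 by nlia.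
apply: (min_j _ (fun t => if t is t'.+1 then p (t' + k) else v)) => //; split=> //=.
- by have -> : (j - k).+1 + k = j.+1 by nlia.
- by have -> : (j - k).+1 + k = j.+1 by nlia.
- by case=> [|t] //= le_t; apply: Rp; nlia.
case=> [|t] le_t; first by rewrite add0n adjC.
by rewrite addSn; apply: adp; nlia.
Qed.

End Minimal.

End Paths.

Lemma leq_sum2 (I : finType) (P : {set I}) (F : I -> nat) i k :
  i \in P -> k \in P -> i != k -> F i + F k <= \sum_(t in P) F t.
Proof.
move=> Pi Pk nik; rewrite (bigD1 i Pi) /= leq_add2l.
have E : (k \in P) && (k != i) by rewrite Pk eq_sym.
by rewrite (bigD1 k E) leq_addr.
Qed.

Lemma leq_sum1 (I : finType) (P : {set I}) (F : I -> nat) i :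
  i \in P -> F i <= \sum_(t in P) F t.
Proof. by move=> Pi; rewrite (bigD1 i Pi) leq_addr. Qed.

Section Growth.
Variable G : sgraph.
Hypothesis cG : conn [set: G].
Implicit Types (A R S X : {set G}) (x y v w : G) (p : nat -> G).

Definition nbhd S y := [set a in S | adj y a].

(* [total_exc] counts every unordered pair twice: [S'] gains at least [c] unordered
   units per new vertex. *)
Definition step c S := exists S', [/\ S \proper S', conn2 S'
  & total_exc S + 2 * c * #|S'| <= total_exc S' + 2 * c * #|S|].

Lemma total_exc_add S y : y \notin S ->
  \sum_(x in S) \sum_(v in S) exc (y |: S) x v
    + 2 * \sum_(v in S) exc (y |: S) y v <= total_exc (y |: S).
Proof.
move=> nSy; have -> := total_exc_split cG (subsetUr [set y] S).
have -> : (y |: S) :\: S = [set y].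
  by apply/setP => v; rewrite !inE; case: eqVneq => [->|]; rewrite ?nSy ?andbF // andNb.
by rewrite !big_set1 leq_addr.
Qed.

Lemma step_add c S y a b : conn2 S -> y \notin S -> a \in S -> b \in S ->
  a != b -> adj y a -> adj y b -> total_exc S + 2 * c <= total_exc (y |: S) -> step c S.
Proof.
move=> cS nSy Sa Sb nab ya yb le; exists (y |: S); split.
- by rewrite properUr // sub1set.
- exact: conn2_add ya yb.
by rewrite cardsU1 nSy; nlia.
Qed.

Section AddVertex.
Variables (S : {set G}) (y a b : G).
Hypotheses (cS : conn2 S) (nSy : y \notin S) (Sa : a \in S) (Sb : b \in S).
Hypotheses (nab : a != b) (ya : adj y a) (yb : adj y b).
Let A := nbhd S y.
Let S1 := y |: S.

Lemma sub_S1 : S \subset S1. Proof. exact: subsetUr. Qed.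

Lemma neq_new v : v \in S -> y != v.
Proof. by move=> Sv; apply: contraNneq nSy => ->. Qed.

Lemma mem_old v : v \in S -> v \in S1.
Proof. exact: (subsetP sub_S1). Qed.

Lemma mem_new : y \in S1. Proof. exact: setU11. Qed.

Lemma exc_apex v c d : v \in S -> v \notin A -> c \in A -> d \in A ->
  c != d -> adj v c -> adj v d -> 2 <= exc S1 y v.
Proof.
move=> Sv nAv; rewrite !inE => /andP[Sc yc] /andP[Sd yd] ncd vc vd.
apply: (@exc_cn2 _ cG S1 y v c d) => //; try exact: mem_old; try by rewrite adjC.
- exact: mem_new.
- exact: neq_new.
by move: nAv; rewrite inE Sv.
Qed.

Section Path.
Variables (R : {set G}) (j : nat) (p : nat -> G).
Hypothesis RS : forall v, v \in R -> v \in S /\ v \notin A.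
Hypothesis mp : min_apath A R j p.
Hypothesis j2 : 1 < j.

Let RA v : v \in R -> v \notin A. Proof. by case/RS. Qed.

Lemma min_apath_mem i : i <= j.+1 -> p i \in S.
Proof using RS mp.
have [_ [A0 A1 _ Rp _] _] := mp.
case: i => [_|i le_i]; first by move: A0; rewrite inE => /andP[].
case: (ltngtP i j) => [lt_i|lt_i|->].
- by case/RS: (Rp i.+1 lt_i).
- by move: le_i; rewrite ltnS leqNgt lt_i.
by move: A1; rewrite inE => /andP[].
Qed.

(** [p j] is at distance 2 from [y] through [p j.+1], and [2 <= j], so the walk from [p 0] must meet
    a drop no later than [p j]. *)
Lemma drop_unit : exists l, [/\ l.+2 <= j,
  forall t, t <= l.+1 -> dist y (p t) = t.+1,
  dist y (p l.+2) <= l.+2 & extra S1 y (p l.+2) (p l, p l.+1)].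
Proof using cG nSy RS mp j2.
have [j0 [A0 A1 nA Rp adp] _] := mp.
have nyR i : 0 < i <= j -> y != p i /\ ~~ adj y (p i).
  move=> /Rp/RS[Si]; rewrite inE Si; split=> //; exact: neq_new.
have [nyp1 nap1] := nyR 1 j0.
have [nypj napj] := nyR j ltac:(nlia).
have yp0 : adj y (p 0) by move: A0; rewrite inE => /andP[].
have Dj : dist y (p j) <= j.
  rewrite (@dist2 _ cG (p j.+1)) //; first by move: A1; rewrite inE => /andP[].
  by rewrite adjC adp.
have ind i : i.+2 <= j -> p i != p i.+2 /\ ~~ adj (p i) (p i.+2).
  by move=> le_i; apply: (min_apath_ind mp RA) => //; nlia.
have adpj i : i < j -> adj (p i) (p i.+1) by move=> lt_i; apply: adp; nlia.
have [l [le_l Dl Dl2 ext]] := first_drop cG yp0 nyp1 nap1 adpj ind Dj.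
exists l; split=> //; apply: ext; apply: mem_old; apply: min_apath_mem; nlia.
Qed.

End Path.

(** A minimal path with at least two interior vertices is walked from both ends; the two edges found
    have opposite orientations along it, so they are different units. A single interior vertex has
    two common neighbours with [y]. *)
Lemma gain2 R r : r \in R -> (forall v, v \in R -> v \in S /\ v \notin A) ->
  (forall u v, u \in R -> v \in S -> v \notin A -> adj u v -> v \in R) ->
  2 <= \sum_(v in R) exc S1 y v.
Proof.
move=> Rr RS clR.
have Aa : a \in A by rewrite inE Sa.
have Ab : b \in A by rewrite inE Sb.
have sA : A \subset S by apply/subsetP => v; rewrite inE => /andP[].
have [j [p mp]] := apath_ex cS sA Aa Ab nab Rr RS clR.
have [j0 [A0 A1 nA Rp adp] _] := mp.
have RA v : v \in R -> v \notin A by case/RS.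
case: (ltngtP j 1) => [|j2|j1]; first by nlia.
  have [l [le_l _ _ exl]] := drop_unit RS mp j2.
  have [r' [le_r _ _ exr]] := drop_unit RS (apath_rev mp) j2.
  have inj := min_apath_inj mp RA.
  apply: (@extra_units _ cG R S1 y
    [:: (p l.+2, (p l, p l.+1));
        (p (j.+1 - r'.+2), (p (j.+1 - r'), p (j.+1 - r'.+1)))]) => [|v f].
    rewrite /= inE andbT; apply/eqP => -[/inj E _ /inj E'].
    by have := E ltac:(nlia) ltac:(nlia); have := E' ltac:(nlia) ltac:(nlia); nlia.
  by rewrite !inE => /orP[]/eqP[-> ->]; split=> //; apply: Rp; nlia.
have Rp1 : p 1 \in R by apply: Rp; nlia.
have [Sp1 nAp1] := RS _ Rp1.
apply: leq_trans (leq_sum1 _ Rp1).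
apply: (exc_apex Sp1 nAp1 A0 A1 nA); first by rewrite adjC adp.
by rewrite j1 adp // j1.
Qed.

End AddVertex.

End Growth.

(** * Closing induced paths by a new vertex *)

Section Growth.
Variable G : sgraph.
Hypothesis cG : conn [set: G].
Implicit Types (A R S X : {set G}) (x y v w : G) (p : nat -> G).

Definition noncomplete S := exists x y, [/\ x \in S, y \in S, x != y & ~~ adj x y].

(** When the new vertex is adjacent to all of [S], or to all but one vertex, an induced path
    avoiding a prescribed vertex is required. *)
Definition robust S := forall v, noncomplete (S :\ v).

Lemma noncompleteS S S' : S \subset S' -> noncomplete S -> noncomplete S'.
Proof.
by move=> /subsetP sS [x [y [Sx Sy nxy naxy]]]; exists x, y; split; auto.
Qed.

Lemma robustS S S' : S \subset S' -> robust S -> robust S'.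
Proof. by move=> sS rS v; apply: noncompleteS (rS v); apply: setSD. Qed.

Definition P3 S x u v :=
  [/\ x \in S, u \in S, v \in S & [/\ adj x u, adj u v, x != v & ~~ adj x v]].

Lemma noncomplete_P3 S : conn S -> noncomplete S -> exists x u v, P3 S x u v.
Proof.
move=> cS [x [y [Sx Sy nxy naxy]]].
have [u [v [Su Sv /andP[xu uv] nxv naxv]]] := conn_P3 cS Sx Sy nxy naxy.
by exists x, u, v; split.
Qed.

Lemma P3_exc S y x u v : y \notin S -> P3 S x u v -> adj y x -> adj y v ->
  exc S x v + 2 <= exc (y |: S) x v /\ exc S v x + 2 <= exc (y |: S) v x.
Proof.
move=> nSy [Sx Su Sv [xu uv nxv naxv]] yx yv.
suff le : exc S x v + 2 <= exc (y |: S) x v.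
  by rewrite [exc S v x]exc_sym // [exc (_ |: _) v x]exc_sym.
by apply: (@exc_P3 _ cG S (y |: S) x v u y); rewrite ?subsetUr ?setU11 // adjC.
Qed.

Lemma P3_sum S y x u v : y \notin S -> P3 S x u v -> adj y x -> adj y v ->
  total_exc S + 4 <= \sum_(s in S) \sum_(t in S) exc (y |: S) s t.
Proof.
move=> nSy P yx yv; have [le1 le2] := P3_exc nSy P yx yv.
have [Sx Su Sv [xu uv nxv naxv]] := P.
apply: (@total_exc_pairs _ cG S (y |: S) 2 [:: (x, v); (v, x)]) => [||s t].
- exact: subsetUr.
- by rewrite /= inE xpair_eqE negb_and nxv.
by rewrite !inE => /orP[]/eqP[-> ->].
Qed.

Lemma P3_sum2 S y x u v x' u' v' : y \notin S ->
  P3 S x u v -> adj y x -> adj y v ->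
  P3 S x' u' v' -> adj y x' -> adj y v' -> x != x' -> x != v' ->
  total_exc S + 8 <= \sum_(s in S) \sum_(t in S) exc (y |: S) s t.
Proof.
move=> nSy P yx yv P' yx' yv' nx' nv'.
have [le1 le2] := P3_exc nSy P yx yv; have [le1' le2'] := P3_exc nSy P' yx' yv'.
have [Sx Su Sv [xu uv nxv naxv]] := P.
have [Sx' Su' Sv' [xu' uv' nxv' naxv']] := P'.
apply: (@total_exc_pairs _ cG S (y |: S) 2 [:: (x, v); (v, x); (x', v'); (v', x')])
  => [||s t].
- exact: subsetUr.
- rewrite /= !inE !xpair_eqE (negbTE nxv) (negbTE nxv') (negbTE nx') (negbTE nv').
  by rewrite /= !andbF.
by rewrite !inE => /or4P[]/eqP[-> ->].
Qed.

(** The path brings 2 in each order. If [y] misses some vertex of [S], its row brings at least 2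
    more in each order. Otherwise robustness gives a second induced path avoiding [x], whose ends
    are adjacent to [y] as well. *)
Lemma add_P3 S y x u v : conn2 S -> robust S -> y \notin S -> P3 S x u v ->
  adj y x -> adj y v -> total_exc S + 6 <= total_exc (y |: S).
Proof.
move=> cS rS nSy P yx yv; have [Sx Su Sv [xu uv nxv naxv]] := P.
have le := total_exc_add cG nSy.
case: (set_0Vmem (S :\: nbhd S y)) => [R0|[r]]; last first.
  move=> Rr; have le2 : 2 <= \sum_(t in S) exc (y |: S) y t.
    apply: (@leq_trans (\sum_(t in S :\: nbhd S y) exc (y |: S) y t)).
      apply: (gain2 cG cS nSy Sx Sv nxv yx yv Rr) => [t|s t].
        by rewrite inE => /andP[].
      by move=> _ St nt _; rewrite inE nt.
    by rewrite [leqRHS](big_setID (nbhd S y)) /= leq_addl.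
  have := P3_sum nSy P yx yv; nlia.
have univ t : t \in S -> adj y t.
  move=> St; move/setP/(_ t): R0; rewrite !inE St andbT /=.
  by move/negbFE.
have [x' [u' [v' P']]] := noncomplete_P3 (cS.2 x) (rS x).
have [] := P'; rewrite !inE => /andP[nx' Sx'] /andP[nu' Su'] /andP[nv' Sv'] rest.
have P'' : P3 S x' u' v' by split.
have := P3_sum2 nSy P yx yv P'' (univ _ Sx') (univ _ Sv').
rewrite [x == x']eq_sym [x == v']eq_sym => /(_ nx' nv'); nlia.
Qed.

(* Closing an induced pentagon gives four new unordered pairs an extra edge. *)
Lemma close_C5 S y (p0 p1 p2 p3 : G) : y \notin S -> p0 \in S -> p1 \in S ->
  p2 \in S -> p3 \in S -> adj p0 p1 -> adj p1 p2 -> adj p2 p3 -> adj y p0 ->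
  adj y p3 -> ~~ adj y p1 -> ~~ adj y p2 -> ~~ adj p0 p2 -> ~~ adj p1 p3 ->
  ~~ adj p0 p3 -> p0 != p2 -> p1 != p3 -> total_exc S + 8 <= total_exc (y |: S).
Proof.
move=> nSy S0 S1 S2 S3 a01 a12 a23 y0 y3 ny1 ny2 n02 n13 n03 e02 e13.
have ney v : v \in S -> y != v by apply: neq_new.
have e03 : p0 != p3 by apply: contraTneq a01 => ->; rewrite adjC.
have e12 := adjN a12; have e01 := adjN a01; have e23 := adjN a23.
have D1 u v : adj u v -> dist u v = 1 by apply: adj_dist1.
have a10 : adj p1 p0 by rewrite adjC.
have a21 : adj p2 p1 by rewrite adjC.
have a32 : adj p3 p2 by rewrite adjC.
have b0 : adj p0 y by rewrite adjC.
have b3 : adj p3 y by rewrite adjC.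
have Dy1 : dist y p1 = 2 by apply: dist2 y0 a01; rewrite ?ney.
have Dy2 : dist y p2 = 2 by apply: dist2 y3 a32; rewrite ?ney.
have D02 : dist p0 p2 = 2 by apply: dist2 a01 a12.
have D13 : dist p1 p3 = 2 by apply: dist2 a12 a23.
have D03 : dist p0 p3 = 2 by apply: dist2 b0 y3.
have D1y : dist p1 y = 2 by rewrite distC.
have D2y : dist p2 y = 2 by rewrite distC.
have D20 : dist p2 p0 = 2 by rewrite distC.
have D30 : dist p3 p0 = 2 by rewrite distC.
have mo v : v \in S -> v \in y |: S by apply: mem_old.
have ext a b c d : a \in y |: S -> b \in y |: S -> adj a b ->
    dist c a = 1 -> dist c b = 2 -> dist d b = 1 -> dist d a = 2 ->
    dist c d = 2 -> extra (y |: S) c d (a, b).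
  by move=> Sa Sb ab E1 E2 E3 E4 E5; apply: mem_extra; rewrite ?E1 ?E2 ?E3 ?E4 ?E5.
have yS := mem_new S y.
have ex1 : extra (y |: S) y p1 (p3, p2) by apply: ext => //; (exact: mo || exact: D1).
have ex2 : extra (y |: S) y p2 (p0, p1) by apply: ext => //; (exact: mo || exact: D1).
have ex3 : extra (y |: S) p1 p3 (p0, y) by apply: ext => //; (exact: mo || exact: D1).
have ex4 : extra (y |: S) p0 p2 (y, p3) by apply: ext => //; (exact: mo || exact: D1).
have le1 : 2 <= \sum_(v in S) exc (y |: S) y v.
  apply: leq_trans (leq_sum2 _ S1 S2 e12).
  by have := exc_extra cG ex1; have := exc_extra cG ex2; nlia.
have le2 : total_exc S + 1 * 4 <= \sum_(u in S) \sum_(v in S) exc (y |: S) u v.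
  apply: (@total_exc_pairs _ cG S (y |: S) 1 [:: (p1, p3); (p3, p1); (p0, p2); (p2, p0)]).
  - exact: subsetUr.
  - rewrite /= !inE !xpair_eqE (negbTE e13) ![_ == p0]eq_sym (negbTE e01).
    by rewrite (negbTE e03) (negbTE e02) /= !andbF.
  have le3 : exc S p1 p3 + 1 <= exc (y |: S) p1 p3.
    by apply: exc_inc_extra ex3 _; rewrite ?subsetUr //= nSy orbT.
  have le4 : exc S p0 p2 + 1 <= exc (y |: S) p0 p2.
    by apply: exc_inc_extra ex4 _; rewrite ?subsetUr //= nSy.
  move=> u v; rewrite !inE => /or4P[]/eqP[-> ->]; split=> //;
  by rewrite [exc S _ _]exc_sym // [exc (_ |: _) _ _]exc_sym.
have := total_exc_add cG nSy; nlia.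
Qed.

End Growth.

(** * Growth by 4 and, without induced 4-cycles, by 6 per vertex *)

Section Growth.
Variable G : sgraph.
Hypothesis cG : conn [set: G].
Implicit Types (A R S X : {set G}) (x y v w : G) (p : nat -> G).

Definition noC4 := forall a b c d : G, adj a b -> adj b c -> adj c d ->
  adj d a -> a != c -> b != d -> ~~ adj a c -> ~~ adj b d -> False.

Lemma gain2_all S y a b r : conn2 S -> y \notin S -> a \in S -> b \in S ->
  a != b -> adj y a -> adj y b -> r \in S :\: nbhd S y ->
  2 <= \sum_(v in S) exc (y |: S) y v.
Proof.
move=> cS nSy Sa Sb nab ya yb Rr.
apply: (@leq_trans (\sum_(v in S :\: nbhd S y) exc (y |: S) y v)).
  apply: (gain2 cG cS nSy Sa Sb nab ya yb Rr) => [v|u v].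
    by rewrite inE => /andP[].
  by move=> _ Sv nv _; rewrite inE nv.
by rewrite [leqRHS](big_setID (nbhd S y)) /= leq_addl.
Qed.

Lemma nbC S y v : v \in S -> (v \in nbhd S y) = adj y v.
Proof. by move=> Sv; rewrite inE Sv. Qed.

Lemma add2 S y a b : conn2 S -> noncomplete S -> y \notin S -> a \in S ->
  b \in S -> a != b -> adj y a -> adj y b -> total_exc S + 4 <= total_exc (y |: S).
Proof.
move=> cS ncS nSy Sa Sb nab ya yb; have le := total_exc_add cG nSy.
case: (set_0Vmem (S :\: nbhd S y)) => [R0|[r Rr]]; last first.
  have := gain2_all cS nSy Sa Sb nab ya yb Rr.
  have := total_exc_le cG (subsetUr [set y] S); nlia.
have univ t : t \in S -> adj y t.
  by move=> St; move/setP/(_ t): R0; rewrite !inE St andbT => /negbFE.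
have [x [u [v P]]] := noncomplete_P3 cS.1 ncS; have [Sx _ Sv _] := P.
have := P3_sum cG nSy P (univ _ Sx) (univ _ Sv); nlia.
Qed.

Lemma grow2 S y a b : conn2 S -> noncomplete S -> y \notin S -> a \in S ->
  b \in S -> a != b -> adj y a -> adj y b -> step 2 S.
Proof.
move=> cS ncS nSy Sa Sb nab ya yb; apply: (step_add cS nSy Sa Sb nab ya yb).
exact: add2 nab ya yb.
Qed.

Section Slope3.
Hypothesis nC4 : noC4.
Variables (S : {set G}) (y a b : G).
Hypotheses (cS : conn2 S) (rS : robust S) (nSy : y \notin S).
Hypotheses (Sa : a \in S) (Sb : b \in S).
Hypotheses (nab : a != b) (ya : adj y a) (yb : adj y b).
Let A := nbhd S y.
Let S1 := y |: S.
Let R := S :\: A.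

Let RS v : v \in R -> v \in S /\ v \notin A.
Proof. by rewrite inE => /andP[]. Qed.

Let RA v : v \in R -> v \notin A. Proof. by case/RS. Qed.

Let Ry v : v \in R -> y != v /\ ~~ adj y v.
Proof. by case/RS=> Sv; rewrite nbC // => nyv; split=> //; apply: neq_new Sv. Qed.

Let Ay v : v \in A -> v \in S /\ adj y v.
Proof. by rewrite inE => /andP[]. Qed.

(** If [r] is adjacent to both [c] and [c'], these are two common neighbours with [y]. If it misses
    one of them and [dist y r <= 2], the edge from that one to [d] is extra. At distance 3, [(y, c)]
    and [(y, c')] are geodesic edges on the same level. *)
Lemma unit_beside c c' d r : c \in A -> c' \in A -> c != c' -> d \in R ->
  adj d c -> adj d c' -> r \in R -> adj r d -> 0 < exc S1 y r.
Proof.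
move=> Ac Ac' ncc' Rd dc dc' Rr rd.
have [Sr nAr] := RS Rr; have [Sd nAd] := RS Rd.
have [Sc yc] := Ay Ac; have [Sc' yc'] := Ay Ac'.
have [nyr nayr] := Ry Rr; have [nyd nayd] := Ry Rd.
have cd : adj c d by rewrite adjC.
have dr : adj d r by rewrite adjC.
have D1 u v : adj u v -> dist u v = 1 by apply: adj_dist1.
have Dyd : dist y d = 2 by apply: dist2 yc cd.
have nrA v : v \in A -> r != v by move=> Av; apply: contraNneq nAr => ->.
case: (boolP (adj r c && adj r c')) => [/andP[rc rc']|].
  by apply: leq_trans (exc_apex cG nSy Sr nAr Ac Ac' ncc' rc rc').
have Dyr3 : dist y r <= 3 by have := dist_adj cG y dr; rewrite Dyd.
have ex v : v \in A -> adj d v -> ~~ adj r v -> dist y r <= 2 -> 0 < exc S1 y r.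
  move=> Av dv nrv Dyr; have [Sv yv] := Ay Av.
  apply: (@exc_extra _ cG _ _ _ (v, d)); apply: mem_extra.
  - exact: mem_old.
  - exact: mem_old.
  - by rewrite adjC.
  - by rewrite Dyd D1.
  - by rewrite (D1 _ _ rd) (@dist2 _ cG d) // nrA.
  by rewrite (D1 _ _ yv) (D1 _ _ rd).
case: (leqP (dist y r) 2) => [Dyr|lt2].
  by rewrite negb_and => /orP[nr|nr]; [exact: ex nr Dyr | exact: ex nr Dyr].
move=> _; have Dyr : dist y r = 3 by nlia.
have nr v : v \in A -> ~~ adj r v.
  move=> Av; apply/negP => rv; have [_ yv] := Ay Av.
  have vr : adj v r by rewrite adjC.
  by have := dist_adj cG y vr; rewrite (D1 _ _ yv) leqNgt lt2.
have Drv v : v \in A -> adj d v -> dist r v = 2.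
  by move=> Av dv; apply: (@dist2 _ cG d) => //; [exact: nrA | exact: nr].
have gd v : v \in A -> adj d v -> (y, v) \in good S1 y r :&: geo_edges y r.
  move=> Av dv; have [Sv yv] := Ay Av; rewrite in_setI; apply/andP; split.
    apply: mem_good => //; first exact: mem_new.
    - exact: mem_old.
    - by rewrite distxx (D1 _ _ yv).
    by rewrite (Drv v Av dv) (distC cG) Dyr.
  by rewrite inE /= distxx (Drv v Av dv) Dyr.
rewrite -(cards1 (y, c)); apply: exc_ge => //.
  by rewrite sub1set; have := gd c Ac dc; rewrite in_setI => /andP[].
move=> f; rewrite inE => /eqP-> _; exists (y, c'); first exact: gd.
by rewrite inE xpair_eqE /= eqxx eq_sym ncc'.
Qed.

(** [d] gives the row of [y] two of the three units required. The third comes from a neighbour of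
    [d] in [R], or, if [d] is isolated in [R], from [gain2] on the rest of [R]. If [d] is all of
    [R], robustness at [d] leaves an induced path whose ends are adjacent to [y]. *)
Lemma grow3_apex c c' d : c \in A -> c' \in A -> c != c' -> d \in R ->
  adj d c -> adj d c' -> total_exc S + 6 <= total_exc S1.
Proof.
move=> Ac Ac' ncc' Rd dc dc'; have [Sd nAd] := RS Rd.
have le := total_exc_add cG nSy; have leS := total_exc_le cG (subsetUr [set y] S).
have le_d : 2 <= exc S1 y d by apply: exc_apex Ac Ac' ncc' dc dc'.
suff le3 : 3 <= \sum_(v in S) exc S1 y v \/ total_exc S + 6 <= total_exc S1.
  by case: le3 => // le3; move: le leS le3; rewrite -/S1; nlia.
case: (classic (exists2 r, r \in R & adj r d)) => [[r Rr rd]|no].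
  left; apply: leq_trans (leq_sum2 _ Sd (RS Rr).1 _); last first.
    by rewrite eq_sym; apply: adjN.
  have := unit_beside Ac Ac' ncc' Rd dc dc' Rr rd; move: le_d; nlia.
case: (set_0Vmem (R :\ d)) => [R0|[r Rr]]; last first.
  left; have nAd' : d \notin R :\ d by rewrite !inE eqxx.
  have le2 : 2 <= \sum_(v in R :\ d) exc S1 y v.
    apply: (gain2 cG cS nSy Sa Sb nab ya yb Rr) => [v|u v].
      by rewrite !inE => /and3P[_ /= -> ->].
    rewrite inE => /andP[/set1P nu Ru] Sv nAv uv; rewrite in_setD1 in_setD nAv Sv !andbT.
    by apply/eqP => E; case: no; exists u; rewrite -?E.
  have lesum : exc S1 y d + \sum_(v in R :\ d) exc S1 y v
      <= \sum_(v in S) exc S1 y v.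
    rewrite [leqRHS](bigD1 d) //= leq_add2l.
    rewrite [leqRHS](bigID (mem (R :\ d))) /=.
    apply: leq_trans (leq_addr _ _); apply: eq_leq; apply: eq_bigl => v.
    apply/idP/andP => [/setD1P[nvd Rv]|[]//]; have [Sv _] := RS Rv.
    by split; [rewrite Sv | apply/setD1P].
  move: le_d le2 lesum; nlia.
right; have [x [u [v P]]] := noncomplete_P3 (cS.2 d) (rS d).
have [] := P; rewrite !inE => /andP[nx Sx] /andP[nu Su] /andP[nv Sv] rest.
have univ t : t != d -> t \in S -> adj y t.
  move=> nt St; move/setP/(_ t): R0; rewrite !inE nt St andbT /=.
  by move/negbFE.
by apply: (@add_P3 _ cG S y x u v) => //; exact: univ.
Qed.

End Slope3.

End Growth.

Section Growth.
Variable G : sgraph.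
Hypothesis cG : conn [set: G].
Implicit Types (A R S X : {set G}) (x y v w : G) (p : nat -> G).
Hypothesis nC4 : noC4 G.

(** Adjacent to only one inner vertex, [w] would form an induced 4-cycle with that vertex, the other
    inner vertex and the end beyond it. *)
Lemma noC4_path w (p0 p1 p2 p3 : G) : adj p0 p1 -> adj p1 p2 -> adj p2 p3 ->
  p0 != p2 -> p1 != p3 -> ~~ adj p0 p2 -> ~~ adj p1 p3 -> adj w p0 ->
  adj w p3 -> w != p1 -> w != p2 -> adj w p1 = adj w p2.
Proof.
move=> a01 a12 a23 e02 e13 n02 n13 w0 w3 nw1 nw2.
have p0w : adj p0 w by rewrite adjC.
have p3w : adj p3 w by rewrite adjC.
case: (boolP (adj w p1)) => w1; case: (boolP (adj w p2)) => w2 //.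
  by case: (nC4 w1 a12 a23 p3w nw2 e13 w2 n13).
have p21 : adj p2 p1 by rewrite adjC.
have p10 : adj p1 p0 by rewrite adjC.
have n20 : ~~ adj p2 p0 by rewrite adjC.
have e20 : p2 != p0 by rewrite eq_sym.
by case: (nC4 w2 p21 p10 p0w nw1 e20 w1 n20).
Qed.

(** The cases are the numbers [j] of interior vertices of a minimal path between neighbours of [y].
    For [j = 1] there is an apex, for [j = 2] the vertex [y] closes an induced pentagon. For longer
    paths the drops from both ends give two units; a third is found, or else a vertex [w] outside
    [S] is added instead of [y] or together with it. *)
Lemma grow3 S y a b : conn2 S -> robust S -> noncomplete S -> y \notin S ->
  a \in S -> b \in S -> a != b -> adj y a -> adj y b -> step 3 S.
Proof.
move=> cS rS ncS nSy Sa Sb nab ya yb.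
pose A := nbhd S y; pose R := S :\: A.
have RS v : v \in R -> v \in S /\ v \notin A by rewrite inE => /andP[].
have RA v : v \in R -> v \notin A by case/RS.
have Ry v : v \in R -> y != v /\ ~~ adj y v.
  by case/RS=> Sv; rewrite nbC // => nyv; split=> //; apply: neq_new Sv.
have Ay v : v \in A -> v \in S /\ adj y v by rewrite inE => /andP[].
have add_y : total_exc S + 6 <= total_exc (y |: S) -> step 3 S.
  by move=> le; apply: (step_add cS nSy Sa Sb nab ya yb); apply: leq_trans le.
case: (set_0Vmem R) => [R0|[r Rr]].
  have univ t : t \in S -> adj y t.
    by move=> St; move/setP/(_ t): R0; rewrite !inE St andbT => /negbFE.
  have [x [u [v P]]] := noncomplete_P3 cS.1 ncS; have [Sx _ Sv _] := P.
  by apply/add_y/(add_P3 cG cS rS nSy P); apply: univ.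
have Aa : a \in A by rewrite inE Sa.
have Ab : b \in A by rewrite inE Sb.
have sA : A \subset S by apply/subsetP => v /Ay[].
have clR u v : u \in R -> v \in S -> v \notin A -> adj u v -> v \in R.
  by move=> _ Sv nAv _; rewrite in_setD nAv.
have [j [p mp]] := apath_ex cS sA Aa Ab nab Rr RS clR.
have [j0 [A0 A1 nA Rp adp] min_j] := mp.
case: (ltngtP j 1) => [|j2|j1]; first by rewrite ltnS leqn0 => /eqP E; rewrite E in j0.
  have inj := min_apath_inj mp RA.
  have ind := min_apath_ind mp RA.
  have Sp i : i <= j.+1 -> p i \in S by apply: (min_apath_mem RS mp).
  have Ry' i : 0 < i <= j -> y != p i /\ ~~ adj y (p i) by move=> /Rp/Ry.
  have [l [le_l Dl Dl2 exl]] := drop_unit cG nSy RS mp j2.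
  have [r' [le_r Dr Dr2 exr]] := drop_unit cG nSy RS (apath_rev mp) j2.
  case: (ltngtP j 2) => [|j3|Ej]; first by move: j2; nlia.
    have add3 : 3 <= \sum_(v in S) exc (y |: S) y v -> step 3 S.
      move=> le3; apply: add_y.
      by have := total_exc_add cG nSy; have := total_exc_le cG (subsetUr [set y] S); nlia.
    have mo v : v \in S -> v \in y |: S by apply: mem_old.
    have Sl : p l \in S by apply: Sp; nlia.
    have Sl1 : p l.+1 \in S by apply: Sp; nlia.
    have Sl2 : p l.+2 \in S by apply: Sp; nlia.
    have Sr : p (j.+1 - r'.+2) \in S by apply: Sp; nlia.
    have al : adj (p l) (p l.+1) by apply: adp; nlia.
    have al1 : adj (p l.+1) (p l.+2) by apply: adp; nlia.
    have al2 : adj (p l.+2) (p l.+1) by rewrite adjC.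
    have [el nl] : p l != p l.+2 /\ ~~ adj (p l) (p l.+2) by apply: ind; nlia.
    have D1 u v : adj u v -> dist u v = 1 by apply: adj_dist1.
    have E0 : dist y (p l) = l.+1 by apply: Dl.
    have E1 : dist y (p l.+1) = l.+2 by apply: Dl.
    have nr i : i < j -> (p i, p i.+1) != (p (j.+1 - r'), p (j.+1 - r'.+1)).
      move=> lt_i; apply/eqP => -[/inj E /inj E'].
      by have := E ltac:(nlia) ltac:(nlia); have := E' ltac:(nlia) ltac:(nlia); nlia.
    have lt_lj : l < j by nlia.
    (* In the first case [p l] and [p l.+2] are equally far from [y]. Then [(p l.+2, p l.+1)] and
       [(p l, p l.+1)] are geodesic edges for [y] and [p l.+1] on the same level, and one of them is
       the third unit. *)
    have [le_p|lt_p] := leqP (dist y (p l.+2)) l.+1.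
      have Dp : dist y (p l.+2) = l.+1.
        by apply/eqP; rewrite eqn_leq le_p; have := dist_adj cG y al2;
          rewrite (Dl l.+1).
      apply/add3/(@units _ cG S (y |: S) y
        [:: (p l.+2, (p l, p l.+1)); (p l.+1, (p l.+2, p l.+1));
            (p (j.+1 - r'.+2), (p (j.+1 - r'), p (j.+1 - r'.+1)))]).
        rewrite /= !inE negb_or !andbT -andbA; apply/and3P; split.
        - by rewrite xpair_eqE negb_and eq_sym (adjN al1).
        - by apply: contraNneq (nr l lt_lj) => -[_ -> ->].
        apply/eqP => -[E _ E']; have := inj (j.+1 - r'.+2) (j.+1 - r'.+1).
        by rewrite -E -E' => /(_ ltac:(nlia) ltac:(nlia) erefl); nlia.
      have gl : (p l, p l.+1) \in good (y |: S) y (p l.+1).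
        apply: mem_good; rewrite ?mo ?E0 ?E1 //.
        by rewrite distxx D1 // adjC.
      move=> v f; rewrite 2!in_cons mem_seq1 => /or3P[]/eqP[-> ->]; split=> //.
      - by case/andP: exl.
      - by case/andP: exl => _ /negbTE->.
      - by apply: mem_good; rewrite ?mo ?Dp ?E1 // distxx D1.
      - move=> _; exists (p l, p l.+1).
          by rewrite in_setI gl inE /= distxx E0 E1 addn0.
        split; last by rewrite /= Dp E0.
        rewrite !inE !negb_or !xpair_eqE (negbTE el) !andbF /=.
        rewrite (negbTE (adjN al1)) /=; by apply: contraNN (nr l lt_lj) => /andP[].
      - by case/andP: exr.
      - by case/andP: exr => _ /negbTE->.
    have Dp : dist y (p l.+2) = l.+2 by apply/eqP; rewrite eqn_leq Dl2.
    have nAA : p 0 <> p j.+1 by apply/eqP.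
    case: l le_l Dl Dl2 exl Sl Sl1 Sl2 al al1 al2 el nl E0 E1 lt_lj lt_p Dp
      => [|l] le_l Dl Dl2 exl Sl Sl1 Sl2 al al1 al2 el nl E0 E1 lt_lj lt_p Dp.
      (* As [2 < j], minimality keeps this common neighbour of [y] and [p 2] outside [S]. Either [w]
         closes the induced path [p 0 p 1 p 2], or [y p 0 p 1 p 2 w] is an induced pentagon; in that
         case both [y] and [w] are added, for a gain of 4 + 8. *)
      have [w [yw w2]] := dist2P cG Dp.
      have nSw : w \notin S.
        apply/negP => Sw; have Aw : w \in A by rewrite inE Sw.
        have p2w : adj (p 2) w by rewrite adjC.
        have [[E2|wp0] [//|wpj]] := min_apath_end mp Aw (k := 2) ltac:(nlia) p2w.
          by move: j3; rewrite E2 ltnn.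
        by apply: nAA; rewrite -wp0.
      have [_ y0] := Ay _ A0; have wy : adj w y by rewrite adjC.
      have [ey1 ny1] : y != p 1 /\ ~~ adj y (p 1) by apply: Ry'; nlia.
      have [ey2 ny2] : y != p 2 /\ ~~ adj y (p 2) by apply: Ry'; nlia.
      have nw v : v \in S -> w != v by apply: neq_new.
      have E := noC4_path y0 al al1 ey1 el ny1 nl wy w2 (nw _ Sl) (nw _ Sl1).
      case: (boolP (adj w (p 0))) => w0; move: (w0); rewrite E => w1.
        have P : P3 S (p 0) (p 1) (p 2) by [].
        apply: (step_add cS nSw Sl Sl2 el w0 w2).
        exact: leq_trans (add_P3 cG cS rS nSw P w0 w2).
      have cS1 : conn2 (y |: S) by apply: conn2_add ya yb.
      have nS1w : w \notin y |: S by rewrite in_setU1 negb_or nSw (adjN wy).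
      have le4 := add2 cG cS ncS nSy Sa Sb nab ya yb.
      have le8 := close_C5 cG nS1w (mem_new S y) (mo _ Sl) (mo _ Sl1) (mo _ Sl2)
        y0 al al1 wy w2 w0 w1 ny1 nl ny2 ey1 el.
      exists (w |: (y |: S)); split.
      - apply: (@proper_sub_trans _ _ (y |: S)); last exact: subsetUr.
        by rewrite properUr // sub1set.
      - exact: conn2_add (mem_new S y) (mo _ Sl2) ey2 wy w2.
      by rewrite !cardsU1 nS1w nSy; nlia.
    (* With [l] shifted by one, the vertices from [p l] to [p l.+3] have distances [l.+1], [l.+2],
       [l.+3], [l.+3] to [y]. The distance between [p l] and [p l.+3] decides how to continue. *)
    have S0 : p l \in S by apply: Sp; nlia.
    have a0 : adj (p l) (p l.+1) by apply: adp; nlia.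
    have [e02 n02] : p l != p l.+2 /\ ~~ adj (p l) (p l.+2) by apply: ind; nlia.
    have [e03 n03] : p l != p l.+3 /\ ~~ adj (p l) (p l.+3) by apply: ind; nlia.
    have D31 : dist (p l.+3) (p l.+1) = 2.
      by rewrite distC // (dist2 cG el nl al al1).
    have n30 : ~~ adj (p l.+3) (p l) by rewrite adjC.
    have e30 : p l.+3 != p l by rewrite eq_sym.
    have ge2 := dist_ge2 cG e30 n30.
    have le3 : dist (p l.+3) (p l) <= 3.
      have a10 : adj (p l.+1) (p l) by rewrite adjC.
      by have := dist_adj cG (p l.+3) a10; rewrite D31.
    have [D30|D30] : dist (p l.+3) (p l) = 2 \/ dist (p l.+3) (p l) = 3.
    - by move: ge2 le3; nlia.
    - have [w [p3w w0]] := dist2P cG D30; have w3 : adj w (p l.+3) by rewrite adjC.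
      have nSw : w \notin S.
        apply/negP => Sw; case: (boolP (w \in A)) => [Aw|nAw].
          have [+ [//|wpj]] := min_apath_end mp Aw (k := l.+3) ltac:(nlia) p3w.
          case=> [Ej|wp0]; last by apply: nAA; rewrite -wp0.
          have a1 : adj (p j.+1) (p j) by rewrite adjC; apply: adp.
          have [_ yj] := Ay _ A1; have := dist_adj cG y a1.
          by rewrite (D1 _ _ yj) -Ej Dp.
        (* If [w] were in [R], it could replace both [p l.+1] and [p l.+2], shortening a minimal
           path. *)
        pose q t := if t <= l then p t else if t == l.+1 then w else p t.+1.
        have q_lo t : t <= l -> q t = p t by rewrite /q => ->.
        have q_mid : q l.+1 = w by rewrite /q ltnn eqxx.
        have q_hi t : l.+1 < t -> q t = p t.+1.
          by move=> lt_t; rewrite /q leqNgt (ltnW lt_t) /= gtn_eqF.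
        have Rw : w \in R by rewrite in_setD nAw.
        have Ej : j.-1.+1 = j by rewrite prednK.
        suff : j <= j.-1 by move: j3; nlia.
        apply: (min_j _ q); [by move: j3; nlia | split].
        - by rewrite q_lo.
        - by rewrite Ej q_hi //; nlia.
        - by rewrite Ej q_lo // q_hi //; nlia.
        - move=> t le_t; case: (ltngtP t l.+1) => [lt_t|lt_t|->].
          + by rewrite q_lo //; apply: Rp; nlia.
          + by rewrite q_hi //; apply: Rp; nlia.
          by rewrite q_mid.
        move=> t le_t; case: (ltngtP t l.+1) => [lt_t|lt_t|->].
        - rewrite ltnS in lt_t; rewrite (q_lo t) //.
          move: lt_t; rewrite leq_eqVlt => /orP[/eqP->|lt_t].
            by rewrite q_mid adjC.
          by rewrite q_lo //; apply: adp; nlia.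
        - by rewrite !q_hi ?ltnS ?(ltnW lt_t) //; apply: adp; nlia.
        by rewrite q_mid q_hi.
      have nw v : v \in S -> w != v by apply: neq_new.
      have E := noC4_path a0 al al1 e02 el n02 nl w0 w3 (nw _ Sl) (nw _ Sl1).
      case: (boolP (adj w (p l.+1))) => w1; move: (w1); rewrite E => w2.
        have P : P3 S (p l.+1) (p l.+2) (p l.+3) by [].
        apply: (step_add cS nSw Sl Sl2 el w1 w3).
        exact: leq_trans (add_P3 cG cS rS nSw P w1 w3).
      apply: (step_add cS nSw S0 Sl2 e03 w0 w3).
      apply: leq_trans (close_C5 cG nSw S0 Sl Sl1 Sl2 a0 al al1 w0 w3 w1 w2
        n02 nl n03 e02 el).
      by rewrite leq_add2l.
    have E00 : dist y (p l) = l.+1 by apply: Dl; nlia.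
    (* At distance 3 the edge preceding the drop edge is extra for the same pair; this is the third
       unit. *)
    have ex2 : extra (y |: S) y (p l.+3) (p l, p l.+1).
      apply: mem_extra; rewrite ?mo ?E00 ?E0 ?D30 ?D31 ?Dp //.
      by rewrite addn2.
    apply/add3/(@extra_units _ cG S (y |: S) y
      [:: (p l.+3, (p l.+1, p l.+2)); (p l.+3, (p l, p l.+1));
          (p (j.+1 - r'.+2), (p (j.+1 - r'), p (j.+1 - r'.+1)))]).
      rewrite /= !inE negb_or !andbT -andbA; apply/and3P; split.
      - by rewrite !xpair_eqE !negb_and [p l.+1 == _]eq_sym (adjN a0) orbT.
      - by apply: contraNneq (nr l.+1 lt_lj) => -[_ -> ->].
      by apply: contraNneq (nr l ltac:(nlia)) => -[_ -> ->].
    by move=> v f; rewrite 2!in_cons mem_seq1 => /or3P[]/eqP[-> ->].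
  have [e02 n02] : p 0 != p 2 /\ ~~ adj (p 0) (p 2) by apply: ind; nlia.
  have [e13 n13] : p 1 != p 3 /\ ~~ adj (p 1) (p 3) by apply: ind; nlia.
  have a01 : adj (p 0) (p 1) by apply: adp.
  have a12 : adj (p 1) (p 2) by apply: adp; nlia.
  have a23 : adj (p 2) (p 3) by apply: adp; nlia.
  have [[_ y0] [_ y3]] := (Ay _ A0, Ay _ A1); rewrite Ej in y3.
  have [_ n1] := Ry' 1 ltac:(nlia); have [_ n2] := Ry' 2 ltac:(nlia).
  have n03 : ~~ adj (p 0) (p 3).
    apply/negP => a03; apply: (nC4 a01 a12 a23 _ e02 e13 n02 n13).
    by rewrite adjC.
  apply: add_y; apply: leq_trans (close_C5 cG nSy _ _ _ _ a01 a12 a23 y0 y3 n1 n2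
    n02 n13 n03 e02 e13); rewrite ?leq_add2l //; apply: Sp; nlia.
have Rp1 : p 1 \in R by apply: Rp; nlia.
apply: add_y; apply: (grow3_apex cG cS rS nSy Sa Sb nab ya yb A0 A1 nA Rp1).
  by rewrite adjC adp.
by rewrite j1 adp // j1.
Qed.

End Growth.

(** * Isometric cycles *)

Section Cycles.
Variable G : sgraph.
Hypothesis cG : conn [set: G].
Implicit Types (A R S X : {set G}) (x y v w : G) (p z : nat -> G).

(* [z] runs periodically around an isometric cycle of length [N]. *)
Definition iso N z :=
  forall i k, k <= N -> dist (z i) (z (i + k)) = minn k (N - k).

Definition cyc N z := [set z i | i : 'I_N].

Lemma iso_mod N (f : nat -> G) : 0 < N ->
  (forall a b, a <= b -> b < N -> dist (f a) (f b) = minn (b - a) (N - (b - a))) ->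
  iso N (fun i => f (i %% N)).
Proof.
move=> N0 D i k le_k; have lt_i := ltn_pmod i N0.
rewrite -(modnDml i k N); move: (i %% N) lt_i => r lt_r.
case: (ltnP (r + k) N) => le_rk.
  by rewrite (modn_small le_rk) D ?leq_addr // addKn.
case: (ltngtP k N) => [lt_k|lt_k|->]; first last.
- by rewrite modnDr modn_small // distxx subnn minn0.
- by move: lt_k le_k; lia.
have -> : (r + k) %% N = r + k - N.
  by rewrite -(subnK le_rk) modnDr modn_small ?subnK //; move: lt_k lt_r; lia.
rewrite distC // D; [|move: lt_k; lia|exact: lt_r].
have -> : r - (r + k - N) = N - k by move: lt_k le_rk lt_r; lia.
by rewrite minnC subKn // ltnW.
Qed.

Section Iso.
Variables (N : nat) (z : nat -> G).
Hypotheses (N4 : 4 <= N) (iz : iso N z).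

Lemma isoE i a b : a <= b -> b - a <= N ->
  dist (z (i + a)) (z (i + b)) = minn (b - a) (N - (b - a)).
Proof. by move=> le_ab le_N; rewrite -{1}(subnKC le_ab) addnA iz. Qed.

Lemma iso_per i : z (i + N) = z i.
Proof.
by apply/esym/eqP; rewrite -(dist0 cG) iz // subnn minn0.
Qed.

Lemma iso_modE i : z i = z (i %% N).
Proof.
rewrite {1}(divn_eq i N) addnC; elim: (i %/ N) => [|q IH]; first by rewrite addn0.
by rewrite mulSn addnCA addnC iso_per.
Qed.

Lemma iso_adj i : adj (z i) (z i.+1).
Proof.
rewrite (adj_dist cG) -addn1 iz; last by move: N4; nlia.
by apply/eqP; move: N4; nlia.
Qed.

Lemma iso_inj i a b : a < N -> b < N -> z (i + a) = z (i + b) -> a = b.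
Proof.
wlog le_ab : a b / a <= b => [wl|] lt_a lt_b E.
  by case: (leqP a b) => [|/ltnW] le; [apply: wl | apply/esym/wl].
have := @isoE i a b le_ab; rewrite E distxx => /(_ ltac:(nlia)).
by move: le_ab lt_b; nlia.
Qed.

Lemma mem_cyc i : z i \in cyc N z.
Proof.
have N0 : 0 < N by move: N4; nlia.
rewrite iso_modE; apply/imsetP.
by exists (Ordinal (ltn_pmod i N0)).
Qed.

Lemma card_cyc : #|cyc N z| = N.
Proof.
rewrite card_imset ?card_ord // => i k E; apply: val_inj.
exact: (@iso_inj 0 i k (ltn_ord i) (ltn_ord k) E).
Qed.

Lemma conn2_cyc : conn2 (cyc N z).
Proof.
have N0 : 0 < N by move: N4; nlia.
have cC : conn (cyc N z).
  have := @conn_seg _ z N.-1; rewrite prednK //; apply=> i _; exact: iso_adj.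
split=> // v; case: (boolP (v \in cyc N z)) => [|nv]; last first.
  suff -> : cyc N z :\ v = cyc N z by [].
  by apply/setDidPl; rewrite disjoint_sym disjoints1.
case/imsetP=> i _ ->; have N2 : N.-2.+1 = N.-1 by move: N4; nlia.
have -> : cyc N z :\ z i = [set z (i.+1 + t) | t : 'I_N.-2.+1].
  apply/setP => u; apply/setD1P/imsetP.
    case=> nu /imsetP[k _ Eu]; have lt_k := ltn_ord k; have lt_i := ltn_ord i.
    case: (ltngtP k i) => [lt|lt|Eki]; last by rewrite Eu Eki eqxx in nu.
      have lt_t : k + N - i.+1 < N.-2.+1 by rewrite N2; move: N4 lt lt_i; nlia.
      exists (Ordinal lt_t) => //=; rewrite subnKC; last by move: lt_i; nlia.
      by rewrite iso_per.
    have lt_t : k - i.+1 < N.-2.+1 by rewrite N2; move: N4 lt lt_k; nlia.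
    by exists (Ordinal lt_t) => //=; rewrite subnKC.
  case=> t _ ->; split; last exact: mem_cyc.
  have lt_t : t.+1 < N by have := ltn_ord t; move: N4; nlia.
  apply/negP => /eqP E; suff : t.+1 = 0 by [].
  by apply: (@iso_inj i t.+1 0 lt_t N0); rewrite addn0 addnS -addSn.
apply: (@conn_seg _ (fun t => z (i.+1 + t))) => t _; rewrite addnS.
exact: iso_adj.
Qed.

Section Gain.
Variables (S : {set G}) (i : nat).
Hypothesis sS : cyc N z \subset S.

Lemma cyc_sub k : z k \in S.
Proof. exact: (subsetP sS) (mem_cyc k). Qed.

Lemma cyc_unit a b c : a <= N -> b <= N -> c <= N ->
  adj (z (i + b)) (z (i + c)) ->
  minn c (N - c) = (minn b (N - b)).+1 ->
  dist (z (i + a)) (z (i + b)) = (dist (z (i + a)) (z (i + c))).+1 ->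
  minn a (N - a) <= minn b (N - b) + dist (z (i + a)) (z (i + c)) ->
  extra S (z i) (z (i + a)) (z (i + b), z (i + c)).
Proof.
move=> le_a le_b le_c bc E1 E2 lt.
by apply: mem_extra; rewrite ?cyc_sub ?iz.
Qed.

Lemma cyc_adj a : adj (z (i + a)) (z (i + a.+1)).
Proof. by rewrite addnS; apply: iso_adj. Qed.

Lemma cyc_adjC a : adj (z (i + a.+1)) (z (i + a)).
Proof. by rewrite adjC cyc_adj. Qed.

Lemma cyc_neq a b : a < N -> b < N -> a != b -> z (i + a) != z (i + b).
Proof.
by move=> lt_a lt_b; apply: contraNneq => /(@iso_inj i a b lt_a lt_b) ->.
Qed.

End Gain.

End Iso.

Section Gain.
Variables (S : {set G}) (z : nat -> G) (i : nat).

(** Each of the two vertices at distance 2 contributes the middle edge of the longer arc. *)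
Lemma cyc_gain5 : iso 5 z -> cyc 5 z \subset S ->
  2 <= \sum_(u in S) exc S (z i) u.
Proof.
move=> iz sS; have N4 : 3 < 5 by [].
apply: leq_trans (leq_sum2 _ (cyc_sub N4 iz sS (i + 2)) (cyc_sub N4 iz sS (i + 3))
  (cyc_neq N4 iz i _ _ _)) => //.
apply: (@leq_add 1 1).
  apply: (@exc_extra _ cG _ _ _ (z (i + 4), z (i + 3))).
  apply: (cyc_unit N4 iz sS) => //; rewrite ?(isoE iz) //.
  exact: cyc_adjC.
apply: (@exc_extra _ cG _ _ _ (z (i + 1), z (i + 2))).
apply: (cyc_unit N4 iz sS) => //; rewrite ?(distC cG (z (i + 3))) ?(isoE iz) //.
exact: cyc_adj.
Qed.

(** The opposite vertex contributes 2, since one of its two geodesics is surplus. Each neighbour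
    contributes the edge opposite to the one joining it to [z i]. *)
Lemma cyc_gain4 : iso 4 z -> cyc 4 z \subset S ->
  4 <= \sum_(u in S) exc S (z i) u.
Proof.
move=> iz sS; have N4 : 3 < 4 by [].
have mz k : z k \in S := cyc_sub N4 iz sS k.
have ez a b : a < 4 -> b < 4 -> (z (i + a) == z (i + b)) = (a == b).
  move=> lt_a lt_b; apply/eqP/eqP => [|->] //; exact: (iso_inj N4 iz).
have D a : a <= 4 -> dist (z i) (z (i + a)) = minn a (4 - a) := iz i a.
have az := cyc_adj N4 iz i; have azC := cyc_adjC N4 iz i.
have az3 : adj (z (i + 0)) (z (i + 3)).
  by rewrite addn0 (adj_dist cG) D.
have dC a b : a <= b -> b - a <= 4 ->
    dist (z (i + b)) (z (i + a)) = minn (b - a) (4 - (b - a)).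
  by move=> le_ab le_N; rewrite (distC cG) (isoE iz).
have gd a b c : a <= 4 -> b <= 4 -> c <= 4 -> adj (z (i + b)) (z (i + c)) ->
    minn c (4 - c) = (minn b (4 - b)).+1 ->
    dist (z (i + a)) (z (i + b)) = (dist (z (i + a)) (z (i + c))).+1 ->
    (z (i + b), z (i + c)) \in good S (z i) (z (i + a)).
  by move=> le_a le_b le_c bc E1 E2; apply: mem_good; rewrite ?mz ?D.
have gg b c : (z (i + b), z (i + c)) \in good S (z i) (z (i + 2)) ->
    (dist (z i) (z (i + b)) + dist (z (i + 2)) (z (i + c))).+1 = 2 ->
    (z (i + b), z (i + c)) \in good S (z i) (z (i + 2)) :&: geo_edges (z i) (z (i + 2)).
  by move=> g E; rewrite in_setI g inE /= E D.
have g1 : (z (i + 0), z (i + 3)) \in good S (z i) (z (i + 2)).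
  by apply: gd => //; rewrite (dC 0 2) // (isoE iz).
have g2 : (z (i + 3), z (i + 2)) \in good S (z i) (z (i + 2)).
  by apply: gd => //; rewrite (isoE iz) // distxx.
have g3 : (z (i + 0), z (i + 1)) \in good S (z i) (z (i + 2)).
  by apply: gd => //; rewrite (dC 0 2) // (dC 1 2).
have g4 : (z (i + 1), z (i + 2)) \in good S (z i) (z (i + 2)).
  by apply: gd => //; rewrite (dC 1 2) // distxx.
apply: (@units _ cG S S (z i)
  [:: (z (i + 2), (z (i + 0), z (i + 3))); (z (i + 2), (z (i + 3), z (i + 2)));
      (z (i + 1), (z (i + 3), z (i + 2))); (z (i + 3), (z (i + 1), z (i + 2)))]).
  by rewrite /= !inE !xpair_eqE !ez.
move=> v f; rewrite 3!in_cons mem_seq1 => /or4P[]/eqP[-> ->]; split=> //.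
- move=> _; exists (z (i + 0), z (i + 1)); last first.
    by rewrite !inE !xpair_eqE !ez.
  by apply: gg => //; rewrite D // (dC 1 2).
- move=> _; exists (z (i + 1), z (i + 2)); last first.
    by rewrite !inE !xpair_eqE !ez //= !D.
  by apply: gg => //; rewrite D // distxx.
- by apply: gd => //; rewrite (isoE iz) // (isoE iz).
- by rewrite inE /= !D // (isoE iz).
- by apply: gd => //; rewrite (dC 1 3) // (dC 2 3).
by rewrite inE /= !D // (dC 2 3).
Qed.

(** On the longer arc a non-antipodal pair at distance [d] has [d] extra edges if [N] is even and
    [d - 1] if [N] is odd. Distance 3 gives at least two for every [N] from 7 on. In a hexagon
    distance 3 is antipodal, and distance 2 gives two. *)
Lemma cyc_gain6 N : 6 <= N -> iso N z -> cyc N z \subset S ->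
  4 <= \sum_(u in S) exc S (z i) u.
Proof.
move=> N6 iz sS; have N4 : 3 < N by nlia.
have dC a b : a <= b -> b - a <= N ->
    dist (z (i + b)) (z (i + a)) = minn (b - a) (N - (b - a)).
  by move=> le_ab le_N; rewrite (distC cG) (isoE iz).
have ez a b : a < N -> b < N -> (z (i + a) == z (i + b)) = (a == b).
  move=> lt_a lt_b; apply/eqP/eqP => [|->] //; exact: (iso_inj N4 iz).
have [N6'|N7] := leqP N 6.
  have EN : N = 6 by nlia.
  move: iz sS N4 dC ez; rewrite EN => iz sS N4 dC ez.
  apply: (@extra_units _ cG S S (z i)
    [:: (z (i + 2), (z (i + 5), z (i + 4))); (z (i + 2), (z (i + 4), z (i + 3)));
        (z (i + 4), (z (i + 1), z (i + 2))); (z (i + 4), (z (i + 2), z (i + 3)))]).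
    by rewrite /= !inE !xpair_eqE !ez.
  move=> v f; rewrite 3!in_cons mem_seq1 => /or4P[]/eqP[-> ->];
    split; rewrite ?(cyc_sub N4 iz sS) //.
  - by apply: (cyc_unit N4 iz sS); rewrite ?(isoE iz) ?(cyc_adjC N4 iz).
  - by apply: (cyc_unit N4 iz sS); rewrite ?(isoE iz) ?(cyc_adjC N4 iz).
  - by apply: (cyc_unit N4 iz sS); rewrite ?dC ?(cyc_adj N4 iz).
  by apply: (cyc_unit N4 iz sS); rewrite ?dC ?(cyc_adj N4 iz).
pose M := N./2.
have [M1 M2] : M.*2 <= N /\ N <= M.*2.+1.
  by rewrite /M -{2 3}(odd_double_half N); case: (odd N); rewrite /=; nlia.
apply: (@extra_units _ cG S S (z i)
  [:: (z (i + 3), (z (i + (N - M).+1), z (i + (N - M))));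
      (z (i + 3), (z (i + (N - M).+2), z (i + (N - M).+1)));
      (z (i + (N - 3)), (z (i + M.-1), z (i + M)));
      (z (i + (N - 3)), (z (i + M.-2), z (i + M.-1)))]).
  rewrite /= !inE !xpair_eqE !ez; nlia.
have EM1 : M.-1 = M.-2.+1 by nlia.
have EM : M = M.-1.+1 by nlia.
have a1 := cyc_adj N4 iz i M.-1; rewrite -EM in a1.
have a2 := cyc_adj N4 iz i M.-2; rewrite -EM1 in a2.
move=> v f; rewrite 3!in_cons mem_seq1 => /or4P[]/eqP[-> ->];
  split; rewrite ?(cyc_sub N4 iz sS) //.
- apply: (cyc_unit N4 iz sS); rewrite ?(isoE iz) ?(cyc_adjC N4 iz) //; nlia.
- apply: (cyc_unit N4 iz sS); rewrite ?(isoE iz) ?(cyc_adjC N4 iz) //; nlia.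
- apply: (cyc_unit N4 iz sS); rewrite ?dC //; nlia.
- apply: (cyc_unit N4 iz sS); rewrite ?dC //; nlia.
Qed.

End Gain.

End Cycles.

(** * Isometric cycles leaving a set *)

Section Crossing.
Variable G : sgraph.
Hypothesis c2G : conn2 [set: G].
Let cG : conn [set: G] := c2G.1.
Implicit Types (A R S X : {set G}) (x y v w : G) (p z : nat -> G).

Definition closed_in S := forall y a b, y \notin S -> a \in S -> b \in S ->
  adj y a -> adj y b -> a = b.

(* A shortest walk avoiding [s] from an outer to an inner neighbour of [s],
   completed by [s]: a shortcut would either avoid [s] and shorten the walk, or
   pass through [s] and cut off a shorter such walk. *)
Lemma crossing S s0 : conn2 S -> closed_in S -> S != setT -> s0 \in S ->
  (exists2 s1, s1 \in S & s1 != s0) ->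
  exists N z, [/\ 4 <= N, iso N z, z 0 \in S, z 1 \notin S & z N.-1 \in S].
Proof.
move=> cS clS nST Ss0 [s1 Ss1 n10].
have [y0 nSy0] : exists y, y \notin S.
  apply/existsP; rewrite -negb_forall; apply: contra nST => /forallP H.
  by apply/eqP/setP => v; rewrite in_setT H.
have [s [y [_ Ss _ nSy sy]]] := cG (in_setT s0) Ss0 (in_setT y0) nSy0.
have [s2 Ss2 n2s] : exists2 s2, s2 \in S & s2 != s.
  by case: (eqVneq s s0) => [->|n0]; [exists s1 | exists s0; rewrite // eq_sym].
have [_ [x [_ /set1P-> Sx + sx]]] := cS.1 [set s] s s2 Ss (set11 s) Ss2
  (introN set1P (elimN eqP n2s)).
rewrite inE => nxs.
pose B := [set: G] :\ s.
have inB v : (v \in B) = (v != s) by rewrite !inE andbT.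
pose P m := exists y x, [/\ y \notin S, adj s y, x \in S, adj s x & walk B m y x].
have [m [y1 [x1 [nSy1 sy1 Sx1 sx1 [w [w0 wm Bw adw]]]]] min_m] : exists2 m, P m &
    forall k, P k -> m <= k.
  have By : y \in B by rewrite inB eq_sym adjN.
  have Bx : x \in B by rewrite inB.
  apply: least_nat; have [n wn] := conn_walk (c2G.2 s) By Bx.
  by exists n, y, x; split.
pose f k := if k is k'.+1 then w k' else s.
have fadj a : a <= m -> adj (f a) (f a.+1).
  by case: a => [|a] lt_a /=; [rewrite w0 | apply: adw].
have subw a b : a <= b -> b <= m -> walk B (b - a) (w a) (w b).
  move=> le_ab le_b; apply: walk_sub => // t /andP[_ le_t].
    by apply: Bw; apply: leq_trans le_b.
  by apply: adw; apply: leq_trans le_b.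
have up a b : a <= b -> b <= m.+1 -> dist (f a) (f b) <= b - a.
  move=> le_ab le_b; apply: dist_le; apply: walk_sub => // t /andP[_ lt_t].
  by apply: fadj; rewrite -ltnS; apply: leq_trans lt_t _.
(* The other way round, through [s]. *)
have up' a b : a <= b -> b <= m.+1 -> dist (f a) (f b) <= m.+2 - (b - a).
  move=> le_ab le_b; have le0 := up 0 a (leq0n a) (leq_trans le_ab le_b).
  have le1 := up b m.+1 le_b (leqnn _).
  have fs : adj (f m.+1) (f 0) by rewrite /= wm adjC.
  have := dist_adj cG (f b) fs; have := dist_tri cG (f 0) (f a) (f b).
  rewrite (distC cG (f a) (f 0)) (distC cG (f b) (f 0)).
  by move: le_ab le_b le0 le1; nlia.
(* The first vertex after [s] on a geodesic to [w i] is a neighbour of [s] inside or outside [S].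
   The rest of the geodesic, joined to the part of [w] from [y1] or to [x1] respectively, competes
   with [w]. *)
have lowA i : i <= m -> minn i.+1 (m.+1 - i) <= dist s (w i).
  move=> le_i; rewrite leqNgt; apply/negP => lt.
  have [g [g0 gl dg ag]] := geodesic cG s (w i).
  have l0 : 0 < dist s (w i).
    by rewrite lt0n (dist0 cG) eq_sym -inB Bw.
  have wg : walk B (dist s (w i)).-1 (g 1) (w i).
    rewrite -{2}gl -subn1; apply: walk_sub => // t /andP[t0 lt_t].
      by rewrite inB -(dist0 cG) (distC cG) dg // -lt0n.
    exact: ag.
  have sg : adj s (g 1) by rewrite -{1}g0; apply: ag.
  case: (boolP (g 1 \in S)) => Sg.
    have : m <= i + (dist s (w i)).-1.
      apply: min_m; exists y1, (g 1); split=> //.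
      apply: walk_cat (walk_rev wg); rewrite -{1}(subn0 i) -w0; exact: subw.
    by move: lt l0 le_i; nlia.
  have : m <= (dist s (w i)).-1 + (m - i).
    apply: min_m; exists (g 1), x1; split=> //.
    by apply: walk_cat wg _; rewrite -wm; apply: subw.
  by move: lt l0 le_i; nlia.
have lowB i j : i <= j -> j <= m -> minn (j - i) (m.+2 - (j - i)) <= dist (w i) (w j).
  move=> le_ij le_j; have le_i := leq_trans le_ij le_j.
  have [g [g0 gl dg ag]] := geodesic cG (w i) (w j).
  case: (classic (exists2 t, t <= dist (w i) (w j) & g t = s)) => [[t le_t gt]|no].
    have Et : dist (w i) s = t by rewrite -gt dg.
    have le2 : dist s (w j) <= dist (w i) (w j) - t.
      apply: dist_le; rewrite -gt -{2}gl; apply: walk_sub => // u /andP[_ lt_u].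
      exact: ag.
    have := lowA i le_i; rewrite (distC cG) Et; have := lowA j le_j.
    by move: le2 le_t le_ij le_j; nlia.
  have W1 : walk B i y1 (w i) by have := subw 0 i isT le_i; rewrite w0 subn0.
  have W2 : walk B (dist (w i) (w j)) (w i) (w j).
    exists g; split=> // t le_t; rewrite inB; apply/eqP => gt.
    by case: no; exists t.
  have W3 : walk B (m - j) (w j) x1 by have := subw j m le_j (leqnn m); rewrite wm.
  have : m <= i + dist (w i) (w j) + (m - j).
    by apply: min_m; exists y1, x1; split=> //; apply: walk_cat (walk_cat W1 W2) W3.
  by move: le_ij le_j; nlia.
have D a b : a <= b -> b < m.+2 ->
    dist (f a) (f b) = minn (b - a) (m.+2 - (b - a)).
  move=> le_ab lt_b; apply/eqP; rewrite eqn_leq leq_min up // up' //=.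
  case: a b le_ab lt_b => [|a] [|b] // le_ab lt_b /=.
  - by rewrite subn0 subSS; apply: lowA.
  by rewrite subSS; apply: lowB.
(* For [m = 0] the vertex [y1] would lie in [S]; for [m = 1] it would have the two neighbours [s]
   and [x1] in [S], against [closed_in]. Hence the length [m.+2] is at least 4. *)
have m2 : 1 < m.
  case: (ltngtP m 1) => // [|m1].
    rewrite ltnS leqn0 => /eqP m0; move: nSy1; rewrite -w0.
    by rewrite m0 in wm; rewrite wm Sx1.
  have yx : adj y1 x1 by rewrite -w0 -wm m1; apply: adw; rewrite m1.
  have ys : adj y1 s by rewrite adjC.
  by move: sx1; rewrite (clS y1 s x1 nSy1 Ss Sx1 ys yx) adj_irrefl.
exists m.+2, (fun i => f (i %% m.+2)); split.
- by move: m2; nlia.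
- exact: iso_mod.
- by rewrite mod0n.
- by rewrite modn_small //= w0.
by rewrite modn_small //= wm.
Qed.

End Crossing.

(** * Adding an ear *)

Section Ears.
Variable G : sgraph.
Hypothesis cG : conn [set: G].
Implicit Types (A R S X : {set G}) (x y v w : G) (p z : nat -> G).

Lemma total_exc_set S X : [disjoint X & S] ->
  total_exc S + 2 * \sum_(x in X) \sum_(u in S) exc (X :|: S) x u
    + \sum_(x in X) \sum_(y in X) exc (X :|: S) x y <= total_exc (X :|: S).
Proof.
move=> dXS; have -> := total_exc_split cG (subsetUr X S).
have -> : (X :|: S) :\: S = X.
  by rewrite setDUl setDv setU0; apply/setDidPl.
by rewrite !leq_add2r total_exc_le // subsetUr.
Qed.

(** Each new vertex has row sum at least 4 on the cycle alone, which already pays the rate 4. A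
    pentagon guarantees only 2 and is treated separately. *)
Lemma step_cyc S N z : conn2 S -> N = 4 \/ 6 <= N -> iso N z -> z 0 \in S ->
  z 1 \notin S -> z N.-1 \in S -> step 2 S.
Proof.
move=> cS N46 iz S0 nS1 SN; have N4 : 3 < N by case: N46 => [->|]; nlia.
pose X := cyc N z :\: S; have XS : X :|: S = cyc N z :|: S.
  by apply/setP => v; rewrite !inE; case: (v \in S); rewrite ?orbT ?orbF.
have dXS : [disjoint X & S].
  by rewrite -setI_eq0; apply/eqP/setP => v; rewrite !inE; case: (v \in S); rewrite ?andbF.
exists (X :|: S); split.
- rewrite properUr //; apply/subsetPn; exists (z 1) => //.
  by rewrite in_setD nS1 mem_cyc.
- rewrite XS; apply: (@conn2U _ _ _ (z 0) (z N.-1)); rewrite ?mem_cyc //.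
    exact: conn2_cyc.
  apply/eqP => E; suff : 0 = N.-1 by move: N4; nlia.
  by apply: (iso_inj N4 iz (i := 0)) => //; move: N4; nlia.
have := total_exc_set dXS; rewrite cardsU (eqP (_ : X :&: S == set0)) ?cards0 ?subn0; last first.
  by rewrite setI_eq0.
have : 4 * #|X| <= \sum_(x in X) \sum_(u in S) exc (X :|: S) x u
    + \sum_(x in X) \sum_(y in X) exc (X :|: S) x y.
  rewrite mulnC -sum_nat_const -big_split /=; apply: leq_sum => x.
  rewrite in_setD => /andP[nSx /imsetP[i _ ->]]; move: (nat_of_ord i) => k.
  have sub : cyc N z \subset X :|: S by rewrite XS subsetUl.
  have -> : \sum_(u in S) exc (X :|: S) (z k) u + \sum_(y in X) exc (X :|: S) (z k) y
      = \sum_(u in X :|: S) exc (X :|: S) (z k) u.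
    rewrite [RHS](big_setID S) /=; congr (_ + _); apply: eq_bigl => u;
    by rewrite !inE; case: (u \in S); rewrite ?orbT ?andbF ?orbF.
  case: N46 => [N4'|N6]; last exact: (cyc_gain6 cG k N6 iz sub).
  by rewrite N4' in iz sub *; apply: cyc_gain4.
nlia.
Qed.

Lemma shortest_walk A x y : conn A -> x \in A -> y \in A -> exists n p,
  [/\ p 0 = x, p n = y, forall i, i <= n -> p i \in A,
      forall i, i < n -> adj (p i) (p i.+1)
    & forall i k, i.+1 < k -> k <= n -> p i != p k /\ ~~ adj (p i) (p k)].
Proof.
move=> cA Ax Ay; have [n [p [p0 pn Ap adp]] min_n] :=
  least_nat (conn_walk cA Ax Ay).
exists n, p; split=> // i k lt_ik le_k.
have sub a b : a <= b -> b <= n -> walk A (b - a) (p a) (p b).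
  move=> le_ab le_b; apply: walk_sub => // t /andP[_ lt_t].
    by apply: Ap; apply: leq_trans le_b.
  by apply: adp; apply: leq_trans le_b.
have W1 : walk A i x (p i).
  by have := sub 0 i isT ltac:(nlia); rewrite p0 subn0.
have W2 : walk A (n - k) (p k) y by have := sub k n le_k (leqnn n); rewrite pn.
split; apply/negP; [move/eqP => E | move=> a1].
  rewrite -E in W2; have := min_n _ (walk_cat W1 W2).
  by move: lt_ik le_k; nlia.
have W : walk A 1 (p i) (p k) by apply: walk1 => //; apply: Ap; move: lt_ik le_k; nlia.
have := min_n _ (walk_cat (walk_cat W1 W) W2).
by move: lt_ik le_k; nlia.
Qed.

Lemma conn2_ear2 S s s' y1 y2 : conn2 S -> s \in S -> s' \in S -> s != s' ->
  y1 \notin S -> y2 \notin S -> adj y1 s -> adj y2 s' -> adj y1 y2 ->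
  conn2 (y1 |: (y2 |: S)).
Proof.
move=> [cS cS1] Ss Ss' ns nS1 nS2 y1s y2s' y12.
have y21 : adj y2 y1 by rewrite adjC.
have top T : adj y2 y1 -> conn (y2 |: T) -> conn (y1 |: (y2 |: T)).
  by move=> _ cT; apply: (conn_add cT _ y12); apply: setU11.
split; first by apply: top => //; apply: conn_add y2s'.
move=> v; case: (boolP (v \in S)) => Sv.
  have -> : (y1 |: (y2 |: S)) :\ v = y1 |: (y2 |: (S :\ v)).
    apply/setP => u; rewrite !inE; case: (eqVneq u v) => //= ->.
    have [nv1 nv2] : v != y1 /\ v != y2.
      by split; apply: contraTneq Sv => ->.
    by rewrite (negbTE nv1) (negbTE nv2).
  case: (eqVneq v s') => [->|nvs'].
    rewrite setUCA; have cT : conn (y1 |: (S :\ s')).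
      by apply: (conn_add (cS1 s') _ y1s); rewrite !inE ns.
    by apply: (conn_add cT _ y21); apply: setU11.
  apply: top => //; apply: (conn_add (cS1 v) _ y2s').
  by rewrite !inE eq_sym nvs'.
have c1 : conn (y1 |: S) by apply: conn_add y1s.
have c2 : conn (y2 |: S) by apply: conn_add y2s'.
have -> : (y1 |: (y2 |: S)) :\ v = ([set y1] :\ v) :|: (([set y2] :\ v) :|: S).
  rewrite !setDUl; congr (_ :|: (_ :|: _)).
  by apply/setDidPl; rewrite disjoint_sym disjoints1.
have D1 u : [set u] :\ v = if u == v then set0 else [set u].
  apply/setP => t; rewrite !inE; case: (eqVneq u v) => [->|nu].
    by rewrite inE; case: eqVneq.
  by rewrite inE; case: (eqVneq t u) => [->|]; rewrite ?andbT ?andbF.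
rewrite !D1; case: eqVneq => _; case: eqVneq => _; rewrite ?set0U //.
exact: top.
Qed.

Section HalfEar.
Variables (S S' : {set G}) (s s' x y1 y2 : G).
Hypotheses (cS : conn2 S) (sS : S \subset S') (Ss : s \in S) (Ss' : s' \in S)
  (Sx : x \in S) (nS1 : y1 \notin S) (nS2 : y2 \notin S).
Hypothesis S'2 : y2 \in S'.
Hypotheses (as1 : adj s y1) (a12 : adj y1 y2) (a2s' : adj y2 s')
  (as'x : adj s' x) (axs : adj x s).
Hypothesis nss' : ~~ adj s s'.
Hypotheses (cl1 : forall v, v \in S -> adj y1 v -> v = s)
  (cl2 : forall v, v \in S -> adj y2 v -> v = s') (ess' : s != s').

(** Two units come from the pentagon [s y1 y2 s' x]. The third comes from a walk from [s] to [s'] in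
    [S] without [x]: it has at least two edges, while [s'] is at distance 2 from [y1], so a drop
    occurs. *)
Lemma half_ear : 3 <= \sum_(u in S) exc S' y1 u.
Proof.
have D1 u v : adj u v -> dist u v = 1 by apply: adj_dist1.
have a1s : adj y1 s by rewrite adjC.
have axs' : adj x s' by rewrite adjC.
have asx : adj s x by rewrite adjC.
have new v : v \in S -> y1 != v by apply: neq_new.
have new2 v : v \in S -> y2 != v by apply: neq_new.
have nxs : x != s := adjN axs.
have n1x : ~~ adj y1 x by apply: contra nxs => /cl1->.
have n1s' : ~~ adj y1 s' by apply: contra ess' => /cl1->.
have n2x : ~~ adj y2 x by apply: contraL as'x => /cl2-> //; rewrite adj_irrefl.
have D1x : dist y1 x = 2 by apply: dist2 a1s asx; rewrite ?new.
have D1s' : dist y1 s' = 2 by apply: dist2 a12 a2s'; rewrite ?new.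
have Dss' : dist s' s = 2 by apply: dist2 as'x axs; rewrite 1?eq_sym // adjC.
have Dx2 : dist x y2 = 2 by rewrite (distC cG); apply: dist2 a2s' as'x; rewrite ?new2.
have mS v : v \in S -> v \in S' := subsetP sS v.
have Ps : s \in S :\ x by rewrite !inE eq_sym nxs.
have Ps' : s' \in S :\ x by rewrite !inE (adjN as'x).
have [n [p [p0 pn Ap adp indp]]] := shortest_walk (cS.2 x) Ps Ps'.
have Sp i : i <= n -> p i \in S by move=> /Ap; rewrite inE => /andP[].
have xp i : i <= n -> p i != x by move=> /Ap; rewrite !inE => /andP[].
have n2 : 1 < n.
  case: (n) adp p0 pn => [|[|k]] // adp' p0 pn.
    by move: ess'; rewrite -p0 -pn eqxx.
  by move: nss'; rewrite -p0 -pn adp'.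
have y1p0 : adj y1 (p 0) by rewrite p0.
have Sp1 : p 1 \in S by apply: Sp; nlia.
have n1p1 : ~~ adj y1 (p 1).
  apply/negP => /(cl1 Sp1) E; have := adp 0 ltac:(nlia).
  by rewrite p0 E adj_irrefl.
have ind2 i : i.+2 <= n -> p i != p i.+2 /\ ~~ adj (p i) (p i.+2).
  by move=> le_i; apply: indp.
have [|j [le_j _ _ ext]] := first_drop cG y1p0 (new _ Sp1) n1p1 adp ind2.
  by rewrite pn D1s'.
have Sj : p j \in S by apply: Sp; nlia.
have Sj1 : p j.+1 \in S by apply: Sp; nlia.
have Sj2 : p j.+2 \in S by apply: Sp; nlia.
apply: (@extra_units _ cG S S' y1
  [:: (s', (s, x)); (x, (y2, s')); (p j.+2, (p j, p j.+1))]).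
  rewrite /= !inE !xpair_eqE !negb_or !negb_and (adjN as'x) andbT.
  rewrite [x == p _]eq_sym [x == p _]eq_sym !xp ?orbT //; nlia.
move=> v f; rewrite 2!in_cons mem_seq1 => /or3P[]/eqP[-> ->]; split=> //.
- by apply: mem_extra; rewrite ?mS ?D1x ?Dss' ?D1s' ?(D1 _ _ a1s) ?(D1 _ _ as'x).
- apply: mem_extra => //; rewrite ?D1x ?D1s' ?Dx2 ?(D1 _ _ a12) ?(D1 _ _ axs') //.
  exact: mS.
by apply: ext; apply: mS.
Qed.

End HalfEar.

End Ears.

Section Ears.
Variable G : sgraph.
Hypothesis cG : conn [set: G].
Implicit Types (A R S X : {set G}) (x y v w : G) (p z P : nat -> G).

Lemma step_mono c c' S : c <= c' -> step c' S -> step c S.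
Proof.
move=> le [S' [sS cS' le']]; exists S'; split=> //.
have := subset_leq_card (proper_sub sS); move: le le'; nia.
Qed.

Lemma sum_set2 (F : G -> nat) a b : a != b ->
  \sum_(x in a |: [set b]) F x = F a + F b.
Proof. by move=> nab; rewrite big_setU1 ?inE // big_set1. Qed.

Lemma sum_set3 (F : G -> nat) a b c : a != b -> a != c -> b != c ->
  \sum_(x in a |: (b |: [set c])) F x = F a + (F b + F c).
Proof.
by move=> nab nac nbc; rewrite big_setU1 ?sum_set2 // !inE negb_or nab.
Qed.

(** The configuration is symmetric under reversal, so [half_ear] serves both new vertices: two rows
    of 3, in both orders, make 12. *)
Lemma ear2 S s s' x y1 y2 : conn2 S -> s \in S -> s' \in S -> x \in S ->
  y1 \notin S -> y2 \notin S -> adj s y1 -> adj y1 y2 -> adj y2 s' ->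
  adj s' x -> adj x s -> ~~ adj s s' -> s != s' ->
  (forall v, v \in S -> adj y1 v -> v = s) ->
  (forall v, v \in S -> adj y2 v -> v = s') -> step 3 S.
Proof.
move=> cS Ss Ss' Sx nS1 nS2 as1 a12 a2s' as'x axs nss' ess' cl1 cl2.
pose X := y1 |: [set y2]; have n12 := adjN a12.
have dXS : [disjoint X & S].
  rewrite -setI_eq0; apply/eqP/setP => v; rewrite !inE.
  by apply/negP => /andP[/orP[]/eqP-> Sv]; [rewrite Sv in nS1 | rewrite Sv in nS2].
have EX : X :|: S = y1 |: (y2 |: S) by rewrite setUA.
have cX : #|X :|: S| = #|S|.+2.
  by rewrite EX !cardsU1 !inE negb_or n12 nS1 nS2.
have [sS m1 m2] : [/\ S \subset X :|: S, y1 \in X :|: S & y2 \in X :|: S].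
  by rewrite subsetUr !inE !eqxx orbT.
have le1 := half_ear cG cS sS Ss Ss' Sx nS1 nS2 m2 as1 a12 a2s' as'x axs
  nss' cl1 cl2 ess'.
have [a2s a21 as1'] : [/\ adj s' y2, adj y2 y1 & adj y1 s]
  by split; rewrite adjC.
have [asx axs' nss] : [/\ adj s x, adj x s' & ~~ adj s' s].
  by split; rewrite adjC.
have es's : s' != s by rewrite eq_sym.
have le2 := half_ear cG cS sS Ss' Ss Sx nS2 nS1 m1 a2s a21 as1' asx axs'
  nss cl2 cl1 es's.
exists (X :|: S); split.
- by rewrite properUr //; apply/subsetPn; exists y1; rewrite // !inE eqxx.
- rewrite EX; apply: (conn2_ear2 cS Ss Ss' ess' nS1 nS2) => //.
rewrite cX; have := total_exc_set cG dXS; rewrite sum_set2 //.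
by move: le1 le2; nlia.
Qed.

(** A shortest way from [s] to [s'] inside [S] that avoids the edge between them. The vertex [a]
    ensures that [s] has a neighbour other than [s'], and the absence of triangles over the edge
    forces length at least 3. *)
Lemma around_edge S s s' a : conn2 S -> s \in S -> s' \in S -> adj s s' ->
  a \in S -> a != s -> a != s' ->
  (forall t, t \in S -> adj s t -> adj s' t -> False) ->
  exists n P, [/\ P 0 = s, P n = s', forall i, i <= n -> P i \in S,
    forall i, i < n -> adj (P i) (P i.+1)
    & [/\ 2 < n, forall i, i.+2 <= n -> P i != P i.+2 /\ ~~ adj (P i) (P i.+2)
      & forall i k, i <= n -> k <= n -> P i = P k -> i = k]].
Proof.
move=> cS Ss Ss' ass' Sa nas nas' nocn.
pose Q m := exists t, [/\ t \in S, adj s t, t != s' & walk (S :\ s) m t s'].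
have [m [t [St ast nts' [p [p0 pm Ap adp]]]] min_m] :
    exists2 m, Q m & forall k, Q k -> m <= k.
  apply: least_nat.
  have s1 : s \in S :\ s' by rewrite !inE Ss (adjN ass').
  have a1 : a \in S :\ s' by rewrite !inE Sa nas'.
  have a2 : a \notin [set s] by rewrite inE.
  have [u [v [Au uX Av vX uv]]] := cS.2 s' [set s] s a s1 (set11 s) a1 a2.
  move/set1P: uX uv => -> sv; move: Av; rewrite !inE => /andP[nvs' Sv].
  have mv : v \in S :\ s by rewrite !inE Sv eq_sym (adjN sv).
  have ms' : s' \in S :\ s by rewrite !inE Ss' eq_sym (adjN ass').
  by have [n wn] := conn_walk (cS.2 s) mv ms'; exists n, v.
have Sp i : i <= m -> p i \in S by move=> /Ap; rewrite !inE => /andP[].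
have nsp i : i <= m -> s != p i by move=> /Ap; rewrite !inE eq_sym => /andP[].
have sub i k : i <= k -> k <= m -> walk (S :\ s) (k - i) (p i) (p k).
  move=> le_ik le_k; apply: walk_sub => // u /andP[_ lt_u].
    by apply: Ap; apply: leq_trans le_k.
  by apply: adp; apply: leq_trans le_k.
have indp i k : i.+1 < k -> k <= m -> p i != p k /\ ~~ adj (p i) (p k).
  move=> lt_ik le_k; have le_i : i <= m by move: lt_ik le_k; nlia.
  have W1 : walk (S :\ s) i t (p i) by have := sub 0 i isT le_i; rewrite p0 subn0.
  have W2 : walk (S :\ s) (m - k) (p k) s'.
    by have := sub k m le_k (leqnn m); rewrite pm.
  split; apply/negP; [move/eqP => E | move=> a1].
    rewrite -E in W2; have : m <= i + (m - k).
      by apply: min_m; exists t; split=> //; apply: walk_cat W1 W2.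
    by move: lt_ik le_k; nlia.
  have W : walk (S :\ s) 1 (p i) (p k) by apply: walk1 => //; apply: Ap.
  have : m <= i + 1 + (m - k).
    by apply: min_m; exists t; split=> //; apply: walk_cat (walk_cat W1 W) W2.
  by move: lt_ik le_k; nlia.
have injp i k : i <= m -> k <= m -> p i = p k -> i = k.
  wlog lt_ik : i k / i < k => [wl|] le_i le_k E.
    by case: (ltngtP i k) => // lt; [apply: wl | apply/esym/wl].
  case: (ltngtP i.+1 k) => [lt|lt|Ek].
  - by have [/eqP] := indp i k lt le_k.
  - by move: lt lt_ik; nlia.
  have lt_im : i < m by rewrite Ek.
  by have := adp i lt_im; rewrite Ek E adj_irrefl.
have m2 : 1 < m.
  case: (ltngtP m 1) => // [|m1].
    by rewrite ltnS leqn0 => /eqP E; move: nts'; rewrite -p0 -pm E eqxx.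
  case: (nocn t) => //; rewrite adjC -p0 -pm m1; apply: adp; by rewrite m1.
have ind0 k : 0 < k -> k < m -> ~~ adj s (p k).
  move=> k0 lt_k; apply/negP => sk; have : m <= m - k.
    apply: min_m; exists (p k); split=> //; first by apply: Sp; apply: ltnW.
      by rewrite -pm; apply/eqP => /(injp k m (ltnW lt_k) (leqnn m)) E;
        move: lt_k; rewrite E ltnn.
    by rewrite -pm; apply: sub => //; apply: ltnW.
  by move: k0 lt_k; nlia.
pose P i := if i is k.+1 then p k else s.
exists m.+1, P; split=> //.
- by case=> [|i] //=; rewrite ltnS; apply: Sp.
- by case=> [|i] /= lt_i; [rewrite p0 | apply: adp].
split=> //.
- case=> [|i] /= le_i; last exact: indp.
  by split; [apply: nsp; apply: ltnW | apply: ind0].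
case=> [|i] [|k] //=.
- by move=> _ /nsp/eqP.
- by move=> /nsp/eqP nE _ /esym.
by move=> le_i le_k /(injp i k le_i le_k) ->.
Qed.

End Ears.

Section NoTriangle.
Variable G : sgraph.
Hypothesis cG : conn [set: G].
Variables (S : {set G}) (s s' y1 y2 : G) (n : nat) (P : nat -> G).
Hypotheses (nS1 : y1 \notin S) (nS2 : y2 \notin S) (a1s : adj y1 s)
  (a21 : adj y2 y1) (na2s : ~~ adj y2 s).
Hypotheses (D1 : dist y1 s' <= 2) (D2 : dist y2 s' <= 2).
Hypothesis cl1 : forall v, v \in S -> adj y1 v -> v = s.
Hypotheses (P0 : P 0 = s) (Pn : P n = s') (SP : forall i, i <= n -> P i \in S).
Hypotheses (adP : forall i, i < n -> adj (P i) (P i.+1)) (n2 : 2 < n).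
Hypothesis indP :
  forall i, i.+2 <= n -> P i != P i.+2 /\ ~~ adj (P i) (P i.+2).
Hypothesis injP : forall i k, i <= n -> k <= n -> P i = P k -> i = k.

Let n0 : 0 < n. Proof. exact: ltn_trans n2. Qed.

Let P1s : P 1 != s.
Proof. by rewrite -P0; apply/eqP => /(injP n0 (leq0n n)). Qed.

Lemma end_unit (T : {set G}) : S \subset T -> exists2 j, j.+2 <= n &
  extra T y1 (P j.+2) (P j, P j.+1).
Proof using cG nS1 a1s D1 cl1 P0 Pn SP adP n2 indP injP.
move=> /subsetP sT.
have [||||j [le_j _ _ ext]] := @first_drop _ cG y1 P n _ _ _ adP indP.
- by rewrite P0.
- by apply: (neq_new nS1); apply: SP.
- by apply: contra P1s => /(cl1 (SP n0))->.
- by rewrite Pn; apply: leq_trans D1 _; apply: ltnW.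
have le_j1 := ltnW le_j.
exists j => //; apply: ext; apply/sT/SP => //; exact: ltnW.
Qed.

(** Here the walk along [P] starts one step earlier, at [y1]; the conditional is the vertex
    preceding [P j] on this longer walk. *)
Lemma mid_unit (T : {set G}) : S \subset T -> y1 \in T -> exists2 j, j < n &
  extra T y2 (P j.+1) (if j is k.+1 then P k else y1, P j).
Proof using cG nS1 nS2 a1s a21 na2s D2 cl1 P0 Pn SP adP n2 indP injP.
move=> /subsetP sT T1; pose Q i := if i is k.+1 then P k else y1.
have adQ i : i < n.+1 -> adj (Q i) (Q i.+1).
  by case: i => [|i] lt_i /=; [rewrite P0 | apply: adP].
have indQ i : i.+2 <= n.+1 -> Q i != Q i.+2 /\ ~~ adj (Q i) (Q i.+2).
  case: i => [|i] le_i /=; last exact: indP.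
  split; first by apply: (neq_new nS1); apply: SP.
  by apply: contra P1s => /(cl1 (SP n0))->.
have [|||j [le_j _ _ ext]] := @first_drop _ cG y2 Q n.+1 a21 _ _ adQ indQ.
- by rewrite /= P0 (neq_new nS2) // -P0 SP.
- by rewrite /= P0.
- by rewrite /= Pn; apply: leq_trans D2 (leqW (ltnW n2)).
exists j => //; apply: ext => //.
  by case: j le_j => [|k] le_k //=; apply/sT/SP/ltnW/ltnW.
by apply/sT/SP; exact: ltnW.
Qed.

End NoTriangle.

(* An ear [s y1 y2 y3 s'] that closes a pentagon over the edge [s s']. *)
Section Ear3.
Variable G : sgraph.
Hypothesis cG : conn [set: G].
Variables (S : {set G}) (s s' y1 y2 y3 : G).
Let X := y1 |: (y2 |: [set y3]).
Let S' := X :|: S.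
Hypotheses (cS : conn2 S) (cS' : conn2 S') (Ss : s \in S) (Ss' : s' \in S).
Hypotheses (nS1 : y1 \notin S) (nS2 : y2 \notin S) (nS3 : y3 \notin S).
Hypotheses (ass' : adj s s') (as1 : adj s y1) (a12 : adj y1 y2)
  (a23 : adj y2 y3) (a3s' : adj y3 s').
Hypotheses (n13 : y1 != y3) (na13 : ~~ adj y1 y3) (nas2 : ~~ adj s y2)
  (nas'2 : ~~ adj s' y2).
Hypotheses (cl1 : forall v, v \in S -> adj y1 v -> v = s)
  (cl3 : forall v, v \in S -> adj y3 v -> v = s').

Let D1 (u v : G) : adj u v -> dist u v = 1. Proof. exact: adj_dist1. Qed.

Let as's : adj s' s. Proof. by rewrite adjC. Qed.
Let a1s : adj y1 s. Proof. by rewrite adjC. Qed.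
Let a21 : adj y2 y1. Proof. by rewrite adjC. Qed.
Let a32 : adj y3 y2. Proof. by rewrite adjC. Qed.
Let as'3 : adj s' y3. Proof. by rewrite adjC. Qed.
Let ess' : s != s' := adjN ass'.
Let na1s' : ~~ adj y1 s'.
Proof. by apply: contraNN ess' => /cl1->. Qed.
Let na3s : ~~ adj y3 s.
Proof. by apply: contraNN ess' => /cl3->. Qed.
Let ny1 (v : G) : v \in S -> y1 != v. Proof. exact: neq_new. Qed.
Let ny2 (v : G) : v \in S -> y2 != v. Proof. exact: neq_new. Qed.
Let ny3 (v : G) : v \in S -> y3 != v. Proof. exact: neq_new. Qed.
Let D1s' : dist y1 s' = 2. Proof. by apply: dist2 a1s ass'; rewrite ?ny1. Qed.
Let D3s : dist y3 s = 2. Proof. by apply: dist2 a3s' as's; rewrite ?ny3. Qed.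
Let D13 : dist y1 y3 = 2. Proof. exact: dist2 a12 a23. Qed.
Let D2s : dist y2 s = 2.
Proof. by apply: dist2 a21 a1s; rewrite ?ny2 // adjC. Qed.
Let D2s' : dist y2 s' = 2.
Proof. by apply: dist2 a23 a3s'; rewrite ?ny2 // adjC. Qed.

(** For each of the five pairs at distance 2 in the pentagon, the middle edge of the longer arc. *)
Lemma ear3_units (T : {set G}) : S \subset T -> y1 \in T -> y2 \in T -> y3 \in T ->
  [/\ extra T y1 s' (y2, y3), extra T y3 s (y2, y1), extra T y2 s (y3, s'),
      extra T y2 s' (y1, s) & extra T y1 y3 (s, s')].
Proof.
move=> /subsetP sT T1 T2 T3; have [Ts Ts'] := (sT _ Ss, sT _ Ss').
have Ds'2 : dist s' y2 = 2 by rewrite distC.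
have Ds'1 : dist s' y1 = 2 by rewrite distC.
have Ds2 : dist s y2 = 2 by rewrite distC.
have Ds3 : dist s y3 = 2 by rewrite distC.
have D31 : dist y3 y1 = 2 by rewrite distC.
have E1 := D1 a12; have E2 := D1 a21; have E3 := D1 a23; have E4 := D1 a32.
have E5 := D1 as1; have E6 := D1 a1s; have E7 := D1 as'3; have E8 := D1 a3s'.
have E9 := D1 ass'; have E10 := D1 as's.
by split; apply: mem_extra;
  rewrite // ?D1s' ?D3s ?D13 ?D2s ?D2s' ?Ds'2 ?Ds'1 ?Ds2 ?Ds3 ?D31
    ?E1 ?E2 ?E3 ?E4 ?E5 ?E6 ?E7 ?E8 ?E9 ?E10.
Qed.

Let dXS : [disjoint X & S].
Proof.
rewrite -setI_eq0; apply/eqP/setP => v; rewrite !inE; apply/negP => /andP[].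
by case/or3P=> /eqP->; apply/negP.
Qed.

Let e12 : y1 != y2 := adjN a12.
Let e23 : y2 != y3 := adjN a23.
Let sS : S \subset S'. Proof. exact: subsetUr. Qed.
Let m1 : y1 \in S'. Proof. by rewrite !inE eqxx. Qed.
Let m2 : y2 \in S'. Proof. by rewrite !inE eqxx orbT. Qed.
Let m3 : y3 \in S'. Proof. by rewrite !inE eqxx !orbT. Qed.

(** The final 2 is the pair [y1], [y3] inside the ear, in both orders. *)
Lemma ear3_step c : 2 * c * 3 <= 2 * (\sum_(u in S) exc S' y1 u
    + (\sum_(u in S) exc S' y2 u + \sum_(u in S) exc S' y3 u)) + 2 -> step c S.
Proof.
move=> le; exists S'; split=> //.
  by rewrite properE sS; apply/subsetPn; exists y1.
have cX : #|X| = 3 by rewrite !cardsU1 !inE cards1 negb_or e12 n13 e23.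
have := total_exc_set cG dXS; rewrite (sum_set3 (fun x => \sum_(u in S) exc _ x u)) //.
have -> : #|X :|: S| = 3 + #|S|.
  by rewrite cardsU (eqP (_ : X :&: S == set0)) ?setI_eq0 // cards0 subn0 cX.
have [_ _ _ _ ex13] := ear3_units sS m1 m2 m3.
have le13 := exc_extra cG ex13.
have X1 : y1 \in X by rewrite !inE eqxx.
have X3 : y3 \in X by rewrite !inE eqxx !orbT.
have leB : 2 <= \sum_(x in X) \sum_(y in X) exc S' x y.
  apply: leq_trans (leq_sum2 _ X1 X3 n13); apply: (@leq_add 1 1).
    exact: leq_trans (leq_sum1 _ X3).
  by apply: leq_trans (leq_sum1 _ X1); rewrite exc_sym.
move: le leB; rewrite -/S'; nlia.
Qed.

(** At distance 3, [y2] and [t] are joined by a geodesic along either side of the pentagon, and two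
    of the doubled levels count. The rows of [y1], [y2], [y3] reach 2, 4, 2, and 2 (2 + 4 + 2) + 2 =
    18. *)
Lemma ear3_far t : t \in S -> adj t s -> adj t s' -> 2 < dist y2 t ->
  step 3 S.
Proof.
move=> St ts ts' far; apply: ear3_step.
have [u1 u3 u2s u2s' _] := ear3_units sS m1 m2 m3.
have nts : t != s := adjN ts; have nts' : t != s' := adjN ts'.
have na1t : ~~ adj y1 t by apply: contra nts => /(cl1 St)->.
have na3t : ~~ adj y3 t by apply: contra nts' => /(cl3 St)->.
have D1t : dist y1 t = 2 by apply: dist2 a1s _; rewrite ?ny1 // adjC.
have D3t : dist y3 t = 2 by apply: dist2 a3s' _; rewrite ?ny3 // adjC.
have D2t : dist y2 t = 3.
  by have := dist_tri cG y1 y2 t; rewrite D1t (D1 a21); move: far; nlia.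
have Dt1 : dist t y1 = 2 by rewrite distC.
have Dt3 : dist t y3 = 2 by rewrite distC.
have Dt2 : dist t y2 = 3 by rewrite distC.
have S's : s \in S' := subsetP sS s Ss.
have S's' : s' \in S' := subsetP sS s' Ss'.
have v1 : extra S' y1 t (y2, y3).
  by apply: mem_extra; rewrite ?D13 ?Dt3 ?Dt2 ?D1t ?(D1 a12).
have v3 : extra S' y3 t (y2, y1).
  by apply: mem_extra; rewrite ?D31 ?(distC cG y3 y1) ?D13 ?Dt1 ?Dt2 ?D3t ?(D1 a32).
have le1 : 2 <= \sum_(u in S) exc S' y1 u.
  apply: (@extra_units _ cG S S' y1 [:: (s', (y2, y3)); (t, (y2, y3))]).
    by rewrite /= mem_seq1 xpair_eqE eq_sym (negbTE nts').
  by move=> v f; rewrite in_cons mem_seq1 => /orP[]/eqP[-> ->].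
have le3 : 2 <= \sum_(u in S) exc S' y3 u.
  apply: (@extra_units _ cG S S' y3 [:: (s, (y2, y1)); (t, (y2, y1))]).
    by rewrite /= mem_seq1 xpair_eqE eq_sym (negbTE nts).
  by move=> v f; rewrite in_cons mem_seq1 => /orP[]/eqP[-> ->].
have le2 : 4 <= \sum_(u in S) exc S' y2 u.
  have Dts : dist t s = 1 := D1 ts.
  have Dts' : dist t s' = 1 := D1 ts'.
  apply: (@units _ cG S S' y2
    [:: (s, (y3, s')); (s', (y1, s)); (t, (y2, y3)); (t, (y3, s'))]).
    rewrite /= !in_cons !in_nil !xpair_eqE (negbTE ess') ![s == t]eq_sym (negbTE nts).
    by rewrite ![s' == t]eq_sym (negbTE nts') (negbTE e23) !andbF.
  have gd a b : a \in S' -> b \in S' -> adj a b -> dist y2 b = (dist y2 a).+1 ->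
      dist t a = (dist t b).+1 -> (dist y2 a + dist t b).+1 = 3 ->
      (a, b) \in good S' y2 t :&: geo_edges y2 t.
    by move=> *; rewrite in_setI mem_good //= inE /= D2t; apply/eqP.
  have g1 : (y2, y3) \in good S' y2 t :&: geo_edges y2 t.
    by apply: gd; rewrite ?distxx ?(D1 a23) ?Dt2 ?Dt3.
  have g2 : (y2, y1) \in good S' y2 t :&: geo_edges y2 t.
    by apply: gd; rewrite ?distxx ?(D1 a21) ?Dt2 ?Dt1.
  have g3 : (y3, s') \in good S' y2 t :&: geo_edges y2 t.
    by apply: gd; rewrite ?D2s' ?(D1 a23) ?Dt3 ?Dts'.
  have g4 : (y1, s) \in good S' y2 t :&: geo_edges y2 t.
    by apply: gd; rewrite ?D2s ?(D1 a21) ?Dt1 ?Dts.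
  move=> v f; rewrite 3!in_cons mem_seq1 => /or4P[]/eqP[-> ->].
  - by have /andP[-> /negbTE->] := u2s; split.
  - by have /andP[-> /negbTE->] := u2s'; split.
  - split=> // [|_]; first by move: g1; rewrite in_setI => /andP[].
    exists (y2, y1) => //=; split=> //.
    rewrite 3!in_cons mem_seq1 !xpair_eqE /= (negbTE nts) (negbTE nts').
    by rewrite (negbTE n13) (negbTE e23) !andbF.
  split=> // [|_]; first by move: g3; rewrite in_setI => /andP[].
  exists (y1, s) => //=; split=> //; last by rewrite (D1 a21) (D1 a23).
  by rewrite 3!in_cons mem_seq1 !xpair_eqE /= (negbTE nts) (negbTE nts')
    (negbTE n13) (negbTE e12) !andbF.
move: le1 le2 le3; nlia.
Qed.

(** The edges [(y1, s)] and [(y3, s')] are extra for [y2] and [t], but [y1] and [y3] are credited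
    only with their pentagon unit. The total 2 (1 + 4 + 1) + 2 = 14 pays for rate 4, not for rate
    6. *)
Lemma ear3_near t : t \in S -> adj t s -> adj t s' -> dist y2 t <= 2 ->
  step 2 S.
Proof.
move=> St ts ts' near; apply: ear3_step.
have [u1 u3 u2s u2s' _] := ear3_units sS m1 m2 m3.
have nts : t != s := adjN ts; have nts' : t != s' := adjN ts'.
have na1t : ~~ adj y1 t by apply: contra nts => /(cl1 St)->.
have na3t : ~~ adj y3 t by apply: contra nts' => /(cl3 St)->.
have Dt1 : dist t y1 = 2.
  by rewrite (distC cG); apply: dist2 a1s _; rewrite ?ny1 // adjC.
have Dt3 : dist t y3 = 2.
  by rewrite (distC cG); apply: dist2 a3s' _; rewrite ?ny3 // adjC.
have S's : s \in S' := subsetP sS s Ss.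
have S's' : s' \in S' := subsetP sS s' Ss'.
have v1 : extra S' y2 t (y1, s).
  by apply: mem_extra; rewrite ?D2s ?Dt1 ?(D1 a21) ?(D1 ts).
have v2 : extra S' y2 t (y3, s').
  by apply: mem_extra; rewrite ?D2s' ?Dt3 ?(D1 a23) ?(D1 ts').
have le1 : 1 <= \sum_(u in S) exc S' y1 u.
  exact: leq_trans (exc_extra cG u1) (leq_sum1 _ Ss').
have le3 : 1 <= \sum_(u in S) exc S' y3 u.
  exact: leq_trans (exc_extra cG u3) (leq_sum1 _ Ss).
have le2 : 4 <= \sum_(u in S) exc S' y2 u.
  apply: (@extra_units _ cG S S' y2
    [:: (s, (y3, s')); (s', (y1, s)); (t, (y1, s)); (t, (y3, s'))]).
    rewrite /= !in_cons !in_nil !xpair_eqE (negbTE ess') ![s == t]eq_sym (negbTE nts).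
    by rewrite ![s' == t]eq_sym (negbTE nts') (negbTE n13) !andbF.
  by move=> v f; rewrite 3!in_cons mem_seq1 => /or4P[]/eqP[-> ->].
move: le1 le2 le3; nlia.
Qed.

(** The long way around the edge is walked in both directions. Each direction adds one unit to an
    end of the ear and one to [y2], so the rows are again 2, 4, 2. *)
Lemma ear3_path a : a \in S -> a != s -> a != s' ->
  (forall t, t \in S -> adj s t -> adj s' t -> False) -> step 3 S.
Proof.
move=> Sa nas nas' noT.
have [n [P [P0 Pn SP adP [n2 indP injP]]]] :=
  around_edge cS Ss Ss' ass' Sa nas nas' noT.
pose P' i := P (n - i).
have P'0 : P' 0 = s' by rewrite /P' subn0.
have P'n : P' n = s by rewrite /P' subnn.
have SP' i : i <= n -> P' i \in S by move=> _; apply/SP/leq_subr.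
have adP' i : i < n -> adj (P' i) (P' i.+1).
  move=> lt_i; rewrite /P' adjC (_ : n - i = (n - i.+1).+1); first by apply: adP; nlia.
  by move: lt_i; nlia.
have indP' i : i.+2 <= n -> P' i != P' i.+2 /\ ~~ adj (P' i) (P' i.+2).
  move=> le_i; rewrite /P' eq_sym adjC (_ : n - i = (n - i.+2).+2).
    by apply: indP; move: le_i; nlia.
  by move: le_i; nlia.
have injP' i k : i <= n -> k <= n -> P' i = P' k -> i = k.
  by move=> le_i le_k /(injP _ _ (leq_subr _ _) (leq_subr _ _)); move: le_i le_k; nlia.
have na2s : ~~ adj y2 s by rewrite adjC.
have na2s' : ~~ adj y2 s' by rewrite adjC.
have le21 : dist y1 s' <= 2 by rewrite D1s'.
have le22 : dist y2 s' <= 2 by rewrite D2s'.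
have le23 : dist y3 s <= 2 by rewrite D3s.
have le24 : dist y2 s <= 2 by rewrite D2s.
have [u1 u3 u2s u2s' _] := ear3_units sS m1 m2 m3.
have [j1 lj1 e1] := end_unit cG nS1 a1s le21 cl1 P0 Pn SP adP n2 indP injP sS.
have [j3 lj3 e3] := end_unit cG nS3 a3s' le23 cl3 P'0 P'n SP' adP' n2 indP' injP' sS.
have [b1 lb1 f1] := mid_unit cG nS1 nS2 a1s a21 na2s le22 cl1 P0 Pn SP adP n2 indP injP sS m1.
have [b3 lb3 f3] := mid_unit cG nS3 nS2 a3s' a23 na2s' le24 cl3 P'0 P'n SP' adP' n2 indP' injP' sS m3.
have ltS j : j.+2 <= n -> j <= n by nlia.
have le1 : 2 <= \sum_(u in S) exc S' y1 u.
  apply: (@extra_units _ cG S S' y1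
    [:: (s', (y2, y3)); (P j1.+2, (P j1, P j1.+1))]).
    by rewrite /= mem_seq1 !xpair_eqE (negbTE (ny2 (SP _ (ltS _ lj1)))) andbF.
  by move=> v f; rewrite in_cons mem_seq1 => /orP[]/eqP[-> ->]; split=> //; apply: SP.
have le3 : 2 <= \sum_(u in S) exc S' y3 u.
  apply: (@extra_units _ cG S S' y3
    [:: (s, (y2, y1)); (P' j3.+2, (P' j3, P' j3.+1))]).
    by rewrite /= mem_seq1 !xpair_eqE (negbTE (ny2 (SP' _ (ltS _ lj3)))) andbF.
  by move=> v f; rewrite in_cons mem_seq1 => /orP[]/eqP[-> ->]; split=> //; apply: SP'.
have le2 : 4 <= \sum_(u in S) exc S' y2 u.
  have lb1' := ltnW lb1; have lb3' := ltnW lb3.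
  have lq b := leq_subr b n.
  have ln := leqnn n; have l0 := leq0n n.
  apply: (@extra_units _ cG S S' y2 [:: (s, (y3, s')); (s', (y1, s));
    (P b1.+1, (if b1 is k.+1 then P k else y1, P b1));
    (P' b3.+1, (if b3 is k.+1 then P' k else y3, P' b3))]).
    (* Injectivity of [P] turns any coincidence into equations between positions, which contradict
       the opposite orientations or [2 < n]. *)
    rewrite [uniq _]/= !in_cons !in_nil !orbF !andbT !xpair_eqE !negb_or (negbTE ess').
    apply/and3P; split; rewrite ?andTb; last first.
    - apply/negP => /andP[/eqP/(injP _ _ lb1 (lq _)) E1 /andP[_ /eqP/(injP _ _ lb1' (lq _))]].
      by move: E1 lb1 lb3; nlia.
    - apply/andP; split; apply/negP => /andP[/eqP E1 /andP[_ /eqP E2]].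
        move: E1 E2; rewrite -Pn -P0 => /(injP _ _ ln lb1) E1 /(injP _ _ l0 lb1').
        by move: E1 n2; nlia.
      by move: E1; rewrite -Pn => /(injP _ _ ln (lq _)); move: lb3; nlia.
    apply/andP; split; apply/negP => /andP[/eqP E1 /andP[_ /eqP E2]].
      by move: E1; rewrite -P0 => /(injP _ _ l0 lb1).
    move: E1 E2; rewrite -Pn -P0 => /(injP _ _ l0 (lq _)) E1 /(injP _ _ ln (lq _)).
    by move: E1 n2 lb3; nlia.
  move=> v f; rewrite 3!in_cons mem_seq1 => /or4P[]/eqP[-> ->]; split=> //.
    exact: SP.
  exact: SP'.
apply: ear3_step; move: le1 le2 le3; nlia.
Qed.

(** With [z] as a fourth new vertex there are two more pentagons, [s y1 y2 z t] and [s' y3 y2 z t].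
    The rows of [y1], [y2], [y3], [z] reach 2, 6, 2, 2, and twice their sum is exactly 6 for each of
    four vertices. *)
Lemma ear3_wide t z : t \in S -> z \notin S -> adj t s -> adj t s' ->
  adj y2 z -> adj z t -> ~~ adj y2 t -> ~~ adj z s -> ~~ adj z s' ->
  ~~ adj z y1 -> ~~ adj z y3 -> step 3 S.
Proof.
move=> St nSz ts ts' a2z zt na2t nzs nzs' nz1 nz3.
have nts : t != s := adjN ts; have nts' : t != s' := adjN ts'.
have na1t : ~~ adj y1 t by apply: contra nts => /(cl1 St)->.
have na3t : ~~ adj y3 t by apply: contra nts' => /(cl3 St)->.
have n2z : y2 != z := adjN a2z.
have n1z : y1 != z by apply: contraNneq na1t => ->.
have n3z : y3 != z by apply: contraNneq na3t => ->.
have nzS v : v \in S -> z != v by apply: neq_new.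
have az2 : adj z y2 by rewrite adjC.
have atz : adj t z by rewrite adjC.
have nS'z : z \notin S' by rewrite !inE negb_or !(eq_sym z) !negb_or n1z n2z n3z.
have Dt1 : dist t y1 = 2.
  by rewrite (distC cG); apply: dist2 a1s _; rewrite ?ny1 // adjC.
have Dt3 : dist t y3 = 2.
  by rewrite (distC cG); apply: dist2 a3s' _; rewrite ?ny3 // adjC.
have D1t : dist y1 t = 2 by rewrite distC.
have D3t : dist y3 t = 2 by rewrite distC.
have D2t : dist y2 t = 2 by apply: dist2 a2z zt; rewrite ?ny2.
have Dt2 : dist t y2 = 2 by rewrite distC.
have Dz1 : dist z y1 = 2 by apply: dist2 az2 a21; rewrite // eq_sym.
have Dz3 : dist z y3 = 2 by apply: dist2 az2 a23; rewrite // eq_sym.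
have D1z : dist y1 z = 2 by rewrite distC.
have D3z : dist y3 z = 2 by rewrite distC.
have Dzs : dist z s = 2 by apply: dist2 zt ts; rewrite ?nzS.
have Dzs' : dist z s' = 2 by apply: dist2 zt ts'; rewrite ?nzS.
have Dsz : dist s z = 2 by rewrite distC.
have Ds'z : dist s' z = 2 by rewrite distC.
have Ds2 : dist s y2 = 2 by rewrite distC.
have Ds'2 : dist s' y2 = 2 by rewrite distC.
pose T := z |: S'.
have sT : S \subset T by apply: subset_trans sS (subsetUr _ _).
have [T1 T2 T3] : [/\ y1 \in T, y2 \in T & y3 \in T].
  by split; apply: setU1r.
have Tz : z \in T by apply: setU11.
have [Ts Ts' Tt] : [/\ s \in T, s' \in T & t \in T].
  by split; apply: (subsetP sT).
have [u1 u3 u2s u2s' _] := ear3_units sT T1 T2 T3.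
have [Dz2 D2z Dzt Dtz] := And4 (D1 az2) (D1 a2z) (D1 zt) (D1 atz).
have [Dts Dts' D12 D32] := And4 (D1 ts) (D1 ts') (D1 a12) (D1 a32).
have [Dst Ds't] : dist s t = 1 /\ dist s' t = 1.
  by rewrite !(distC cG _ t).
have [D21 D23] := conj (D1 a21) (D1 a23).
have [Ds1 Ds'3] := conj (D1 as1) (D1 as'3).
have v1 : extra T y1 t (y2, z) by apply: mem_extra; rewrite ?D1z ?D12 ?Dt2 ?Dtz ?D1t.
have v3 : extra T y3 t (y2, z) by apply: mem_extra; rewrite ?D3z ?D32 ?Dt2 ?Dtz ?D3t.
have v2 : extra T y2 s (z, t) by apply: mem_extra; rewrite ?D2z ?D2t ?Dsz ?Dst ?D2s.
have v2' : extra T y2 s' (z, t) by apply: mem_extra; rewrite ?D2z ?D2t ?Ds'z ?Ds't ?D2s'.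
have w2 : extra T y2 t (y1, s) by apply: mem_extra; rewrite ?D2s ?Dt1 ?D21 ?Dts ?D2t.
have w2' : extra T y2 t (y3, s') by apply: mem_extra; rewrite ?D2s' ?Dt3 ?D23 ?Dts' ?D2t.
have vz : extra T z s (y2, y1) by apply: mem_extra; rewrite ?Dz1 ?Dz2 ?Ds2 ?Ds1 ?Dzs.
have vz' : extra T z s' (y2, y3) by apply: mem_extra; rewrite ?Dz3 ?Dz2 ?Ds'2 ?Ds'3 ?Dzs'.
have le1 : 2 <= \sum_(u in S) exc T y1 u.
  apply: (@extra_units _ cG S T y1 [:: (s', (y2, y3)); (t, (y2, z))]).
    by rewrite /= mem_seq1 !xpair_eqE eq_sym (negbTE nts').
  by move=> v f; rewrite in_cons mem_seq1 => /orP[]/eqP[-> ->].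
have le3 : 2 <= \sum_(u in S) exc T y3 u.
  apply: (@extra_units _ cG S T y3 [:: (s, (y2, y1)); (t, (y2, z))]).
    by rewrite /= mem_seq1 !xpair_eqE eq_sym (negbTE nts).
  by move=> v f; rewrite in_cons mem_seq1 => /orP[]/eqP[-> ->].
have lez : 2 <= \sum_(u in S) exc T z u.
  apply: (@extra_units _ cG S T z [:: (s, (y2, y1)); (s', (y2, y3))]).
    by rewrite /= mem_seq1 !xpair_eqE (negbTE ess').
  by move=> v f; rewrite in_cons mem_seq1 => /orP[]/eqP[-> ->].
have le2 : 6 <= \sum_(u in S) exc T y2 u.
  apply: (@extra_units _ cG S T y2 ([:: (s, (y3, s')); (s, (z, t)); (s', (y1, s))]
     ++ [:: (s', (z, t)); (t, (y1, s)); (t, (y3, s'))])).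
    rewrite /= !in_cons !in_nil !xpair_eqE (negbTE ess') ![s == t]eq_sym (negbTE nts).
    by rewrite ![s' == t]eq_sym (negbTE nts') (negbTE n13) (negbTE n3z) (negbTE n1z) !andbF.
  move=> v f; rewrite mem_cat => /orP[];
    by rewrite 2!in_cons mem_seq1 => /or3P[]/eqP[-> ->].
have cT : conn2 T.
  by apply: (@conn2_add _ S' z y2 t) => //; [apply: (subsetP sS) | apply: ny2].
pose Y := z |: X.
have EY : Y :|: S = T by rewrite /T /S' setUA.
have nXz : z \notin X by apply: contra nS'z => Xz; rewrite /S' inE Xz.
have dY : [disjoint Y & S].
  by rewrite -setI_eq0 setIUl setU_eq0 !setI_eq0 dXS andbT disjoints1.
have cX : #|X| = 3 by rewrite !cardsU1 !inE cards1 negb_or e12 n13 e23.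
exists T; split=> //; first by rewrite properE sT; apply/subsetPn; exists y1.
have := total_exc_set cG dY; rewrite EY big_setU1 //= (sum_set3 (fun x => \sum_(u in S) exc _ x u)) //.
have -> : #|T| = 4 + #|S|.
  rewrite -EY cardsU (eqP (_ : Y :&: S == set0)) ?setI_eq0 // cards0 subn0.
  by rewrite cardsU1 nXz cX.
by move: le1 le2 le3 lez; nlia.
Qed.

End Ear3.

(** * Growth to the whole graph *)

Section Steps.
Variable G : sgraph.
Hypothesis c2G : conn2 [set: G].
Let cG : conn [set: G] := c2G.1.
Implicit Types (A R S X : {set G}) (x y v w : G) (p z : nat -> G).

Definition long_iso := exists N z, 6 <= N /\ @iso G N z.

(** The part of the pentagon outside [S] has two or three vertices. Rate 6 is not immediate only for
    three, when the ends have a common neighbour [t] in [S] at distance at most 2 from [z 2].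
    Without induced 4-cycles [z 2] and [t] are not adjacent, and a common neighbour [w] of theirs
    either lies in [S], giving a two-vertex ear, or is added as a fourth vertex. *)
Lemma step_far S z : closed_in S -> conn2 S -> noncomplete S -> iso 5 z ->
  z 0 \in S -> z 1 \notin S -> z 4 \in S ->
  step 2 S /\ (noC4 G -> step 3 S).
Proof.
move=> clS cS ncS iz S0 nS1 S4.
have adz i : adj (z i) (z i.+1) by apply: (iso_adj cG (isT : 4 <= 5) iz).
have far i k : dist (z i) (z (i + k)) = 2 -> z i != z (i + k) /\ ~~ adj (z i) (z (i + k)).
  by move=> E; rewrite -(dist0 cG) (adj_dist cG) E.
have [n02 na02] : z 0 != z 2 /\ ~~ adj (z 0) (z 2) := far 0 2 (iz 0 2 isT).
have [n13 na13] : z 1 != z 3 /\ ~~ adj (z 1) (z 3) := far 1 2 (iz 1 2 isT).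
have [n24 na24] : z 2 != z 4 /\ ~~ adj (z 2) (z 4) := far 2 2 (iz 2 2 isT).
have [n03 na03] : z 0 != z 3 /\ ~~ adj (z 0) (z 3) := far 0 3 (iz 0 3 isT).
have E5 : z 5 = z 0 by have := iso_per cG iz 0.
have a40 : adj (z 4) (z 0) by have := adz 4; rewrite E5.
have cl1 v : v \in S -> adj (z 1) v -> v = z 0.
  by move=> Sv av; apply: (clS (z 1)) => //; rewrite adjC.
have nS2 : z 2 \notin S by apply: contra n02 => /cl1 ->.
case: (boolP (z 3 \in S)) => [S3|nS3].
  have cl2 v : v \in S -> adj (z 2) v -> v = z 3.
    by move=> Sv av; apply: (clS (z 2)).
  suff st3 : step 3 S by split=> //; apply: step_mono st3.
  exact: (ear2 cG cS S0 S3 S4 nS1 nS2 (adz 0) (adz 1) (adz 2) (adz 3) a40 na03 n03 cl1 cl2).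
have cl3 v : v \in S -> adj (z 3) v -> v = z 4.
  by move=> Sv av; apply: (clS (z 3)).
have a04 : adj (z 0) (z 4) by rewrite adjC.
have n04 := adjN a04; have na42 : ~~ adj (z 4) (z 2) by rewrite adjC.
set s := z 0 in cl1 S0 n02 na02 n03 na03 E5 a40 a04 n04.
set s' := z 4 in cl3 S4 n24 na24 a40 a04 n04 na42.
have cS' : conn2 ((z 1 |: (z 2 |: [set z 3])) :|: S).
  have -> : (z 1 |: (z 2 |: [set z 3])) :|: S = S :|: cyc 5 z.
    apply/setP => v; rewrite !inE; apply/idP/idP.
      case/orP=> [/or3P[]/eqP->|->//]; rewrite mem_cyc ?orbT //.
    case/orP=> [->|/imsetP[[i lti] _ ->]]; first by rewrite orbT.
    by case: i lti => [|[|[|[|[|i]]]]] //= _; rewrite ?eqxx ?orbT ?S0 ?S4 ?orbT.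
  apply: (@conn2U _ S (cyc 5 z) s s') => //; try exact: (mem_cyc cG _ iz).
  exact: (conn2_cyc cG _ iz).
have near := ear3_near cG cS' S0 S4 nS1 nS2 nS3 a04
  (adz 0) (adz 1) (adz 2) (adz 3) n13 na13 na02 na42 cl1 cl3.
have farr := ear3_far cG cS' S0 S4 nS1 nS2 nS3 a04
  (adz 0) (adz 1) (adz 2) (adz 3) n13 na13 na02 na42 cl1 cl3.
have wide := ear3_wide cG cS' S0 S4 nS1 nS2 nS3 a04
  (adz 0) (adz 1) (adz 2) (adz 3) n13 na13 na02 na42 cl1 cl3.
have pathc := ear3_path cG cS cS' S0 S4 nS1 nS2 nS3 a04
  (adz 0) (adz 1) (adz 2) (adz 3) n13 na13 na02 na42 cl1 cl3.
case: (classic (exists2 t, t \in S & adj t s && adj t s')) => [[t St /andP[ts ts']]|noT]; last first.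
  suff st3 : step 3 S by split=> //; apply: step_mono st3.
  have [a Sa /andP[nas nas']] : exists2 a, a \in S & (a != s) && (a != s').
    have [x [y [Sx Sy nxy naxy]]] := ncS.
    case: (boolP ((x != s) && (x != s'))) => [xs|]; first by exists x.
    case: (boolP ((y != s) && (y != s'))) => [ys|]; first by exists y.
    rewrite !negb_and !negbK => /orP[]/eqP Ey /orP[]/eqP Ex; move: nxy naxy;
      by rewrite Ex Ey ?eqxx // ?a04 ?a40.
  apply: (pathc a) => // t St st s't; apply: noT; exists t => //.
  by rewrite !(adjC t) st.
case: (leqP (dist (z 2) t) 2) => [le2|lt2]; last first.
  suff st3 : step 3 S by split=> //; apply: step_mono st3.
  exact: (farr t).
split=> [|nC4]; first exact: (near t).
have nts := adjN ts; have nts' := adjN ts'.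
have na1t : ~~ adj (z 1) t by apply: contra nts => /(cl1 t St)->.
have na3t : ~~ adj (z 3) t by apply: contra nts' => /(cl3 t St)->.
have n1t : z 1 != t by exact: (neq_new nS1 St).
have n2t : z 2 != t by exact: (neq_new nS2 St).
have n3t : z 3 != t by exact: (neq_new nS3 St).
have na2t : ~~ adj (z 2) t.
  by apply/negP => a2t; exact: (nC4 s (z 1) (z 2) t (adz 0) (adz 1) a2t ts n02 n1t na02 na1t).
have Dt : dist (z 2) t = 2 by apply/eqP; rewrite eqn_leq le2 (dist_ge2 cG).
have [w [a2w wt]] := dist2P cG Dt.
case: (boolP (w \in S)) => [Sw|nSw].
  have cl2 v : v \in S -> adj (z 2) v -> v = w.
    by move=> Sv av; apply: (clS (z 2)).
  have nsw : s != w by apply: contraNneq na02 => ->; rewrite adjC.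
  have n1w : z 1 != w by exact: (neq_new nS1 Sw).
  have na1w : ~~ adj (z 1) w by apply: contra nsw => /(cl1 w Sw)->.
  have nasw : ~~ adj s w.
    apply/negP => sw; have ws : adj w s by rewrite adjC.
    exact: (nC4 s (z 1) (z 2) w (adz 0) (adz 1) a2w ws n02 n1w na02 na1w).
  exact: (ear2 cG cS S0 Sw St nS1 nS2 (adz 0) (adz 1) a2w wt ts nasw nsw cl1 cl2).
have nws : ~~ adj w s.
  by apply: contra nts => ws; rewrite (clS w t s nSw St S0 wt ws).
have nws' : ~~ adj w s'.
  by apply: contra nts' => ws; rewrite (clS w t s' nSw St S4 wt ws).
have n0w : w != s by exact: (neq_new nSw S0).
have n4w : w != s' by exact: (neq_new nSw S4).
have nw1 : ~~ adj w (z 1).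
  apply/negP => w1; have tw : adj t w by rewrite adjC.
  have a10 : adj (z 1) s by rewrite adjC adz.
  have st : adj s t by rewrite adjC.
  exact: (nC4 w (z 1) s t w1 a10 st tw n0w n1t nws na1t).
have nw3 : ~~ adj w (z 3).
  apply/negP => w3; have tw : adj t w by rewrite adjC.
  have s't : adj s' t by rewrite adjC.
  exact: (nC4 w (z 3) s' t w3 (adz 3) s't tw n4w n3t nws' na3t).
exact: (wide t w).
Qed.

Lemma iso4_C4 z : iso 4 z -> noC4 G -> False.
Proof.
move=> iz nC4; have adz i : adj (z i) (z i.+1) by apply: (iso_adj cG (isT : 4 <= 4) iz).
have far i k : dist (z i) (z (i + k)) = 2 -> z i != z (i + k) /\ ~~ adj (z i) (z (i + k)).
  by move=> E; rewrite -(dist0 cG) (adj_dist cG) E.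
have [n02 na02] : z 0 != z 2 /\ ~~ adj (z 0) (z 2) := far 0 2 (iz 0 2 isT).
have [n13 na13] : z 1 != z 3 /\ ~~ adj (z 1) (z 3) := far 1 2 (iz 1 2 isT).
have E4 : z 4 = z 0 by have := iso_per cG iz 0.
have a30 : adj (z 3) (z 0) by have := adz 3; rewrite E4.
exact: (nC4 _ _ _ _ (adz 0) (adz 1) (adz 2) a30).
Qed.

Lemma step_out S : closed_in S -> conn2 S -> noncomplete S -> S != setT ->
  step 2 S /\ (noC4 G -> ~ long_iso -> step 3 S).
Proof.
move=> clS cS ncS nST; have [x [y [Sx Sy nxy _]]] := ncS.
have [|N [z [N4 iz S0 nS1 SN]]] := crossing c2G cS clS nST Sx.
  by exists y; rewrite // eq_sym.
case: (ltngtP N 5) => [lt5|gt5|E]; last first.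
- rewrite E in iz SN; have [st2 st3] := step_far clS cS ncS iz S0 nS1 SN.
  by split=> // nC4 _; apply: st3.
- split; first exact: (step_cyc cG cS (or_intror gt5) iz S0 nS1 SN).
  by move=> _ nl; case: nl; exists N, z.
have E : N = 4 by move: N4 lt5; nlia.
split; first exact: (step_cyc cG cS (or_introl E) iz S0 nS1 SN).
by move=> nC4; rewrite E in iz; have := iso4_C4 iz nC4.
Qed.

(** [e] is the deficit of the starting set, which no step increases. *)
Lemma grow_ind c e (P : {set G} -> Prop) :
  (forall S S', S \subset S' -> P S -> P S') ->
  (forall S, conn2 S -> P S -> S != setT -> step c S) ->
  forall S, conn2 S -> P S -> 2 * c * #|S| <= total_exc S + e ->
  2 * c * #|G| <= total_exc [set: G] + e.
Proof.
move=> mono st S; have [n] := ubnP (#|G| - #|S|).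
elim: n S => // n IH S; rewrite ltnS => le_n cS PS leS.
case: (eqVneq S setT) => [E|nST]; first by move: leS; rewrite E cardsT.
have [S' [pS' cS' leS']] := st S cS PS nST.
have ltc := proper_card pS'; have leG : #|S'| <= #|G| := max_card _.
apply: (IH S') => //; last by move: leS leS'; nlia.
  by move: ltc leG le_n; nlia.
exact: mono (proper_sub pS') PS.
Qed.

Lemma not_closed S : ~ closed_in S -> exists y a b,
  [/\ y \notin S, a \in S, b \in S & [/\ a != b, adj y a & adj y b]].
Proof.
move=> ncl; apply: NNPP => no; apply: ncl => y a b nSy Sa Sb ya yb.
by apply/eqP; apply/negP => /negP nab; apply: no; exists y, a, b; split.
Qed.

Lemma grow_slope2 S : conn2 S -> noncomplete S -> 4 * #|S| <= total_exc S ->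
  4 * #|G| <= total_exc [set: G].
Proof.
move=> cS nS leS; have := @grow_ind 2 0 (@noncomplete G) (@noncompleteS G) _ S cS nS.
rewrite !addn0; apply=> // {leS cS nS}S cS nS nST.
case: (classic (closed_in S)) => [clS|/not_closed].
  by have [] := step_out clS cS nS nST.
case=> y [a [b [nSy Sa Sb [nab ya yb]]]].
exact: (grow2 cG cS nS nSy Sa Sb nab ya yb).
Qed.

(* 20 is what a pentagon lacks: its total excess is 10 = 6 * 5 - 20. *)
Lemma grow_slope3 S : noC4 G -> ~ long_iso -> conn2 S -> noncomplete S ->
  robust S -> 6 * #|S| <= total_exc S + 20 -> 6 * #|G| <= total_exc [set: G] + 20.
Proof.
move=> nC4 nl cS nS rS leS.
pose P S := noncomplete S /\ @robust G S.
apply: (@grow_ind 3 20 P _ _ S cS _ leS) => //.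
  move=> A B sAB [nA rA]; split; first exact: noncompleteS nA.
  exact: robustS rA.
move=> {nS rS leS cS}S cS [nS rS] nST.
case: (classic (closed_in S)) => [clS|/not_closed].
  by have [_ st3] := step_out clS cS nS nST; apply: st3.
case=> y [a [b [nSy Sa Sb [nab ya yb]]]].
exact: (grow3 cG nC4 cS rS nS nSy Sa Sb nab ya yb).
Qed.

End Steps.

(** * Starting subgraphs *)

Section Starts.
Variable G : sgraph.
Hypothesis c2G : conn2 [set: G].
Let cG : conn [set: G] := c2G.1.
Implicit Types (A R S X Q T : {set G}) (x y v w : G) (p z : nat -> G).

Lemma iso_far N z i : 4 <= N -> iso N z -> z i != z (i + 2) /\ ~~ adj (z i) (z (i + 2)).
Proof.
move=> N4 iz; have E : dist (z i) (z (i + 2)) = 2.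
  by rewrite (iz i 2) //; move: N4; nlia.
by rewrite -(dist0 cG) (adj_dist cG) E.
Qed.

Lemma noncomplete_cyc N z : 4 <= N -> iso N z -> noncomplete (cyc N z).
Proof.
move=> N4 iz; have [n02 na02] := iso_far 0 N4 iz.
by exists (z 0), (z 2); split; rewrite ?(mem_cyc cG N4 iz).
Qed.

Lemma total_exc_rows c S : (forall x, x \in S -> c <= \sum_(y in S) exc S x y) ->
  c * #|S| <= total_exc S.
Proof. by move=> le; rewrite mulnC -sum_nat_const; apply: leq_sum. Qed.

Lemma start_even N z : N = 4 \/ 6 <= N -> iso N z -> 4 * #|G| <= total_exc [set: G].
Proof.
move=> EN iz; have N4 : 4 <= N by case: EN; nlia.
apply: (grow_slope2 c2G (conn2_cyc cG N4 iz) (noncomplete_cyc N4 iz)).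
apply: total_exc_rows => _ /imsetP[i _ ->]; case: EN => [E|N6].
  by subst N; apply: (cyc_gain4 cG i iz (subxx _)).
exact: (cyc_gain6 cG i N6 iz (subxx _)).
Qed.

Lemma start_5 z : noC4 G -> ~ long_iso G -> iso 5 z ->
  6 * #|G| <= total_exc [set: G] + 20.
Proof.
move=> nC4 nl iz; have N4 : 4 <= 5 by [].
apply: (grow_slope3 c2G nC4 nl (conn2_cyc cG N4 iz) (noncomplete_cyc N4 iz)).
  (* Deleting [z i] leaves [z i.+1] and [z (i.+1 + 2)], which are two apart. *)
  move=> v; suff [i [n1 n3]] : exists i, v != z i.+1 /\ v != z (i.+1 + 2).
    have [nz naz] := iso_far i.+1 N4 iz.
    by exists (z i.+1), (z (i.+1 + 2)); rewrite !inE !(mem_cyc cG N4 iz) ![_ == v]eq_sym n1 n3.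
  case: (boolP (v \in cyc 5 z)) => [/imsetP[i _ ->]|nv]; last first.
    by exists 0; split; apply: contraNneq nv => ->; apply: (mem_cyc cG N4 iz).
  have neq k : 0 < k < 5 -> z i != z (i + k).
    move=> lt_k; apply/eqP; rewrite -{1}[nat_of_ord i]addn0 => E.
    have := iso_inj N4 iz (isT : 0 < 5) _ E.
    by case/andP: lt_k => k0 k5 /(_ k5) E0; rewrite -E0 in k0.
  exists i; split; first by have := neq 1 isT; rewrite addn1.
  by have := neq 3 isT; rewrite addSnnS.
apply: (@leq_trans (10 + 20)); first by rewrite (card_cyc N4 iz).
rewrite leq_add2r -[10]/(2 * 5) -{1}(card_cyc N4 iz).
by apply: total_exc_rows => _ /imsetP[i _ ->]; apply: (cyc_gain5 cG i iz (subxx _)).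
Qed.

Lemma C4_iso : ~ (exists z, @iso G 4 z) -> noC4 G.
Proof.
move=> no a b c d ab bc cd da nac nbd naac nabd; apply: no.
have Dac : dist a c = 2 by apply: dist2 ab bc.
have Dbd : dist b d = 2 by apply: dist2 bc cd.
exists (fun i => nth a [:: a; b; c; d] (i %% 4)); apply: iso_mod => //.
have ad : adj a d by rewrite adjC.
by case=> [|[|[|[|i]]]] [|[|[|[|k]]]] //= _ _; rewrite ?distxx ?(adj_dist1 cG).
Qed.

Definition clique A := forall x y, x \in A -> y \in A -> x != y -> adj x y.

Lemma cliqueN A : ~ noncomplete A -> clique A.
Proof.
move=> nc x y Ax Ay nxy; apply: contraT => naxy; case: nc.
by exists x, y.
Qed.

Lemma cliqueS A X : A \subset X -> clique X -> clique A.
Proof. by move=> /subsetP sA cX x y /sA Xx /sA Xy; apply: cX. Qed.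

Lemma conn2_clique A : clique A -> conn2 A.
Proof.
have c1 X : clique X -> conn X.
  move=> cX Y x y Xx Yx Xy nYy; exists x, y; split=> //; apply: cX => //.
  by apply: contraNneq nYy => <-.
by move=> cA; split=> [|v]; apply: c1 => //; apply: cliqueS cA; apply: subsetDl.
Qed.

Lemma max_clique : exists2 Q, clique Q & forall A, clique A -> #|A| <= #|Q|.
Proof.
pose P k := exists2 Q, clique Q & #|G| - #|Q| = k.
have [|k [Q cQ E] mink] := @least_nat P.
  by exists (#|G| - #|@set0 G|), set0 => // x y; rewrite inE.
exists Q => // A cA; have := mink _ (ex_intro2 _ _ A cA erefl).
have lA : #|A| <= #|G| := max_card _; have lQ : #|Q| <= #|G| := max_card _.
by move: E lA lQ; nlia.
Qed.

Lemma clique_add Q y : clique Q -> (forall v, v \in Q -> adj y v) ->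
  clique (y |: Q).
Proof.
move=> cQ yQ u v; rewrite !inE => /orP[/eqP->|Qu] /orP[/eqP->|Qv] nuv.
- by rewrite eqxx in nuv.
- exact: yQ.
- by rewrite adjC yQ.
- exact: cQ.
Qed.

Lemma card_nbD Q y : #|Q :\: nbhd Q y| = #|Q| - #|nbhd Q y|.
Proof. by rewrite cardsD (setIidPr _) //; apply/subsetP => v; rewrite inE => /andP[]. Qed.

Lemma sum_const_le Q (F : G -> nat) c : (forall v, v \in Q -> c <= F v) ->
  c * #|Q| <= \sum_(v in Q) F v.
Proof. by move=> le; rewrite mulnC -sum_nat_const; apply: leq_sum. Qed.

(** A vertex of [Q] not adjacent to [y] has all of [nbhd Q y] as common neighbours with [y]. *)
Lemma clique_apex Q T y : clique Q -> Q \subset T -> y \in T -> y \notin Q ->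
  2 * #|nbhd Q y|.-1 * (#|Q| - #|nbhd Q y|) <= \sum_(v in Q) exc T y v.
Proof.
move=> cQ sQ Ty nQy; have sT := subsetP sQ.
case: (set_0Vmem (nbhd Q y)) => [->|[c0 c0y]]; first by rewrite cards0.
rewrite -card_nbD [leqRHS](big_setID (nbhd Q y)) /=; apply: leq_trans (leq_addl _ _).
apply: sum_const_le => v; rewrite in_setD => /andP[ny Qv].
apply: (exc_cn cG Ty (sT _ Qv) _ _ c0y).
- by apply: contraNneq nQy => ->.
- by rewrite nbC in ny.
- by apply: subset_trans sQ; apply/subsetP => u; rewrite inE => /andP[].
move=> u; rewrite inE => /andP[Qu yu]; rewrite yu cQ //.
by apply: contraNneq ny => <-; rewrite nbC.
Qed.

Lemma total_exc_pair Q x y : x \notin Q -> y \notin Q -> x != y ->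
  2 * (\sum_(v in Q) exc (x |: (y |: Q)) x v
    + \sum_(v in Q) exc (x |: (y |: Q)) y v + exc (x |: (y |: Q)) x y)
  <= total_exc (x |: (y |: Q)).
Proof.
move=> nQx nQy nxy; rewrite setUA; set T := _ :|: Q.
have dX : [disjoint x |: [set y] & Q].
  rewrite -setI_eq0; apply/eqP/setP => v; rewrite !inE; apply/negP => /andP[].
  by case/orP=> /eqP->; apply/negP.
have := total_exc_set cG dX; rewrite -/T (sum_set2 (fun x => \sum_(u in Q) exc T x u) nxy).
have : 2 * exc T x y <= \sum_(a in x |: [set y]) \sum_(b in x |: [set y]) exc T a b.
  rewrite (sum_set2 (fun x => \sum_(b in _) exc T x b) nxy).
  rewrite (sum_set2 (exc T x) nxy) (sum_set2 (exc T y) nxy).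
  by rewrite (exc_sym cG T y x); nlia.
nlia.
Qed.

Section Clique.
Variable Q : {set G}.
Hypotheses (cQ : clique Q) (maxQ : forall A, clique A -> #|A| <= #|Q|).
Let q := #|Q|.

Lemma nb_lt y : y \notin Q -> #|nbhd Q y| < q.
Proof.
move=> nQy; rewrite ltnNge; apply/negP => le.
have E : nbhd Q y = Q.
  apply/eqP; rewrite eqEcard le andbT; apply/subsetP => v.
  by rewrite inE => /andP[].
have /maxQ : clique (y |: Q).
  by apply: clique_add => // v Qv; rewrite -(nbC y Qv) E.
by rewrite cardsU1 nQy add1n ltnn.
Qed.

Lemma total_exc_clique_vertex y : 9 <= q -> y \notin Q -> setT = y |: Q ->
  2 < #|nbhd Q y| -> #|nbhd Q y| < q.-1 -> 4 * #|G| <= total_exc [set: G].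
Proof.
move=> q9 nQy E r2 rq; rewrite -cardsT.
have Ty : y \in y |: Q := setU11 _ _.
have := clique_apex cQ (subsetUr [set y] Q) Ty nQy.
have := total_exc_add cG nQy; rewrite E cardsU1 nQy -/q.
set s := \sum_(v in Q) _; set s' := \sum_(x in Q) _; move: r2 rq.
have [a Ea] : exists a, #|nbhd Q y| = a by eexists.
rewrite Ea => r2 rq le1 le2.
have : 2 * (q - 3) <= a.-1 * (q - a) by move: r2 rq; nia.
by move: q9 le1 le2; nlia.
Qed.

Lemma start_clique2 x y : noC4 G -> 3 <= q -> y \notin Q -> 2 <= #|nbhd Q y| ->
  x \notin y |: Q -> 2 <= #|nbhd (y |: Q) x| ->
  6 * #|x |: (y |: Q)| <= total_exc (x |: (y |: Q)) + 20.
Proof.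
move=> nC4 q3 nQy r2 nSx r2x.
have [nxy nQx] : x != y /\ x \notin Q.
  by move: nSx; rewrite in_setU1 negb_or => /andP[].
have -> : #|x |: (y |: Q)| = q + 2 by rewrite !cardsU1 nSx nQy /q addnC; nlia.
have := total_exc_pair nQx nQy nxy; set T := x |: _.
have Tx : x \in T := setU11 _ _.
have Ty : y \in T by apply: setU1r; apply: setU11.
have sQ : Q \subset T by apply: subset_trans (subsetUr _ _); apply: subsetUr.
have sQT := subsetP sQ.
have := clique_apex cQ sQ Ty nQy; have := nb_lt nQy.
have neqx v : v \in Q -> x != v by exact: (neq_new nQx).
have neqy v : v \in Q -> y != v by exact: (neq_new nQy).
set ey := \sum_(v in Q) exc T y v.
case: (leqP 2 #|nbhd Q x|) => [rx|rx].
  have := clique_apex cQ sQ Tx nQx; have := nb_lt nQx.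
  set ex := \sum_(v in Q) exc T x v => rxq lex ryq ley leE.
  have lin a : 2 <= a -> a < q -> 2 * (q - 2) <= 2 * a.-1 * (q - a) by nia.
  have lex' := leq_trans (lin _ rx rxq) lex.
  have ley' := leq_trans (lin _ r2 ryq) ley.
  case: (ltnP 3 q) => [q4|q3'].
    by move: lex' ley' leE q4; nlia.
  suff ge1 : 1 <= exc T x y by move: ge1 lex' ley' leE q3 q3'; nlia.
  have Eq : q = 3 by apply/eqP; rewrite eqn_leq q3 q3'.
  have miss (z : G) : z \notin Q -> 2 <= #|nbhd Q z| ->
      exists2 w, w \in Q /\ ~~ adj z w & forall v, v \in Q -> v != w -> adj z v.
    move=> nQz rz; have /eqP/cards1P[w Ew] : #|Q :\: nbhd Q z| = 1.
      by rewrite card_nbD; have := nb_lt nQz; move: rz Eq; rewrite /q; nlia.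
    have : w \in Q :\: nbhd Q z by rewrite Ew set11.
    rewrite in_setD => /andP[nzw Qw]; rewrite nbC // in nzw.
    exists w => // v Qv nvw; apply: contraT => nzv.
    have : v \in Q :\: nbhd Q z by rewrite in_setD nbC // nzv.
    by rewrite Ew in_set1 (negbTE nvw).
  have [w [Qw nyw] yQ] := miss y nQy r2.
  have [w' [Qw' nxw'] xQ] := miss x nQx rx.
  have qD : 2 <= #|Q :\ w| by have := cardsD1 w Q; rewrite Qw -/q Eq; nlia.
  case: (eqVneq w w') => [Ew|nww'].
    subst w'; have nxay : ~~ adj x y.
      apply/negP => xy; have /maxQ : clique (x |: (y |: (Q :\ w))).
        apply: clique_add => [|v]; last first.
          by rewrite in_setU1 in_setD1 => /orP[/eqP->|/andP[nv Qv]] //; apply: xQ.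
        apply: clique_add => [|v]; first exact: cliqueS (subsetDl _ _) cQ.
        by rewrite in_setD1 => /andP[nv Qv]; apply: yQ.
      rewrite !cardsU1 in_setU1 !in_setD1 (negbTE nxy) (negbTE nQx) (negbTE nQy) !andbF.
      by move: qD Eq; rewrite /q; nlia.
    have /card_gt1P[a [b [Da Db nab]]] := qD.
    move: Da Db; rewrite !in_setD1 => /andP[na Qa] /andP[nb' Qb].
    apply: ltnW; apply: (@exc_cn2 _ cG T x y a b) => //; rewrite ?sQT //; 
      by rewrite ?(adjC _ y) ?xQ ?yQ.
  have yw' : adj y w' by apply: yQ; rewrite // eq_sym.
  have xw : adj x w by apply: xQ.
  have w'w : adj w' w by apply: cQ; rewrite // eq_sym.
  have ww' : adj w w' by rewrite adjC.
  have nxay : ~~ adj x y.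
    apply/negP => xy; have wx : adj w x by rewrite adjC.
    exact: (nC4 x y w' w xy yw' w'w wx (neqx _ Qw') (neqy _ Qw) nxw' nyw).
  have [c /setD1P[ncw' /setD1P[ncw Qc]]] : exists c, c \in Q :\ w :\ w'.
    apply/set0Pn; rewrite -card_gt0; have := cardsD1 w' (Q :\ w).
    by rewrite in_setD1 Qw' eq_sym nww'; move: qD; nlia.
  have xc := xQ c Qc ncw'; have yc := yQ c Qc ncw; have cy : adj c y by rewrite adjC.
  have Dxy : dist x y = 2 by apply: dist2 xc cy.
  have Dyx : dist y x = 2 by rewrite distC.
  have Dyw : dist y w = 2 by apply: dist2 yw' w'w; rewrite ?neqy.
  have Dxw' : dist x w' = 2 by apply: dist2 xw ww'; rewrite ?neqx.
  have Eyw' := adj_dist1 cG yw'; have Exw := adj_dist1 cG xw.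
  rewrite (exc_sym cG); apply: (@exc_extra _ cG T y x (w', w)).
  by apply: mem_extra; rewrite ?Dyw ?Dxw' ?Dyx ?Eyw' ?Exw ?sQT.
have xy : adj x y.
  apply: contraT => nxay; move: r2x; rewrite leqNgt; case/negP.
  apply: leq_ltn_trans rx; apply/subset_leq_card/subsetP => v.
  rewrite !inE => /andP[/orP[/eqP->|->] xv //].
  by rewrite xv in nxay.
have [v Qv xv] : exists2 v, v \in Q & adj x v.
  have /card_gt1P[a [b [Da Db nab]]] := r2x.
  move: Da Db; rewrite !inE => /andP[/orP[/eqP Ea|Qa] xa]; last by exists a.
  by case/andP=> /orP[/eqP Eb|Qb xb]; [rewrite Ea Eb eqxx in nab | exists b].
have xonly u : u \in Q -> u != v -> ~~ adj x u.
  move=> Qu nuv; apply/negP => xu; move: rx; rewrite ltnNge; case/negP.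
  by apply/card_gt1P; exists u, v; split; rewrite ?nbC.
have yv : adj y v.
  have /card_gt0P[u] := ltnW r2; rewrite inE => /andP[Qu yu].
  apply: contraT => nyv; have nuv : u != v by apply: contraNneq nyv => <-.
  have vx : adj v x by rewrite adjC.
  have uv := cQ Qu Qv nuv.
  by case: (nC4 x y u v xy yu uv vx (neqx _ Qu) (neqy _ Qv) (xonly u Qu nuv) nyv).
have vNy : v \in nbhd Q y by rewrite nbC.
set ex := \sum_(u in Q) exc T x u => ryq ley leE.
set r := #|nbhd Q y| in r2 ryq ley.
have rU : #|nbhd Q y :\ v| = r.-1 by rewrite /r (cardsD1 v (nbhd Q y)) vNy.
have lex : r.-1 * (2 + (q - r)) <= ex.
  have -> : q - r = #|Q :\: nbhd Q y| by rewrite card_nbD.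
  rewrite mulnDr /ex (big_setID (nbhd Q y)) /=; apply: leq_add.
    rewrite (big_setD1 v) /=; last by rewrite in_setI Qv.
    apply: leq_trans (leq_addl _ _); rewrite mulnC -rU.
    have -> : (Q :&: nbhd Q y) :\ v = nbhd Q y :\ v.
      by congr (_ :\ _); apply/setIidPr/subsetP => u; rewrite inE => /andP[].
    apply: sum_const_le => u; rewrite in_setD1 inE => /and3P[nuv Qu yu].
    have vu : adj v u by apply: cQ; rewrite // eq_sym.
    by apply: (@exc_cn2 _ cG T x u v y) => //; rewrite ?sQT ?neqx ?xonly // eq_sym neqy.
  apply: sum_const_le => w; rewrite in_setD => /andP[ny Qw]; rewrite nbC // in ny.
  have nwv : w != v by apply: contraNneq ny => ->.
  have vw : adj v w by apply: cQ; rewrite // eq_sym.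
  have Dxw : dist x w = 2 by apply: dist2 xv vw; rewrite ?neqx ?xonly.
  have wv : adj w v by rewrite adjC.
  have vy : adj v y by rewrite adjC.
  have Dwy : dist w y = 2.
    by apply: dist2 wv vy; rewrite 1?eq_sym ?neqy // adjC.
  have inj : injective (pair y : G -> G * G) by move=> a b /(congr1 snd).
  rewrite -rU -(card_imset _ inj).
  have ext f : f \in [set (y, u) | u in nbhd Q y :\ v] -> extra T x w f.
    case/imsetP=> u; rewrite in_setD1 inE => /and3P[nuv Qu yu] ->.
    have nwu : w != u by apply: contraNneq ny => ->.
    have Ewu := adj_dist1 cG (cQ Qw Qu nwu); have Exy := adj_dist1 cG xy.
    have Dxu : dist x u = 2 by apply: dist2 xy yu; rewrite ?neqx ?xonly.
    by apply: mem_extra; rewrite // ?Dxu ?Dwy ?Dxw ?Ewu ?Exy ?sQT.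
  apply: (exc_ge cG); first by apply/subsetP => f /ext/andP[].
  by move=> f /ext/andP[_ /negbTE->].
have {}ley : 2 * r.-1 * (q - r) <= ey := ley.
move: r2 ryq ley lex leE; clearbody ex ey r q; move: (exc T x y) (total_exc T) => e E.
move=> r2 ryq ley lex leE.
have : 3 * q - 4 <= r.-1 * (2 + (q - r)) + 2 * r.-1 * (q - r).
  by move: r2 ryq; clear; nia.
by move: q3 ley lex leE; nlia.
Qed.

Lemma robust_clique x y : y \notin Q -> x \notin y |: Q ->
  robust (x |: (y |: Q)).
Proof.
move=> nQy nSx v; apply: NNPP => /cliqueN/maxQ.
have := cardsD1 v (x |: (y |: Q)); rewrite !cardsU1 nSx nQy; nlia.
Qed.

End Clique.

Lemma card_nb_gt1 A y a b : a \in A -> b \in A -> a != b -> adj y a ->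
  adj y b -> 2 <= #|nbhd A y|.
Proof. by move=> *; apply/card_gt1P; exists a, b; split; rewrite ?nbC. Qed.

Lemma start_clique : 10 <= #|G| -> noC4 G -> ~ long_iso G ->
  ~ (exists z, @iso G 5 z) ->
  [\/ 4 * #|G| <= total_exc [set: G], clique [set: G]
    | exists y Q, [/\ setT = y |: Q, y \notin Q, clique Q
        & #|nbhd Q y| = 2 \/ #|nbhd Q y| = #|G| - 2]].
Proof.
move=> n10 nC4 nl n5.
have attach S : conn2 S -> S != setT -> 2 <= #|S| -> exists2 y, y \notin S & 2 <= #|nbhd S y|.
  move=> cS nST /card_gt1P[s0 [s1 [Ss0 Ss1 ns]]].
  case: (classic (closed_in S)) => [clS|/not_closed].
    have [|N [z [N4 iz _ _ _]]] := crossing c2G cS clS nST Ss0.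
      by exists s1; rewrite // eq_sym.
    case: (ltngtP N 5) => [lt5|gt5|E].
    - have E : N = 4 by move: N4 lt5; nlia.
      by subst N; case: (iso4_C4 c2G iz nC4).
    - by case: nl; exists N, z.
    by subst N; case: n5; exists z.
  case=> y [a [b [nSy Sa Sb [nab ya yb]]]]; exists y => //.
  exact: card_nb_gt1 nab ya yb.
have [Q cQ maxQ] := max_clique.
have big A : #|A| <= 9 -> A != setT.
  by move=> leA; apply: contraTneq n10 => E; rewrite -cardsT -E -ltnNge ltnS.
have q3 : 3 <= #|Q|.
  have /card_gt0P[x _] : 0 < #|G| by move: n10; nlia.
  have cl1 : clique [set x].
    by move=> u v /set1P-> /set1P->; rewrite eqxx.
  have /subsetPn[y _ nxy] : ~~ (setT \subset [set x]).
    by rewrite subTset; apply: big; rewrite cards1.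
  have [u [v [_ /set1P-> _ nv xv]]] := cG (in_setT x) (set11 x) (in_setT y) nxy.
  have cl2 : clique (v |: [set x]).
    by apply: clique_add => // w /set1P->; rewrite adjC.
  have c2 : #|v |: [set x]| = 2 by rewrite cardsU1 nv cards1.
  have [||w nw] := attach _ (conn2_clique cl2).
  - by apply: big; rewrite c2.
  - by rewrite c2.
  rewrite -c2 => le; have E : nbhd (v |: [set x]) w = v |: [set x].
    by apply/eqP; rewrite eqEcard le andbT; apply/subsetP => t; rewrite inE => /andP[].
  have /maxQ : clique (w |: (v |: [set x])).
    by apply: clique_add => // t St; rewrite -(nbC w St) E.
  by rewrite cardsU1 nw c2.
case: (eqVneq Q setT) => [E|nQT]; first by apply: Or32; rewrite -E.
have [y nQy ry] := attach Q (conn2_clique cQ) nQT (ltnW q3).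
have /card_gt1P[a [b [Na Nb nab]]] := ry.
move: Na Nb; rewrite !inE => /andP[Qa ya] /andP[Qb yb].
have cQy := conn2_add (conn2_clique cQ) Qa Qb nab ya yb.
case: (eqVneq (y |: Q) setT) => [E|nQyT].
  have Eq : #|G| = #|Q|.+1 by rewrite -cardsT -E cardsU1 nQy.
  have rq := nb_lt cQ maxQ nQy.
  case: (eqVneq #|nbhd Q y| 2) => [E2|n2].
    by apply: Or33; exists y, Q; split; rewrite // E2; left.
  case: (eqVneq #|nbhd Q y| (#|G| - 2)) => [E2|nn2].
    by apply: Or33; exists y, Q; split=> //; right.
  apply: Or31; apply: (@total_exc_clique_vertex Q cQ y) => //.
  - by move: Eq n10; nlia.
  - by rewrite ltn_neqAle eq_sym n2.
  by move: rq nn2; rewrite Eq; lia.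
have [x nx rx] := attach _ cQy nQyT (leq_trans (ltnW q3) (subset_leq_card (subsetUr _ _))).
apply: Or31; have rb := robust_clique maxQ nQy nx.
have ncS : noncomplete (x |: (y |: Q)).
  by apply: noncompleteS (rb x); apply: subsetDl.
have /card_gt1P[a' [b' [Na Nb nab']]] := rx.
move: Na Nb; rewrite ![_ \in nbhd _ _]inE => /andP[Qa' ya'] /andP[Qb' yb'].
have cS := conn2_add cQy Qa' Qb' nab' ya' yb'.
have le := grow_slope3 c2G nC4 nl cS ncS rb (start_clique2 cQ maxQ nC4 q3 nQy ry nx rx).
by move: n10 le; nlia.
Qed.

Lemma total_exc_or_exceptional : 10 <= #|G| ->
  [\/ 4 * #|G| <= total_exc [set: G], clique [set: G]
    | exists y Q, [/\ setT = y |: Q, y \notin Q, clique Q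
        & #|nbhd Q y| = 2 \/ #|nbhd Q y| = #|G| - 2]].
Proof.
move=> n10.
case: (classic (exists z, @iso G 4 z)) => [[z iz]|/C4_iso nC4].
  by apply: Or31; apply: start_even iz; left.
case: (classic (long_iso G)) => [[N [z [N6 iz]]]|nl].
  by apply: Or31; apply: start_even iz; right.
case: (classic (exists z, @iso G 5 z)) => [[z iz]|n5].
  by apply: Or31; have := start_5 nC4 nl iz; move: n10; nlia.
exact: start_clique.
Qed.

End Starts.

(** * Exceptional graphs *)

Lemma k_connected_conn2 (G : sgraph) : k_connected G 2 -> conn2 [set: G].
Proof.
move=> [_ kG]; split=> [|v].
  by rewrite -setC0; apply/induced_conn/kG; rewrite cards0.
by rewrite setTD; apply/induced_conn/kG; rewrite cards1.
Qed.

Lemma iso_complete (G : sgraph) : clique [set: G] ->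
  isomorphic G (complete_graph #|G|).
Proof.
move=> cG; exists enum_rank; first exact: enum_rank_bij.
move=> x y; apply/idP/idP => [nxy|/adjN nxy]; last first.
  by apply: contraNneq nxy => /enum_rank_inj ->.
by apply: cG; rewrite ?inE //; apply: contraNneq nxy => ->.
Qed.

Section CompletePlus.
Variables (G : sgraph) (y : G) (Q : {set G}).
Hypotheses (E : setT = y |: Q) (nQy : y \notin Q) (cQ : clique Q).
Let L := enum (nbhd Q y) ++ enum (Q :\: nbhd Q y).
Let f (v : G) : option 'I_#|G|.-1 := insub (index v L).

Let mem_L v : (v \in L) = (v \in Q).
Proof. by rewrite mem_cat !mem_enum !inE; case: (v \in Q); case: (adj y v). Qed.

Let size_L : size L = #|G|.-1.
Proof.
have sN : nbhd Q y \subset Q by apply/subsetP => v; rewrite inE => /andP[].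
by rewrite size_cat -!cardE -{1}(setIidPr sN) cardsID -cardsT E cardsU1 nQy.
Qed.

Let f_Q v : v \in Q -> exists2 i, f v = Some i & val i = index v L.
Proof.
move=> Qv; rewrite /f; case: insubP => [i _ Ei|]; first by exists i.
by rewrite -size_L index_mem mem_L Qv.
Qed.

Let f_y : f y = None.
Proof. by rewrite /f insubN // -size_L index_mem mem_L. Qed.

Let Qor v : v = y \/ v \in Q.
Proof. by have := in_setT v; rewrite E => /setU1P. Qed.

Let index_inj u v : u \in Q -> index u L = index v L -> u = v.
Proof.
move=> Qu Eu; have Lu : u \in L by rewrite mem_L.
have Lv : v \in L by rewrite -index_mem -Eu index_mem.
by rewrite -(nth_index y Lu) Eu nth_index.
Qed.

Let index_lt v : v \in Q -> (index v L < #|nbhd Q y|) = adj y v.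
Proof.
move=> Qv; rewrite index_cat mem_enum nbC //; case: ifP => yv.
  by rewrite cardE index_mem mem_enum nbC.
by rewrite -cardE ltnNge leq_addr.
Qed.

Lemma iso_complete_plus t : t = #|nbhd Q y| ->
  isomorphic G (complete_plus #|G| t).
Proof.
move=> ->; exists f => [|u v].
  apply: inj_card_bij => [u v|]; last first.
    by rewrite card_option card_ord prednK //; apply/card_gt0P; exists y.
  case: (Qor u) (Qor v) => [->|Qu] [->|Qv] //.
  - by have [i -> _] := f_Q Qv; rewrite f_y.
  - by have [i -> _] := f_Q Qu; rewrite f_y.
  have [i -> Ei] := f_Q Qu; have [j -> Ej] := f_Q Qv => -[Eij].
  by apply: index_inj Qu _; rewrite -Ei -Ej Eij.
case: (Qor u) (Qor v) => [->|Qu] [->|Qv].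
- by rewrite !adj_irrefl.
- by have [i -> Ei] := f_Q Qv; rewrite f_y /= Ei index_lt.
- by have [i -> Ei] := f_Q Qu; rewrite f_y /= Ei index_lt // adjC.
have [i -> Ei] := f_Q Qu; have [j -> Ej] := f_Q Qv => /=.
apply/idP/idP => [nij|/adjN nuv].
  by apply: cQ => //; apply: contraNneq nij => Euv; apply/eqP/val_inj; rewrite Ei Euv.
by apply: contraNneq nuv => Eij; apply/eqP; apply: index_inj Qu _; rewrite -Ei -Ej Eij.
Qed.

End CompletePlus.

Theorem theorem6 (n : nat) (G : sgraph) (hn : 10 <= n) (hG : #|G| = n)
  (h2 : k_connected G 2) (hex : ~ exceptional n G) :
  ((2 * n)%:Z <= sw_gap G)%R.
Proof.
subst n; have c2G := k_connected_conn2 h2.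
have [le|cl|[y [Q [E nQy cQ t]]]] := total_exc_or_exceptional c2G hn.
- exact: (gap_ge c2G.1).
- by case: hex; apply: Or31; apply: iso_complete.
by case: hex; case: t => t; [apply: Or32|apply: Or33]; apply: iso_complete_plus E nQy cQ _ _.
Qed.
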